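(* With the media, domains and function spaces of the context, fix $k\in(-\pi,\pi)$. For $\Phi\in H^{1/2}_{\Theta,\#\#}(\Sigma_{\#\#})$ let $\widehat U^+_k[\Phi]$ be the unique solution of the half-guide problem $$\left\{\begin{array}{l}-\boldsymbol\nabla_k^T\Theta\,\mathbb{A}^+_p\,\Theta^T\boldsymbol\nabla_k\widehat U^+_k-\rho^+_p\,\omega^2\widehat U^+_k=0\quad\text{in }\Omega_{\#\#}^+,\\ \widehat U^+_k\in H^1_{\Theta,\#\#}(\Omega_{\#\#}^+),\quad\mathbb{A}^+_p\Theta^T\boldsymbol\nabla_k\widehat U^+_k\in H_{\Theta,\#\#}(\mathbf{div};\Omega_{\#\#}^+),\\ \widehat U^+_k=\Phi\quad\text{on }\Sigma_{\#\#},\end{array}\right.$$ and let $\mathcal P_k\in\mathscr L(H^{1/2}_{\Theta,\#\#}(\Sigma_{\#\#}))$ be the propagation operator $\mathcal P_k\Phi:=\widehat U_k^+[\Phi]|_{\Sigma^1_{\#\#}}$. Then for any $\Phi\in H^{1/2}_{\Theta,\#\#}(\Sigma_{\#\#})$, $$\forall\,n\in\mathbb{N},\ \text{for a.e. }\mathbf y\in\Omega^+_{\#\#},\qquad\widehat U_k^+[\Phi](\mathbf y+n\boldsymbol e_x)=\widehat U_k^+[(\mathcal P_k)^n\Phi](\mathbf y),$$ so that $\widehat U_k^+[\Phi]|_{\Sigma^n_{\#\#}}=(\mathcal P_k)^n\Phi$ for all $n\in\mathbb{N}$. Furthermore, the spectral radius of $\mathcal P_k$ is strictly less than $1$.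
   Context: Media. $\mathbb{R}^2_\pm=\{(x,z):\pm x>0\}$, $\mathbf e_x=(1,0)$, $\mathbf e_z=(0,1)$; $\omega\in\mathbb{C}$ with $\mathrm{Im}\,\omega>0$. $\mathbb{A}^\pm\in C^0(\mathbb{R}^2;\mathbb{R}^{2\times2})$ and $\rho^\pm\in C^0(\mathbb{R}^2)$ are real; $\mathbb{A},\rho$ equal $\mathbb{A}^\pm,\rho^\pm$ on $\mathbb{R}^2_\pm$; $\mathbb{A}$ is symmetric and bounded, $\rho$ is bounded, and there are $a,r>0$ with $\xi^T\mathbb{A}(\mathbf x)\xi\ge a|\xi|^2$, $\rho(\mathbf x)\ge r$ for all $\mathbf x,\xi\in\mathbb{R}^2$. One of the following holds. (A) $\mathbb{A}^\pm,\rho^\pm$ are invariant under translations by $\mathbf e_x$ and $p_z^\pm\mathbf e_z$, $p_z^\pm>0$; then $\theta_1=1/p_z^+$, $\theta_2=1/p_z^-$, $\mathbb{A}_p^+(x,z_1,z_2)=\mathbb{A}^+(x,p_z^+z_1)$, and likewise for $\rho_p^+$. (B) $\mathbb{A}^-,\rho^-$ are constant and $\mathbb{A}^+,\rho^+$ are invariant under translations by $\mathbf e_x$ and $\mathbf p^+=(p_x^+,p_z^+)$, $p_z^+\neq0$; then $\theta_1=1/p_z^+$, $\theta_2=-p_x^+/p_z^+$, $\mathbb{A}_p^+(x,z_1,z_2)=\mathbb{A}^+(x+z_2+z_1p_x^+,\,z_1p_z^+)$, and likewise for $\rho_p^+$. In both cases $\mathbb{A}_p^+,\rho_p^+$ are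 continuous and $\mathbb{Z}^3$-periodic. $\Theta\in\mathbb{R}^{3\times2}$ has rows $(1,0),(0,\theta_1),(0,\theta_2)$; $\Theta^T\boldsymbol\nabla V=(\partial_xV,\theta_1\partial_{z_1}V+\theta_2\partial_{z_2}V)$, $\boldsymbol\nabla^T\Theta\boldsymbol W=\partial_xW_1+(\theta_1\partial_{z_1}+\theta_2\partial_{z_2})W_2$; $\Theta^T\boldsymbol\nabla_k$ and $\boldsymbol\nabla_k^T\Theta$ are obtained by replacing $\partial_{z_1}$ with $\partial_{z_1}+\mathrm ik$. Spaces. $\boldsymbol e_x=(1,0,0)$, $\Omega_{\#\#}^+=\mathbb{R}_+\times(0,1)^2$, $\Sigma^n_{\#\#}=\{n\}\times(0,1)^2$ for $n\in\mathbb{N}=\{0,1,\dots\}$, $\Sigma_{\#\#}=\Sigma_{\#\#}^0$; all $\Sigma_{\#\#}^n$ are identified with $\Sigma_{\#\#}$ by translation. For $K=I\times(0,1)^2$, $I$ an open interval, $C^\infty_{0,\#\#}(\overline K)$: restrictions to $K$ of functions $C^\infty$ on $\overline I\times\mathbb{R}^2$, $1$-periodic in $z_1,z_2$, compactly supported in $x\in\overline I$; $H^1_{\Theta,\#\#}(K)$ (resp. $H_{\Theta,\#\#}(\mathbf{div};K)$) is the closure of $C^\infty_{0,\#\#}(\overline K)$ (resp. $[C^\infty_{0,\#\#}(\overline K)]^2$) for the norm $(\|V\|_{L^2}^2+\|\Theta^T\boldsymbol\nabla V\|_{L^2}^2)^{1/2}$ (resp. $(\|\boldsymbol W\|_{L^2}^2+\|\boldsymbol\nabla^T\Theta\boldsymbol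 W\|_{L^2}^2)^{1/2}$). $H^{1/2}_{\Theta,\#\#}(\Sigma_{\#\#})$ is the space of traces on $\Sigma_{\#\#}$ of functions of $H^1_{\Theta,\#\#}(\Omega_{\#\#}^+)$ with the norm $\inf\{\|V\|:V|_{\Sigma_{\#\#}}=\Phi\}$. Traces on $\Sigma_{\#\#}^n$ are the continuous extensions of restrictions of smooth functions, and take values in $H^{1/2}_{\Theta,\#\#}(\Sigma_{\#\#})$. *)

(* Defs.v *)
From HB Require Import structures.
From mathcomp Require Import all_boot all_order all_algebra.
From mathcomp Require Import complex.
From mathcomp Require Import all_classical all_reals all_analysis.
Set Implicit Arguments.
Unset Strict Implicit.
Unset Printing Implicit Defensive.
Import Order.TTheory GRing.Theory Num.Theory.
Import numFieldNormedType.Exports.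
Local Open Scope classical_set_scope.
Local Open Scope ring_scope.
Local Open Scope complex_scope.

(* Points: (x, z) : R * R in the physical plane, (x, (z1, z2)) : R * (R * R)
   in the augmented space, (z1, z2) : R * R on the interfaces. *)

Definition invariant_by {R : realType} {T : Type} (f : R * R -> T) (v : R * R)
  : Prop := forall y, f (y + v) = f y.

Record medium (R : realType) := Medium {
  A_minus : R * R -> 'M[R]_2 ;
  A_plus : R * R -> 'M[R]_2 ;
  A_glob : R * R -> 'M[R]_2 ;
  rho_minus : R * R -> R ;
  rho_plus : R * R -> R ;
  rho_glob : R * R -> R ;
  A_minus_cont : continuous A_minus ;
  A_plus_cont : continuous A_plus ;
  rho_minus_cont : continuous rho_minus ;
  rho_plus_cont : continuous rho_plus ;
  A_globN : forall y, y.1 < 0 -> A_glob y = A_minus y ;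
  A_globP : forall y, 0 < y.1 -> A_glob y = A_plus y ;
  rho_globN : forall y, y.1 < 0 -> rho_glob y = rho_minus y ;
  rho_globP : forall y, 0 < y.1 -> rho_glob y = rho_plus y ;
  A_sym : forall y, (A_glob y)^T = A_glob y ;
  A_bounded : exists M : R, forall y i j, `|A_glob y i j| <= M ;
  rho_bounded : exists M : R, forall y, `|rho_glob y| <= M ;
  A_coercive : exists2 a : R, 0 < a &
    forall y (xi : 'cV[R]_2),
      a * (xi^T *m xi) 0 0 <= (xi^T *m A_glob y *m xi) 0 0 ;
  rho_coercive : exists2 r : R, 0 < r & forall y, r <= rho_glob y
}.

(* [ConfA pzp pzm]: p_z^+ and p_z^-; [ConfB pxp pzp]: p_x^+ and p_z^+. *)
Inductive configuration (R : realType) :=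
| ConfA of R & R
| ConfB of R & R.

Definition compatible {R : realType} (c : configuration R) (m : medium R)
  : Prop :=
  match c with
  | ConfA pzp pzm =>
    [/\ 0 < pzp, 0 < pzm,
        [/\ invariant_by (A_plus m) (1, 0), invariant_by (A_plus m) (0, pzp),
            invariant_by (rho_plus m) (1, 0) &
            invariant_by (rho_plus m) (0, pzp)] &
        [/\ invariant_by (A_minus m) (1, 0), invariant_by (A_minus m) (0, pzm),
            invariant_by (rho_minus m) (1, 0) &
            invariant_by (rho_minus m) (0, pzm)]]
  | ConfB pxp pzp =>
    [/\ pzp != 0,
        [/\ invariant_by (A_plus m) (1, 0), invariant_by (A_plus m) (pxp, pzp),
            invariant_by (rho_plus m) (1, 0) &
            invariant_by (rho_plus m) (pxp, pzp)] &
        (exists A0, forall y, A_minus m y = A0) /\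
        (exists r0, forall y, rho_minus m y = r0)]
  end.

Definition theta1 {R : realType} (c : configuration R) : R :=
  match c with ConfA pzp _ => 1 / pzp | ConfB _ pzp => 1 / pzp end.

Definition theta2 {R : realType} (c : configuration R) : R :=
  match c with ConfA _ pzm => 1 / pzm | ConfB pxp pzp => - pxp / pzp end.

Definition lift_plus {R : realType} {T : Type} (c : configuration R)
    (f : R * R -> T) (y : R * (R * R)) : T :=
  match c with
  | ConfA pzp _ => f (y.1, pzp * y.2.1)
  | ConfB pxp pzp => f (y.1 + y.2.2 + y.2.1 * pxp, y.2.1 * pzp)
  end.

Section L2.
Context {R : realType} {d : measure_display} {T : measurableType d}.
Variables (mu : set T -> \bar R) (D : set T).

Definition sqL2 (f : T -> R[i]) : \bar R :=
  (\int[mu]_(y in D) ((Normc.normc (f y)) ^+ 2)%:E)%E.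

Definition in_L2 (f : T -> R[i]) : Prop :=
  [/\ measurable_fun D (fun y => complex.Re (f y)),
      measurable_fun D (fun y => complex.Im (f y)) &
      (sqL2 f < +oo)%E].

Definition cvg_L2 (f_ : nat -> T -> R[i]) (f : T -> R[i]) : Prop :=
  sqL2 (fun y => f_ j y - f y) @[j --> \oo] --> 0%E.

End L2.

Lemma product_sigma_finite {d1 d2} {T1 : measurableType d1}
    {T2 : measurableType d2} {R : realType}
    (m1 : {sigma_finite_measure set T1 -> \bar R})
    (m2 : {sigma_finite_measure set T2 -> \bar R}) :
  sigma_finite setT (m1 \x m2)%E.
Proof.
have /sigma_finiteP[F [TF ndF Foo]] := sigma_finiteT m1.
have /sigma_finiteP[G [TG ndG Goo]] := sigma_finiteT m2.
exists (fun n => F n `*` G n).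
  rewrite -setXTT TF TG predeqE => -[x y]; split.
    move=> [/= [n _ Fnx] [k _ Gky]]; exists (maxn n k) => //; split.
    - by move: x Fnx; exact/subsetPset/ndF/leq_maxl.
    - by move: y Gky; exact/subsetPset/ndG/leq_maxr.
  by move=> [n _ []/= ? ?]; split; exists n.
move=> k; have [? ?] := Foo k; have [? ?] := Goo k.
split; first exact: measurableX.
by rewrite product_measure1E// lte_mul_pinfty// ge0_fin_numE.
Qed.

(* Lebesgue measure on R^2 and R^3; the generic sigma-finite instance on
   products is not found by unification, hence the explicit instances. *)
Definition mu2 {R : realType} :
    set (measurableTypeR R * measurableTypeR R) -> \bar R :=
  (@lebesgue_measure R \x @lebesgue_measure R)%E.
HB.instance Definition _ (R : realType) := Measure.on (@mu2 R).
HB.instance Definition _ (R : realType) :=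
  Measure_isSigmaFinite.Build _ _ _ (@mu2 R)
    (product_sigma_finite (@lebesgue_measure R) (@lebesgue_measure R)).

Definition mu3 {R : realType} :
    set (measurableTypeR R * (measurableTypeR R * measurableTypeR R))
      -> \bar R :=
  (@lebesgue_measure R \x @mu2 R)%E.
HB.instance Definition _ (R : realType) := Measure.on (@mu3 R).
HB.instance Definition _ (R : realType) :=
  Measure_isSigmaFinite.Build _ _ _ (@mu3 R)
    (product_sigma_finite (@lebesgue_measure R) (@mu2 R)).

Section Spaces.
Context {R : realType}.
Notation C := R[i].
Notation plane := (R * R)%type.
Notation space := (R * (R * R))%type.

Definition Sigma : set plane := `]0, 1[ `*` `]0, 1[.
Definition Omega : set space := `]0, +oo[ `*` Sigma.

(* All iterated directional derivatives of order at most n exist and are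
   continuous. *)
Fixpoint Cn (n : nat) (f : space -> R) : Prop :=
  continuous f /\
  if n is m.+1 then
    forall v : space, (forall y, derivable f y v) /\ Cn m (fun y => 'D_v f y)
  else True.

(* Functions on R^3 whose restrictions to Omega form C^oo_{0,##}; every
   function that is smooth up to the boundary x = 0, z-periodic and compactly
   supported in x has such an extension to x < 0. *)
Definition test_function (phi : space -> C) : Prop :=
  [/\ forall n, Cn n (fun y => complex.Re (phi y)),
      forall n, Cn n (fun y => complex.Im (phi y)),
      forall x z1 z2, phi (x, (z1 + 1, z2)) = phi (x, (z1, z2)) /\
                      phi (x, (z1, z2 + 1)) = phi (x, (z1, z2)) &
      exists M : R, forall x z, M < `|x| -> phi (x, z) = 0].

Definition partial (v : space) (phi : space -> C) (y : space) : C :=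
  'D_v (fun y => complex.Re (phi y)) y +i* 'D_v (fun y => complex.Im (phi y)) y.

Definition e_x : space := (1, (0, 0)).
Definition e_z1 : space := (0, (1, 0)).
Definition e_z2 : space := (0, (0, 1)).

Definition vec2 (a b : C) : 'cV[C]_2 := \col_i (if i == 0 then a else b).

Section Theta.
Variables (t1 t2 : R).

Definition dTheta (phi : space -> C) (y : space) : C :=
  t1%:C * partial e_z1 phi y + t2%:C * partial e_z2 phi y.

Definition ThetaT_grad (phi : space -> C) (y : space) : 'cV[C]_2 :=
  vec2 (partial e_x phi y) (dTheta phi y).

Definition div_Theta (W : space -> 'cV[C]_2) (y : space) : C :=
  partial e_x (fun y => W y 0 0) y + dTheta (fun y => W y 1 0) y.

(* phi_ converges to V in H^1_{Theta,##}(Omega), with gradient limit G. *)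
Definition H1_approx (phi_ : nat -> space -> C) (V : space -> C)
    (G : space -> 'cV[C]_2) : Prop :=
  [/\ forall j, test_function (phi_ j),
      in_L2 mu3 Omega V,
      forall i, in_L2 mu3 Omega (fun y => G y i 0),
      cvg_L2 mu3 Omega phi_ V &
      forall i, cvg_L2 mu3 Omega (fun j y => ThetaT_grad (phi_ j) y i 0)
                                 (fun y => G y i 0)].

(* V belongs to H^1_{Theta,##}(Omega), the closure of the test functions, and
   Theta^T grad V = G; G is determined by V almost everywhere in Omega. *)
Definition H1_grad (V : space -> C) (G : space -> 'cV[C]_2) : Prop :=
  exists phi_, H1_approx phi_ V G.

Definition H1_norm (V : space -> C) (G : space -> 'cV[C]_2) : R :=
  Num.sqrt (fine (sqL2 mu3 Omega V +
                  \sum_(i < 2) sqL2 mu3 Omega (fun y => G y i 0%R))%E).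

(* W belongs to H_{Theta,##}(div; Omega) and grad^T Theta W = D. *)
Definition Hdiv_div (W : space -> 'cV[C]_2) (D : space -> C) : Prop :=
  [/\ forall i, in_L2 mu3 Omega (fun y => W y i 0),
      in_L2 mu3 Omega D &
      exists W_ : nat -> space -> 'cV[C]_2,
        [/\ forall j i, test_function (fun y => W_ j y i 0),
            forall i, cvg_L2 mu3 Omega (fun j y => W_ j y i 0)
                                       (fun y => W y i 0) &
            cvg_L2 mu3 Omega (fun j => div_Theta (W_ j)) D]].

(* V belongs to H^1_{Theta,##}(Omega) and its trace on {n} x (0,1)^2 is Phi. *)
Definition has_trace (n : nat) (V : space -> C) (Phi : plane -> C) : Prop :=
  in_L2 mu2 Sigma Phi /\
  exists G phi_, H1_approx phi_ V G /\
    cvg_L2 mu2 Sigma (fun j z => phi_ j (n%:R, z)) Phi.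

Definition H12 : set (plane -> C) := [set Phi | exists V, has_trace 0 V Phi].

Definition H12_norm (Phi : plane -> C) : R :=
  inf [set N | exists V G,
    [/\ H1_grad V G, has_trace 0 V Phi & N = H1_norm V G]].

(* Elements of H12 are functions, to be identified when equal a.e. *)
Definition eqae (Phi Psi : plane -> C) : Prop :=
  {ae mu2, forall z, Sigma z -> Phi z = Psi z}.

Definition bounded_operator (T : (plane -> C) -> (plane -> C)) : Prop :=
  [/\ forall Phi, H12 Phi -> H12 (T Phi),
      forall Phi Psi, H12 Phi -> H12 Psi -> eqae Phi Psi ->
        eqae (T Phi) (T Psi),
      forall (l : C) Phi Psi, H12 Phi -> H12 Psi ->
        eqae (T (fun z => l * Phi z + Psi z))
             (fun z => l * T Phi z + T Psi z) &
      exists M : R, forall Phi, H12 Phi -> H12_norm (T Phi) <= M * H12_norm Phi].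

Definition resolvent_set (T : (plane -> C) -> (plane -> C)) : set C :=
  [set l | exists S, [/\ bounded_operator S,
     forall Phi, H12 Phi -> eqae (fun z => l * S Phi z - T (S Phi) z) Phi &
     forall Phi, H12 Phi -> eqae (S (fun z => l * Phi z - T Phi z)) Phi]].

Definition spectrum (T : (plane -> C) -> (plane -> C)) : set C :=
  ~` resolvent_set T.

Definition spectral_radius (T : (plane -> C) -> (plane -> C)) : \bar R :=
  ereal_sup [set (Normc.normc l)%:E | l in spectrum T].

End Theta.

Section HalfGuide.
Variables (m : medium R) (c : configuration R) (omega : C) (k : R).

Let t1 := theta1 c.
Let t2 := theta2 c.

(* The second entry of Theta^T grad_k V - Theta^T grad V, and the zeroth-order
   term of grad_k^T Theta, are multiplications by i k theta1. *)
Definition ik_theta1 : C := (0 +i* k) * t1%:C.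

Definition flux_k (U : space -> C) (G : space -> 'cV[C]_2) (y : space)
  : 'cV[C]_2 :=
  map_mx (real_complex R) (lift_plus c (A_plus m) y)
    *m (G y + vec2 0 (ik_theta1 * U y)).

Definition half_guide_solution (Phi : plane -> C) (U : space -> C) : Prop :=
  exists G D,
    [/\ H1_grad t1 t2 U G,
        Hdiv_div t1 t2 (flux_k U G) D,
        {ae mu3, forall y, Omega y ->
          - (D y + ik_theta1 * flux_k U G y 1 0)
          - (lift_plus c (rho_plus m) y)%:C * omega ^+ 2 * U y = 0} &
        has_trace t1 t2 0 U Phi].

End HalfGuide.
End Spaces.

(* Main.v *)
Require Import Defs.
From mathcomp Require Import all_boot all_order all_algebra.
From mathcomp Require Import complex.
From mathcomp Require Import all_classical all_reals all_analysis.
From mathcomp Require Import measurable_realfun.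
From mathcomp Require Import ring lra.
Set Implicit Arguments.
Unset Strict Implicit.
Unset Printing Implicit Defensive.
Import Order.TTheory GRing.Theory Num.Theory.
Import numFieldNormedType.Exports.
Local Open Scope classical_set_scope.
Local Open Scope ring_scope.
Local Open Scope complex_scope.

(** The half-guide problem becomes coercive after multiplication by zeta = i conj(omega).
Write F for the flux of a solution U with gradient G, D for its divergence and
e = |U|^2 + |G|^2. Since Im omega > 0, eliminating D with the equation gives
   Re (zeta (D conj U + F . conj G)) >= c0 e
at almost every point, and |D|^2 + |F|^2 <= C e ([pointwise_bounds]). Green's formula says
that the form on the left integrates to zero against test functions vanishing on the
interface; it holds for smooth fluxes and smooth test functions, and passes to the limit
([green_limit]). Two choices of the test function then give everything.

If V is any H1 function with the same trace as U, the test function U - V shows that the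
energy of U is at most a constant times that of V ([apriori]). Hence uniqueness, linearity
and boundedness of P in the quotient norm of traces. The coefficients have period 1 in x, so
the translate of U by e_x is again a solution, with data P Phi; by uniqueness it is the
solution attached to P Phi, and the first formula follows by induction ([P_iter]).

The test function (1 - exp (- a x)) U vanishes on the interface without any condition on U.
It gives
   c0 int (1 - exp (- a x)) e <= C' a int exp (- a x) e.
Bounding exp (- a x) by 1 for x <= 1 and by exp (- a) for x > 1, and taking a large, one finds
q < 1 such that the energy of U in x > 1 is at most q times its energy in x > 0 ([decay]).

By periodicity the energies of the successive translates decrease like q^n, so every l with
|l|^2 > q belongs to the resolvent set. Indeed l Psi - P Psi = Phi is the fixed-point equation
Psi = l^-1 P Psi + l^-1 Phi. Successive iterates, together with the solutions attached to
them, differ by energies decreasing like (q / |l|^2)^n, and therefore converge ([L2_complete],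
[H1_complete], [fixed_point]); and P Psi = l Psi forces the L^2 norm of the solution attached
to Psi to be at most a constant times (q / |l|^2)^(n/2) for every n, so that Psi = 0
([eigenfunction_eq0]). The spectrum lies in the disc of radius sqrt q.

Traces are handled by one inequality,
   |w(x, .)|^2 <= 2 (s |w|^2 + s^-1 |d_x w|^2)   for every s > 0,
for test functions w ([trace_ineq]). It shows that a trace depends neither on the
approximating sequence nor on the limit of the gradients along it ([trace_cvg_transfer]). *)

(** * The real inner product on the complex numbers *)

(** The real part of a * conj b. Every estimate below concerns real parts only, and a
complex factor is moved to one argument beforehand. *)
Definition rdot {R : realType} (a b : R[i]) : R :=
  complex.Re a * complex.Re b + complex.Im a * complex.Im b.

Section RdotTheory.
Context {R : realType}.
Implicit Types a b c : R[i].

Lemma sqr_normcE a : Normc.normc a ^+ 2 = rdot a a.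
Proof.
case: a => x y; rewrite /Normc.normc /rdot /= sqr_sqrtr; first by rewrite !expr2.
by rewrite addr_ge0 ?sqr_ge0.
Qed.

Lemma rdot_ge0 a : 0 <= rdot a a.
Proof. by rewrite -sqr_normcE sqr_ge0. Qed.

Lemma rdot_eq0 a : rdot a a = 0 -> a = 0.
Proof.
case: a => x y; rewrite /rdot /= -!expr2 => /eqP.
by rewrite paddr_eq0 ?sqr_ge0// !sqrf_eq0 => /andP[/eqP -> /eqP ->].
Qed.

Lemma rdotC a b : rdot a b = rdot b a.
Proof. by rewrite /rdot; ring. Qed.

Lemma rdotDl a b c : rdot (a + b) c = rdot a c + rdot b c.
Proof. by case: a => ? ?; case: b => ? ?; rewrite /rdot /=; ring. Qed.

Lemma rdotDr a b c : rdot c (a + b) = rdot c a + rdot c b.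
Proof. by rewrite rdotC rdotDl !(rdotC c). Qed.

Lemma rdotNl a b : rdot (- a) b = - rdot a b.
Proof. by case: a => ? ?; rewrite /rdot /=; ring. Qed.

Lemma rdotNr a b : rdot a (- b) = - rdot a b.
Proof. by rewrite rdotC rdotNl rdotC. Qed.

Lemma rdot0l b : rdot 0 b = 0.
Proof. by rewrite /rdot /= !mul0r addr0. Qed.

Lemma rdot0r b : rdot b 0 = 0.
Proof. by rewrite rdotC rdot0l. Qed.

Lemma rdotMM (l : R[i]) a : rdot (l * a) (l * a) = rdot l l * rdot a a.
Proof. by case: a => ? ?; case: l => ? ?; rewrite /rdot /=; ring. Qed.

(** Young's inequality takes the place of the Cauchy-Schwarz inequality: being pointwise,
it can be combined with other pointwise bounds before integration. *)
Lemma rdot_young (e : R) a b : 0 < e ->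
  `|rdot a b| <= e * rdot a a + e^-1 * rdot b b.
Proof.
move=> e0; have ei : e * e^-1 = 1 by rewrite mulfV// gt_eqF.
have ei0 : 0 < e^-1 by rewrite invr_gt0.
have H (x y : R) : `|x * y| <= e * (x * x) + e^-1 * (y * y).
  have h1 : 0 <= e * (x + e^-1 * y) ^+ 2 by rewrite mulr_ge0 ?sqr_ge0 ?ltW.
  have h2 : 0 <= e * (x - e^-1 * y) ^+ 2 by rewrite mulr_ge0 ?sqr_ge0 ?ltW.
  have -> : e * (x * x) + e^-1 * (y * y) = e * x ^+ 2 + (e * e^-1) * e^-1 * y ^+ 2.
    by rewrite ei; ring.
  have E1 : e * (x + e^-1 * y) ^+ 2 =
    e * x ^+ 2 + (e * e^-1) * e^-1 * y ^+ 2 + 2 * (e * e^-1) * (x * y) by ring.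
  have E2 : e * (x - e^-1 * y) ^+ 2 =
    e * x ^+ 2 + (e * e^-1) * e^-1 * y ^+ 2 - 2 * (e * e^-1) * (x * y) by ring.
  rewrite E1 ei in h1; rewrite E2 ei in h2; rewrite ei ler_norml.
  by apply/andP; split; nra.
apply: (le_trans (ler_normD _ _)); apply: (le_trans (lerD (H _ _) (H _ _))).
by rewrite /rdot; lra.
Qed.

Lemma rdotDD_le a b : rdot (a + b) (a + b) <= 2 * rdot a a + 2 * rdot b b.
Proof.
have := rdot_ge0 (a - b); rewrite !rdotDl !rdotDr !rdotNl !rdotNr (rdotC b a); lra.
Qed.

End RdotTheory.

(** * Square-integrable functions *)

Section AlmostEverywhere.
Context {R : realType} {d : measure_display} {T : measurableType d}.
Variables (mu : {measure set T -> \bar R}) (D : set T).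

Lemma ae_on_impl (P Q : T -> Prop) : (forall y, D y -> P y -> Q y) ->
  {ae mu, forall y, D y -> P y} -> {ae mu, forall y, D y -> Q y}.
Proof. by move=> PQ; apply: filterS => y h Dy; exact: PQ (h Dy). Qed.

Lemma ae_on_impl2 (P P' Q : T -> Prop) : (forall y, D y -> P y -> P' y -> Q y) ->
  {ae mu, forall y, D y -> P y} -> {ae mu, forall y, D y -> P' y} ->
  {ae mu, forall y, D y -> Q y}.
Proof.
by move=> PQ; apply: filterS2 => y h h' Dy; exact: PQ (h Dy) (h' Dy).
Qed.

Lemma ae_on_all (P : T -> Prop) : (forall y, D y -> P y) ->
  {ae mu, forall y, D y -> P y}.
Proof. by move=> h; apply: nearW. Qed.

End AlmostEverywhere.

Section L2Theory.
Context {R : realType} {d : measure_display} {T : measurableType d}.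
Variables (mu : {measure set T -> \bar R}) (D : set T).
Hypothesis mD : measurable D.
Implicit Types f g h : T -> R[i].

Local Notation L2 := (in_L2 mu D).

Lemma integrable_addr (f g : T -> R) : mu.-integrable D (EFin \o f) ->
  mu.-integrable D (EFin \o g) ->
  mu.-integrable D (EFin \o (fun y => f y + g y)).
Proof. by move=> If Ig; have := integrableD mD If Ig. Qed.

Lemma integrable_scaler (k : R) (f : T -> R) : mu.-integrable D (EFin \o f) ->
  mu.-integrable D (EFin \o (fun y => k * f y)).
Proof. by move=> If; have := integrableZl mD k If. Qed.

(** The squared L^2 norm as a real number, so that estimates can be stated without
extended reals. *)
Definition sqnorm f : R := \int[mu]_(y in D) rdot (f y) (f y).

Lemma measurable_rdot f g :
  measurable_fun D (fun y => complex.Re (f y)) ->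
  measurable_fun D (fun y => complex.Im (f y)) ->
  measurable_fun D (fun y => complex.Re (g y)) ->
  measurable_fun D (fun y => complex.Im (g y)) ->
  measurable_fun D (fun y => rdot (f y) (g y)).
Proof. by move=> *; apply: measurable_funD; apply: measurable_funM. Qed.

Lemma sqL2_rdotE f : sqL2 mu D f = (\int[mu]_(y in D) (rdot (f y) (f y))%:E)%E.
Proof. by apply: eq_integral => y _; rewrite sqr_normcE. Qed.

Lemma in_L2P f : L2 f <-> [/\ measurable_fun D (fun y => complex.Re (f y)),
  measurable_fun D (fun y => complex.Im (f y)) &
  mu.-integrable D (EFin \o (fun y => rdot (f y) (f y)))].
Proof.
split=> -[m1 m2 h]; split=> //.
- apply/integrableP; split.
    by apply/measurable_EFinP; exact: measurable_rdot.
  under eq_integral => y _ do rewrite /= ger0_norm ?rdot_ge0//.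
  by rewrite -sqL2_rdotE.
- case/integrableP : h => _; rewrite sqL2_rdotE.
  by under eq_integral => y _ do rewrite /= ger0_norm ?rdot_ge0//.
Qed.

Lemma sqL2E f : L2 f -> sqL2 mu D f = (sqnorm f)%:E.
Proof.
move=> /in_L2P[_ _ If]; rewrite sqL2_rdotE /sqnorm /Rintegral fineK//.
exact: integrable_fin_num.
Qed.

Lemma sqnorm_ge0 f : 0 <= sqnorm f.
Proof. by apply: Rintegral_ge0 => y _; exact: rdot_ge0. Qed.

Lemma integrable_weighted_rdot (w : T -> R) (M : R) f g : L2 f -> L2 g ->
  measurable_fun D w -> (forall y, D y -> `|w y| <= M) ->
  mu.-integrable D (EFin \o (fun y => w y * rdot (f y) (g y))).
Proof.
move=> /in_L2P[f1 f2 If] /in_L2P[g1 g2 Ig] mw wM.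
apply: (@le_integrable _ _ _ mu D mD _
    (EFin \o (fun y => `|M| * (rdot (f y) (f y) + rdot (g y) (g y))))).
- apply/measurable_EFinP; apply: measurable_funM => //.
  exact: measurable_rdot.
- move=> y Dy /=; rewrite lee_fin normrM [leRHS]ger0_norm; last first.
    by rewrite mulr_ge0// addr_ge0 ?rdot_ge0.
  apply: ler_pM => //; first by rewrite (le_trans (wM _ Dy))// ler_norm.
  by have := rdot_young (f y) (g y) ltr01; rewrite invr1 !mul1r.
- by apply: integrable_scaler; exact: integrable_addr.
Qed.

Lemma integrable_rdot f g : L2 f -> L2 g ->
  mu.-integrable D (EFin \o (fun y => rdot (f y) (g y))).
Proof.
move=> f2 g2; rewrite (_ : (fun y => _) = (fun y => cst 1 y * rdot (f y) (g y))).
  apply: (integrable_weighted_rdot (M := 1)) => // y _.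
  by rewrite /cst normr1.
by apply/funext => y; rewrite mul1r.
Qed.

Lemma L2_lin (l : R[i]) f g : L2 f -> L2 g -> L2 (fun y => l * f y + g y).
Proof.
move=> F G; have [f1 f2 _] := F; have [g1 g2 _] := G.
have m1 : measurable_fun D (fun y => complex.Re (l * f y + g y)).
  rewrite (_ : (fun _ => _) = (fun y => (complex.Re l * complex.Re (f y) -
     complex.Im l * complex.Im (f y)) + complex.Re (g y))).
    apply: measurable_funD => //; apply: measurable_funB => //.
      exact: measurable_funM.
    exact: measurable_funM.
  by apply/funext => y; case: (f y) => ? ?; case: (g y) => ? ?; case: l.
have m2 : measurable_fun D (fun y => complex.Im (l * f y + g y)).
  rewrite (_ : (fun _ => _) = (fun y => (complex.Re l * complex.Im (f y) +
     complex.Im l * complex.Re (f y)) + complex.Im (g y))).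
    apply: measurable_funD => //; apply: measurable_funD => //.
      exact: measurable_funM.
    exact: measurable_funM.
  apply/funext => y; case: (f y) => ? ?; case: (g y) => ? ?; case: l {m1} => ? ? /=.
  by ring.
apply/in_L2P; split => //.
apply: (@le_integrable _ _ _ mu D mD _ (EFin \o
  (fun y => 2 * rdot l l * rdot (f y) (f y) + 2 * rdot (g y) (g y)))).
- by apply/measurable_EFinP; exact: measurable_rdot.
- move=> y _ /=; rewrite lee_fin !ger0_norm ?rdot_ge0//; last first.
    by rewrite addr_ge0// !mulr_ge0 ?rdot_ge0.
  by apply: (le_trans (rdotDD_le _ _)); rewrite rdotMM mulrA.
- by apply: integrable_addr; apply: integrable_scaler; exact: integrable_rdot.
Qed.

Lemma L2_0 : L2 (fun=> 0).
Proof.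
apply/in_L2P; split; [exact: measurable_cst|exact: measurable_cst|].
rewrite (_ : EFin \o _ = cst 0%E); first exact: integrable0.
by apply/funext => y /=; rewrite rdot0l.
Qed.

Lemma L2_D f g : L2 f -> L2 g -> L2 (fun y => f y + g y).
Proof.
move=> F G; rewrite (_ : (fun y => _) = (fun y => 1 * f y + g y)).
  exact: L2_lin.
by apply/funext => y; rewrite mul1r.
Qed.

Lemma L2_Z (l : R[i]) f : L2 f -> L2 (fun y => l * f y).
Proof.
move=> F; rewrite (_ : (fun y => _) = (fun y => l * f y + (fun=> 0) y)).
  by apply: L2_lin => //; exact: L2_0.
by apply/funext => y; rewrite addr0.
Qed.

Lemma L2_B f g : L2 f -> L2 g -> L2 (fun y => f y - g y).
Proof.
move=> F G; rewrite (_ : (fun y => _) = (fun y => (-1) * g y + f y)).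
  exact: L2_lin.
by apply/funext => y; rewrite mulN1r addrC.
Qed.

Lemma sqnormZ (l : R[i]) f : L2 f -> sqnorm (fun y => l * f y) = rdot l l * sqnorm f.
Proof.
move=> /in_L2P[_ _ If]; rewrite /sqnorm -RintegralZl//.
by apply: eq_Rintegral => y _; rewrite rdotMM.
Qed.

Lemma sqnormD_le f g : L2 f -> L2 g ->
  sqnorm (fun y => f y + g y) <= 2 * sqnorm f + 2 * sqnorm g.
Proof.
move=> F G; rewrite /sqnorm -!RintegralZl//; try exact: integrable_rdot.
rewrite -RintegralD//; try (apply: integrable_scaler; exact: integrable_rdot).
apply: le_Rintegral => //.
- by apply: integrable_rdot; exact: L2_D.
- by apply: integrable_addr; apply: integrable_scaler; exact: integrable_rdot.
- by move=> y _; exact: rdotDD_le.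
Qed.

Lemma sqnormB_le f g : L2 f -> L2 g ->
  sqnorm (fun y => f y - g y) <= 2 * sqnorm f + 2 * sqnorm g.
Proof.
move=> F G; have G' := L2_Z (-1) G.
have := sqnormD_le F G'; rewrite sqnormZ// (_ : rdot (-1) (-1) = 1) ?mul1r; last first.
  by rewrite /rdot /=; ring.
by under eq_fun do rewrite mulN1r.
Qed.

Lemma sqnormBC f g : sqnorm (fun y => f y - g y) = sqnorm (fun y => g y - f y).
Proof.
by apply: eq_Rintegral => y _; rewrite -opprB rdotNl rdotNr opprK.
Qed.

Lemma sqnorm0 : sqnorm (fun=> 0) = 0.
Proof.
rewrite /sqnorm; under eq_Rintegral do rewrite rdot0l.
by rewrite Rintegral_cst// mul0r.
Qed.

Lemma ae_eq_sqnorm f g : L2 f -> L2 g ->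
  {ae mu, forall y, D y -> f y = g y} -> sqnorm f = sqnorm g.
Proof.
move=> [f1 f2 _] [g1 g2 _] fg; congr fine; apply: ae_eq_integral => //.
- by apply/measurable_EFinP; exact: measurable_rdot.
- by apply/measurable_EFinP; exact: measurable_rdot.
- by apply: filterS fg => y /[apply] ->.
Qed.

Lemma sqnorm_eq0 f : L2 f -> sqnorm f = 0 -> {ae mu, forall y, D y -> f y = 0}.
Proof.
move=> F f0; have := sqL2E F; rewrite f0 sqL2_rdotE.
move=> h; have /in_L2P[f1 f2 _] := F.
have mf : measurable_fun D (EFin \o (fun y => rdot (f y) (f y))).
  by apply/measurable_EFinP; exact: measurable_rdot.
have /(ae_eq_integral_abs mu mD mf) : (\int[mu]_(y in D) `|(rdot (f y) (f y))%:E| = 0)%E.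
  by under eq_integral => y _ do rewrite /= ger0_norm ?rdot_ge0//.
by apply: filterS => y /[apply] -[]; exact: rdot_eq0.
Qed.

Lemma cvg_L2E (f_ : nat -> T -> R[i]) f : (forall j, L2 (f_ j)) -> L2 f ->
  cvg_L2 mu D f_ f <-> (sqnorm (fun y => f_ j y - f y) @[j --> \oo] --> 0).
Proof.
move=> F_ F; rewrite /cvg_L2; under eq_fun => j do rewrite (sqL2E (L2_B (F_ j) F)).
split; last by move=> h; apply: cvg_EFin => //; near=> j.
by move=> /fine_cvg/=.
Unshelve. all: by end_near. Qed.

Lemma cvg_L2_unique (f_ : nat -> T -> R[i]) f g : (forall j, L2 (f_ j)) -> L2 f -> L2 g ->
  cvg_L2 mu D f_ f -> cvg_L2 mu D f_ g -> {ae mu, forall y, D y -> f y = g y}.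
Proof.
move=> F_ F G; rewrite !cvg_L2E// => hf hg.
suff : sqnorm (fun y => f y - g y) = 0.
  move=> /(sqnorm_eq0 (L2_B F G)); apply: filterS => y /[apply] /eqP.
  by rewrite subr_eq0 => /eqP.
apply/eqP; rewrite eq_le sqnorm_ge0 andbT.
have h : (2 * sqnorm (fun y => f_ j y - f y) + 2 * sqnorm (fun y => f_ j y - g y))
    @[j --> \oo] --> (2 * 0 + 2 * 0 : R).
  by apply: cvgD; apply: cvgM => //; exact: cvg_cst.
rewrite mulr0 addr0 in h; rewrite -(cvg_lim _ h)//.
apply: limr_ge; first by apply/cvg_ex; exists 0.
near=> j; rewrite [X in X <= _](_ : _ = sqnorm (fun y => (f_ j y - g y) - (f_ j y - f y))).
  by rewrite addrC; apply: sqnormB_le; exact: L2_B.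
by apply: eq_Rintegral => y _; congr (rdot _ _); ring.
Unshelve. all: by end_near. Qed.

Lemma pairing_young (w : T -> R) (M e : R) f g : L2 f -> L2 g ->
  measurable_fun D w -> (forall y, D y -> `|w y| <= M) -> 0 < e ->
  `|\int[mu]_(y in D) (w y * rdot (f y) (g y))| <= `|M| * (e * sqnorm f + e^-1 * sqnorm g).
Proof.
move=> F G mw wM e0.
apply: (le_trans (le_normr_Rintegral _ _)) => //.
  exact: (integrable_weighted_rdot (M := M)).
have If := integrable_rdot F F; have Ig := integrable_rdot G G.
have Ief := integrable_scaler e If; have Ieg := integrable_scaler e^-1 Ig.
have Iefg := integrable_addr Ief Ieg.
rewrite /sqnorm -!RintegralZl// -RintegralD// -RintegralZl//.
apply: le_Rintegral => //.
- exact: integrable_norm (integrable_weighted_rdot F G mw wM).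
- exact: integrable_scaler.
- move=> y Dy; rewrite normrM; apply: ler_pM => //; last exact: rdot_young.
  by rewrite (le_trans (wM _ Dy))// ler_norm.
Qed.

Lemma cvg_L2_pairing (w : T -> R) (M : R) f g (g_ : nat -> T -> R[i]) :
  L2 f -> L2 g -> (forall j, L2 (g_ j)) ->
  measurable_fun D w -> (forall y, D y -> `|w y| <= M) ->
  cvg_L2 mu D g_ g ->
  \int[mu]_(y in D) (w y * rdot (f y) (g_ j y)) @[j --> \oo] -->
  \int[mu]_(y in D) (w y * rdot (f y) (g y)).
Proof.
move=> F G G_ mw wM; rewrite cvg_L2E// => h.
apply/cvgrPdist_le => /= e e0.
pose K := 2 * (`|M| + 1) * (sqnorm f + 1).
have K0 : 0 < K.
  have := sqnorm_ge0 f; have : 0 <= `|M| by [].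
  by move=> ? ?; rewrite /K mulr_gt0//; lra.
(* e' is small enough for e' (|M| (|f|^2 + 1)) to be below e. *)
pose e' := e / K.
have e'0 : 0 < e' by rewrite /e' divr_gt0.
have : \forall j \near \oo, sqnorm (fun y => g_ j y - g y) <= e' * e'.
  have e2 : 0 < e' * e' by rewrite mulr_gt0.
  have /cvgrPdist_le/(_ _ e2) := h; apply: filterS => j.
  by rewrite sub0r normrN ger0_norm ?sqnorm_ge0.
apply: filterS => j hj.
rewrite -RintegralB//; try exact: (integrable_weighted_rdot (M := M)).
under eq_Rintegral do rewrite -mulrBr -rdotNr -rdotDr.
apply: (le_trans (pairing_young F (L2_B G (G_ j)) mw wM e'0)).
have h1 : e'^-1 * sqnorm (fun y => g y - g_ j y) <= e'.
  rewrite sqnormBC; apply: le_trans (ler_wpM2l _ hj) _; first by rewrite invr_ge0 ltW.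
  by rewrite mulrA mulVf ?mul1r// gt_eqF.
have h2 : e = e' * K by rewrite /e' divfK// gt_eqF.
have M0 : 0 <= `|M| by [].
have h3 : e' * sqnorm f + e'^-1 * sqnorm (fun y => g y - g_ j y) <= e' * sqnorm f + e'.
  by rewrite lerD2l.
apply: (le_trans (ler_wpM2l M0 h3)).
rewrite h2 /K; have n0 := sqnorm_ge0 f.
have e'ge0 := ltW e'0.
have := mulr_ge0 e'ge0 (mulr_ge0 M0 n0); have := mulr_ge0 e'ge0 n0.
have := mulr_ge0 e'ge0 M0.
set p1 := e' * `|M|; set p2 := e' * sqnorm f; set p3 := e' * (_ * _) => q1 q2 q3.
have -> : `|M| * (p2 + e') = p3 + p1 by rewrite /p1 /p2 /p3; ring.
have -> : e' * (2 * (`|M| + 1) * (sqnorm f + 1)) = 2 * (p3 + p1 + p2 + e').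
  by rewrite /p1 /p2 /p3; ring.
lra.
Qed.


Lemma cvg_L2_lin (l : R[i]) (f_ g_ : nat -> T -> R[i]) f g :
  (forall j, L2 (f_ j)) -> (forall j, L2 (g_ j)) -> L2 f -> L2 g ->
  cvg_L2 mu D f_ f -> cvg_L2 mu D g_ g ->
  cvg_L2 mu D (fun j y => l * f_ j y + g_ j y) (fun y => l * f y + g y).
Proof.
move=> F_ G_ F0 G0; rewrite !cvg_L2E//; last 2 first.
- by move=> j; apply: L2_lin.
- exact: L2_lin.
move=> hf hg.
have h : (2 * (rdot l l * sqnorm (fun y => f_ j y - f y)) + 2 * sqnorm (fun y => g_ j y - g y))
  @[j --> \oo] --> (2 * (rdot l l * 0) + 2 * 0 : R).
  apply: cvgD; apply: cvgM => //; try exact: cvg_cst.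
  by apply: cvgM => //; exact: cvg_cst.
rewrite !mulr0 addr0 in h.
apply: (squeeze_cvgr _ (cvg_cst 0) h); near=> j; rewrite sqnorm_ge0//=.
rewrite [X in X <= _](_ : _ = sqnorm (fun y => l * (f_ j y - f y) + (g_ j y - g y))).
  rewrite -sqnormZ//; last exact: L2_B.
  apply: sqnormD_le; last exact: L2_B.
  by apply: L2_Z; exact: L2_B.
by apply: eq_Rintegral => y _; congr (rdot _ _); ring.
Unshelve. all: by end_near. Qed.

End L2Theory.

(** * Completeness along geometrically convergent sequences *)

Lemma geometric_limit {R : realType} (u : nat -> R) (A r : R) :
  0 <= r -> r < 1 -> (forall n, `|u n.+1 - u n| <= A * r ^+ n) ->
  cvgn u /\ forall n, `|u n - limn u| <= A * r ^+ n / (1 - r).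
Proof.
move=> r0 r1 uA.
have r1' : 0 < 1 - r by lra.
have A0 : 0 <= A.
  by have := uA 0%N; rewrite expr0 mulr1; exact: le_trans.
have H n k : `|u (n + k)%N - u n| <= A * r ^+ n * (1 - r ^+ k) / (1 - r).
  elim: k => [|k IH]; first by rewrite addn0 subrr normr0 expr0 subrr mulr0 mul0r.
  rewrite (_ : u _ - u n = (u (n + k).+1 - u (n + k)%N) + (u (n + k)%N - u n)).
    apply: (le_trans (ler_normD _ _)); apply: (le_trans (lerD (uA _) IH)).
    rewrite [leLHS](_ : _ = A * r ^+ n * (1 - r ^+ k.+1) / (1 - r))//.
    by rewrite exprD exprS; field; rewrite gt_eqF.
  by rewrite addnS; ring.
have H' n k : `|u (n + k)%N - u n| <= A * r ^+ n / (1 - r).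
  apply: (le_trans (H n k)); rewrite ler_pdivrMr// divfK ?gt_eqF//.
  rewrite -[leRHS]mulr1; apply: ler_wpM2l; first by rewrite mulr_ge0 ?exprn_ge0.
  by rewrite gerBl exprn_ge0.
have cu : cvgn u.
  have -> : u = (fun n => u 0%N + series (telescope u) n).
    by apply/funext => n; exact: eq_sum_telescope.
  apply: is_cvgD; first exact: is_cvg_cst.
  apply: normed_cvg; apply: (@series_le_cvg _ _ (geometric A r)).
  - by move=> n /=.
  - by move=> n; apply: mulr_ge0 => //; exact: exprn_ge0.
  - by move=> n; exact: uA.
  - by apply: is_cvg_geometric_series; rewrite ger0_norm.
split=> // n; rewrite distrC.
have : (fun k => `|u (n + k)%N - u n|) @ \oo --> `|limn u - u n|.
  apply: cvg_norm; apply: cvgB; last exact: cvg_cst.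
  have := cu; rewrite -(cvg_shiftn n u) => cu0.
  by under eq_fun do rewrite addnC; exact: cu0.
move=> h; rewrite -(cvg_lim _ h)//; apply: limr_le; first by apply/cvg_ex; eexists; exact: h.
by near=> k; exact: H'.
Unshelve. all: by end_near. Qed.

Lemma ReB {R : realType} (a b : R[i]) :
  complex.Re (a - b) = complex.Re a - complex.Re b.
Proof. by case: a; case: b. Qed.

Lemma ImB {R : realType} (a b : R[i]) :
  complex.Im (a - b) = complex.Im a - complex.Im b.
Proof. by case: a; case: b. Qed.

Section L2Complete.
Context {R : realType} {d : measure_display} {T : measurableType d}.
Variables (mu : {measure set T -> \bar R}) (D : set T).
Hypothesis mD : measurable D.
Implicit Types f g h : T -> R[i].
Local Notation L2 := (in_L2 mu D).
Local Notation sqnorm := (sqnorm mu D).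

(** Let g_n be the increments of the sequence. The series h = sum_n r^(-2n) |g_n|^2 is
integrable, so it is finite almost everywhere, and there |g_n| <= sqrt h r^n: the sequence
converges pointwise at a geometric rate, and h r^(2n) is up to a constant an integrable
bound of the squared error. *)
Lemma L2_complete (f_ : nat -> T -> R[i]) (K r : R) :
  0 < r -> r < 1 -> (forall n, L2 (f_ n)) ->
  (forall n, sqnorm (fun y => f_ n.+1 y - f_ n y) <= K * r ^+ 4 ^+ n) ->
  exists2 f, L2 f & forall n, sqnorm (fun y => f_ n y - f y) <=
     2 / (1 - r) ^+ 2 * (K / (1 - r ^+ 2)) * (r ^+ 2) ^+ n.
Proof.
move=> r0 r1 f2 fK.
have r1' : 0 < 1 - r by lra.
have r2gt0 : 0 < r ^+ 2 by rewrite exprn_gt0.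
have r2lt1 : r ^+ 2 < 1 by rewrite expr_lt1// ltW.
have r21' : 0 < 1 - r ^+ 2 by rewrite subr_gt0.
pose g n y := f_ n.+1 y - f_ n y.
have g2 n : L2 (g n) by exact: L2_B.
pose a n y := ((r ^+ 2) ^- n * rdot (g n y) (g n y))%:E : \bar R.
have a0 n y : (0 <= a n y)%E.
  by rewrite lee_fin mulr_ge0 ?rdot_ge0// invr_ge0 exprn_ge0// ltW.
have ma n : measurable_fun D (a n).
  apply/measurable_EFinP; apply: measurable_funM => //.
  by case: (g2 n) => *; exact: measurable_rdot.
pose h y := (\sum_(0 <= n <oo) a n y)%E.
have mh : measurable_fun D h.
  apply: ge0_emeasurable_sum => // n y _ _; exact: a0.
have h0 y : (0 <= h y)%E by apply: nneseries_ge0 => n _ _; exact: a0.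
have ia n : (\int[mu]_(y in D) a n y <= (K * (r ^+ 2) ^+ n)%:E)%E.
  rewrite /a; under eq_integral do rewrite EFinM.
  have /in_L2P[_ _ Ig] := g2 n.
  rewrite integralZl//.
  rewrite -sqL2_rdotE sqL2E// -EFinM lee_fin mulrC ler_pdivrMr ?exprn_gt0//.
  by rewrite -mulrA -exprMn -exprD; exact: fK.
have ih : (\int[mu]_(y in D) h y <= (K / (1 - r ^+ 2))%:E)%E.
  rewrite /h integral_nneseries//.
  apply: (@le_trans _ _ (\sum_(0 <= n <oo) (K * (r ^+ 2) ^+ n)%:E)%E).
    by apply: lee_nneseries => [n _ _|n _]; [exact: integral_ge0|exact: ia].
  have gc : (fun n => \sum_(0 <= k < n) (K * (r ^+ 2) ^+ k)) @ \oo --> K / (1 - r ^+ 2).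
    by apply: cvg_geometric_series; rewrite ger0_norm// ltW.
  rewrite (_ : (\sum_(0 <= n <oo) _)%E = (K / (1 - r ^+ 2))%:E)//.
  apply: cvg_lim => //; under eq_fun do rewrite sumEFin.
  by apply: cvg_EFin => //; near=> n.
pose A := D `&` [set y | (h y < +oo)%E].
have mA : measurable A by exact: emeasurable_fun_infty_o.
have gA n y : A y -> rdot (g n y) (g n y) <= fine (h y) * (r ^+ 2) ^+ n.
  move=> [_ hy]; rewrite -ler_pdivrMr ?exprn_gt0// -lee_fin fineK; last first.
    by rewrite ge0_fin_numE.
  rewrite mulrC; apply: (@le_trans _ _ (\sum_(0 <= k < n.+1) a k y)%E).
    rewrite big_nat_recr//= leeDr//; apply: sume_ge0 => i _; exact: a0.
  by apply: nneseries_lim_ge => *; exact: a0.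
have comp (c : R[i] -> R) : (forall x y, c (x - y) = c x - c y) ->
    (forall x, c x ^+ 2 <= rdot x x) -> forall y, A y ->
  cvgn (fun n => c (f_ n y)) /\ forall n,
   (c (f_ n y) - limn (fun n => c (f_ n y))) ^+ 2 <=
     (1 - r) ^- 2 * fine (h y) * (r ^+ 2) ^+ n.
  move=> cB c2 y Ay.
  have H0 : 0 <= fine (h y) by exact: fine_ge0.
  have [] := @geometric_limit _ (fun n => c (f_ n y)) (Num.sqrt (fine (h y))) r (ltW r0) r1.
    move=> n; rewrite -cB.
    rewrite -(ler_pXn2r (n := 2))// ?nnegrE ?mulr_ge0 ?sqrtr_ge0 ?exprn_ge0 ?(ltW r0)//.
    rewrite real_normK ?num_real// exprMn sqr_sqrtr// -exprM mulnC exprM.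
    exact: le_trans (c2 _) (gA n _ Ay).
  move=> cc hc; split=> // n.
  have := hc n; rewrite -(ler_pXn2r (n := 2))// ?nnegrE//; last first.
    by rewrite !mulr_ge0 ?sqrtr_ge0 ?exprn_ge0 ?(ltW r0)// invr_ge0 ltW.
  rewrite real_normK ?num_real// => /le_trans; apply.
  rewrite 2!exprMn sqr_sqrtr// -exprM mulnC exprM exprVn; lra.
have cR := comp (@complex.Re R); have cI := comp (@complex.Im R).
have {}cR := cR ReB (fun x => ltac:(by rewrite /rdot -!expr2 lerDl sqr_ge0)).
have {}cI := cI ImB (fun x => ltac:(by rewrite /rdot -!expr2 lerDr sqr_ge0)).
pose f y := if y \in A then
  limn (fun n => complex.Re (f_ n y)) +i* limn (fun n => complex.Im (f_ n y)) else 0.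
have mf1 (c : R[i] -> R) : (forall n, measurable_fun D (fun y => c (f_ n y))) ->
    c 0 = 0 -> (forall y, A y -> cvgn (fun n => c (f_ n y))) ->
    (forall y, A y -> c (f y) = limn (fun n => c (f_ n y))) ->
    measurable_fun D (fun y => c (f y)).
  move=> mc c0 cc cf.
  apply: (@measurable_fun_cvg _ _ _ _ (fun n y => c (f_ n y) * \1_A y)).
    by move=> n; apply: measurable_funM.
  move=> y Dy; have [/set_mem Ay|nAy] := boolP (y \in A).
    under eq_fun do rewrite indicE mem_set// mulr1.
    by rewrite cf//; exact: cc.
  under eq_fun do rewrite indicE (negbTE nAy) mulr0.
  by rewrite /f (negbTE nAy) c0; exact: cvg_cst.
have mR : measurable_fun D (fun y => complex.Re (f y)).
  apply: (mf1 (@complex.Re R)) => //.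
  - by move=> n; case: (f2 n).
  - by move=> y Ay; case: (cR y Ay).
  - by move=> y Ay; rewrite /f mem_set.
have mI : measurable_fun D (fun y => complex.Im (f y)).
  apply: (mf1 (@complex.Im R)) => //.
  - by move=> n; case: (f2 n).
  - by move=> y Ay; case: (cI y Ay).
  - by move=> y Ay; rewrite /f mem_set.
have dR n : measurable_fun D (fun y => complex.Re (f_ n y - f y)).
  under eq_fun do rewrite ReB.
  by apply: measurable_funB => //; case: (f2 n).
have dI n : measurable_fun D (fun y => complex.Im (f_ n y - f y)).
  under eq_fun do rewrite ImB.
  by apply: measurable_funB => //; case: (f2 n).
have C0 : 0 < 2 / (1 - r) ^+ 2 by rewrite divr_gt0// exprn_gt0.
have key n : (sqL2 mu D (fun y => (f_ n y - f y)%R) <=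
    (2 / (1 - r) ^+ 2 * (K / (1 - r ^+ 2)) * (r ^+ 2) ^+ n)%:E)%E.
  set c := 2 / _ * _ * (r ^+ 2) ^+ n.
  rewrite sqL2_rdotE.
  have c0 : 0 < 2 / (1 - r) ^+ 2 * (r ^+ 2) ^+ n by rewrite mulr_gt0// exprn_gt0.
  apply: (@le_trans _ _ (\int[mu]_(y in D) ((2 / (1 - r) ^+ 2 * (r ^+ 2) ^+ n)%:E * h y))%E).
    apply: ge0_le_integral => //.
    - by move=> y _; rewrite lee_fin rdot_ge0.
    - by apply/measurable_EFinP; exact: measurable_rdot.
    - exact: measurable_funeM.
    - move=> y Dy; have [hy|] := ltP (h y) +oo%E; last first.
        by rewrite leye_eq => /eqP ->; rewrite gt0_muley ?leey// lte_fin.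
      have Ay : A y by [].
      have [_ /(_ n) h1] := cR y Ay; have [_ /(_ n) h2] := cI y Ay.
      rewrite -(@fineK _ (h y)) ?ge0_fin_numE// -EFinM lee_fin.
      rewrite /rdot -!expr2 ReB ImB /f mem_set//=.
      apply: (le_trans (lerD h1 h2)); lra.
  rewrite ge0_integralZl//; last by rewrite lee_fin ltW.
  rewrite (_ : c = 2 / (1 - r) ^+ 2 * (r ^+ 2) ^+ n * (K / (1 - r ^+ 2))).
    by rewrite [leRHS]EFinM; apply: lee_wpmul2l => //; rewrite lee_fin ltW.
  by rewrite /c; ring.
have d2 n : L2 (fun y => f_ n y - f y).
  split => //; exact: le_lt_trans (key n) (ltry _).
have F : L2 f.
  rewrite (_ : f = (fun y => f_ 0%N y - (f_ 0%N y - f y))); first exact: L2_B.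
  by apply/funext => y; rewrite subKr.
exists f => // n; rewrite -lee_fin -sqL2E//.
Unshelve. all: by end_near. Qed.
End L2Complete.

(** * Measurability, translation and iterated integrals on the half-guide *)

(** Rounding the first variable down to a multiple of 1/(n+1) yields functions that are
measurable on each of countably many strips; by continuity in the first variable they
converge to f. *)
Lemma measurable_fun_continuous_slices {R : realType} {d} {Z : measurableType d}
    (f : measurableTypeR R * Z -> R) :
  (forall x, measurable_fun setT (fun z => f (x, z))) ->
  (forall z, continuous (fun x : R => f (x, z))) -> measurable_fun setT f.
Proof.
move=> mf cf.
pose q (n : nat) (x : R) : R := (Num.floor (x * n.+1%:R))%:~R / n.+1%:R.
apply: (@measurable_fun_cvg _ _ _ _ (fun n y => f (q n y.1, y.2))).
  move=> n _ B mB.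
  rewrite [X in measurable X](_ : _ = \bigcup_(k : int)
    ([set` `[k%:~R / n.+1%:R, (k + 1)%:~R / n.+1%:R[ ] `*`
     ((fun z => f (k%:~R / n.+1%:R, z)) @^-1` B))).
    apply: countable_bigcupT_measurable => // k; apply: measurableX => //.
    by rewrite -[X in measurable X]setTI; exact: mf.
  apply/seteqP; split=> [[x z] [_ /= Bxz]|[x z] [k _ [/=]]].
    exists (Num.floor (x * n.+1%:R)) => //; split => //=.
    rewrite in_itv/= ler_pdivrMr// ltr_pdivlMr//.
    exact: floor_itv.
  rewrite in_itv/= ler_pdivrMr// ltr_pdivlMr// => kx Bk; split => //=.
  by rewrite /q (floor_def kx).
move=> -[x z] _ /=; apply: (@continuous_cvg _ _ _ _ _ (q ^~ x) (fun x => f (x, z))).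
  exact: cf.
apply/cvgrPdist_le => e e0; near=> n.
have /andP[h1 h2] := floor_itv (x * n.+1%:R).
have n0 : 0 < n.+1%:R :> R by rewrite ltr0n.
have -> : x - q n x = (x * n.+1%:R - (Num.floor (x * n.+1%:R))%:~R) / n.+1%:R.
  by rewrite /q mulrBl mulfK// gt_eqF.
rewrite ger0_norm; last by rewrite divr_ge0 ?subr_ge0// ltW.
apply: (@le_trans _ _ n.+1%:R^-1).
  rewrite -[leRHS]mul1r ler_pM2r ?invr_gt0//.
  by rewrite intrD in h2; lra.
by apply: ltW; near: n; exact: near_infty_natSinv_lt (PosNum e0).
Unshelve. all: by end_near. Qed.

Lemma continuous_pairr {T U : topologicalType} (x : T) : continuous (fun z : U => (x, z)).
Proof. by move=> z; apply: cvg_pair; [exact: cvg_cst|exact: cvg_id]. Qed.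

Lemma continuous_pairl {T U : topologicalType} (z : U) : continuous (fun x : T => (x, z)).
Proof. by move=> x; apply: cvg_pair; [exact: cvg_id|exact: cvg_cst]. Qed.

Section Geometry.
Context {R : realType}.
Notation plane := (R * R)%type.
Notation space := (R * (R * R))%type.
Notation mplane := (measurableTypeR R * measurableTypeR R)%type.
Notation mspace := (measurableTypeR R * (measurableTypeR R * measurableTypeR R))%type.

Lemma continuous_plane_measurable (f : plane -> R) :
  continuous f -> @measurable_fun _ _ mplane _ setT f.
Proof.
move=> cf; apply: measurable_fun_continuous_slices => x.
- apply: continuous_measurable_fun => z.
  apply: (@continuous_comp _ _ _ (fun z => (x, z)) f); last exact: cf.
  exact: continuous_pairr.
- move=> z.
  apply: (@continuous_comp _ _ _ (fun z' => (z', x)) f); last exact: cf.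
  exact: continuous_pairl.
Qed.

Lemma continuous_space_measurable (f : space -> R) :
  continuous f -> @measurable_fun _ _ mspace _ setT f.
Proof.
move=> cf; apply: measurable_fun_continuous_slices => x.
- apply: continuous_plane_measurable => z.
  apply: (@continuous_comp _ _ _ (fun z => (x, z)) f); last exact: cf.
  exact: continuous_pairr.
- move=> z.
  apply: (@continuous_comp _ _ _ (fun z' => (z', x)) f); last exact: cf.
  exact: continuous_pairl.
Qed.

Lemma measurable_Sigma : measurable (@Sigma R : set mplane).
Proof. by apply: measurableX; exact: measurable_itv. Qed.

Lemma measurable_Omega : measurable (@Omega R : set mspace).
Proof. by apply: measurableX; [exact: measurable_itv|exact: measurable_Sigma]. Qed.

Lemma lebesgue_measure_shift (c : R) (A : set (measurableTypeR R)) : measurable A ->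
  lebesgue_measure ((fun x => x + c) @^-1` A) = lebesgue_measure A.
Proof.
have ms : measurable_fun setT (fun x : measurableTypeR R => x + c : measurableTypeR R).
  by apply: measurable_funD.
move=> mA.
rewrite -[LHS]/(pushforward lebesgue_measure (fun x : measurableTypeR R => x + c : measurableTypeR R) A).
apply/esym.
apply: (@lebesgue_measure_unique _ (pushforward lebesgue_measure (fun x : measurableTypeR R => x + c : measurableTypeR R))) => // X.
move=> [[a b] /= ab <-].
rewrite /pushforward (_ : _ @^-1` _ = [set` `]a - c, b - c] ]).
  rewrite !lebesgue_measure_itv/= !lte_fin ltrD2r.
  by case: ifP => // _; rewrite -!EFinD; congr (_%:E); ring.
by apply/seteqP; split=> x /=; rewrite !in_itv/= ltrBlDr lerBrDr.
Qed.

Definition shiftx (c : R) (y : space) : space := y + c *: e_x.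

Lemma shiftxE c y : shiftx c y = (y.1 + c, y.2).
Proof.
rewrite /shiftx /e_x; case: y => x [z1 z2]; congr (_, _) => /=; first by rewrite [_ *: _]mulr1.
by congr (_, _); rewrite /= [_ *: _]mulr0 addr0.
Qed.

Lemma shiftxD a b y : shiftx a (shiftx b y) = shiftx (b + a) y.
Proof. by rewrite /shiftx scalerDl addrA. Qed.

Lemma measurable_shiftx c : @measurable_fun _ _ mspace mspace setT (shiftx c).
Proof.
rewrite (_ : shiftx c = fun y => (y.1 + c, y.2)); last by apply/funext => y; exact: shiftxE.
apply: measurable_fun_pair; last exact: measurable_snd.
by apply: measurable_funD => //; exact: measurable_fst.
Qed.

(** Both sides define measures that agree on rectangles. *)
Lemma mu3_shiftx c (A : set mspace) : measurable A -> mu3 (shiftx c @^-1` A) = mu3 A.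
Proof.
move=> mA.
rewrite -[LHS]/(pushforward mu3 (shiftx c : mspace -> mspace) A).
have ms := measurable_shiftx c.
apply/esym.
apply: (@product_measure_unique _ _ _ _ _ lebesgue_measure mu2
  (pushforward mu3 (shiftx c : mspace -> mspace))) => // X Y mX mY.
transitivity (mu3 (((fun x : measurableTypeR R => x + c) @^-1` X) `*` Y)).
  congr mu3; apply/funext => y.
  by rewrite -[LHS]/((X `*` Y) (shiftx c y)) shiftxE.
rewrite /mu3 product_measure1E//.
  by congr (_ * _)%E; exact: lebesgue_measure_shift.
rewrite -[X in measurable X]setTI.
have ms' : measurable_fun setT (fun x : measurableTypeR R => x + c : measurableTypeR R).
  by apply: measurable_funD.
exact: ms'.
Qed.

Lemma OmegaE (y : space) : Omega y = (0 < y.1 /\ Sigma y.2) :> Prop.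
Proof. by rewrite /Omega /setX /= in_itv /= andbT. Qed.

Definition Omega_from (c : R) : set space := `]c, +oo[ `*` Sigma.

Lemma Omega_fromE c (y : space) : Omega_from c y = (c < y.1 /\ Sigma y.2) :> Prop.
Proof. by rewrite /Omega_from /setX /= in_itv /= andbT. Qed.

Lemma Omega_from_sub c : 0 <= c -> Omega_from c `<=` Omega.
Proof.
by move=> c0 y; rewrite Omega_fromE OmegaE => -[h ?]; split => //; exact: le_lt_trans h.
Qed.

Lemma measurable_Omega_from c : measurable (Omega_from c : set mspace).
Proof. by apply: measurableX; [exact: measurable_itv|exact: measurable_Sigma]. Qed.

Lemma preimage_shiftx_Omega c : shiftx c @^-1` (Omega_from c) = Omega.
Proof.
apply/funext => y; rewrite /preimage /= Omega_fromE OmegaE shiftxE /=.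
by rewrite ltrDr.
Qed.

Lemma Omega_shiftx c y : 0 <= c -> Omega y -> Omega (shiftx c y).
Proof.
by move=> c0; rewrite !OmegaE shiftxE /= => -[h ?]; split => //; exact: ltr_wpDr.
Qed.

Lemma measurable_fun_shiftx c (f : space -> R) : 0 <= c ->
  @measurable_fun _ _ mspace _ Omega f ->
  @measurable_fun _ _ mspace _ Omega (f \o shiftx c).
Proof.
move=> c0 mf; apply: (@measurable_comp _ _ _ mspace _ _ (Omega : set mspace)) => //.
- exact: measurable_Omega.
- by move=> _ [y Oy <-]; exact: Omega_shiftx.
- by apply: measurable_funTS; exact: measurable_shiftx.
Qed.

Lemma ge0_integral_shiftx c (f : space -> R) : 0 <= c ->
  @measurable_fun _ _ mspace _ Omega f -> (forall y, Omega y -> 0 <= f y) ->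
  (\int[mu3]_(y in Omega) (f (shiftx c y))%:E = \int[mu3]_(y in Omega_from c) (f y)%:E)%E.
Proof.
move=> c0 mf f0; have ms := measurable_shiftx c.
rewrite -(preimage_shiftx_Omega c).
have := @ge0_integral_pushforward _ _ mspace mspace R (shiftx c) ms mu3 (Omega_from c)
  (EFin \o f) (measurable_Omega_from c).
rewrite /comp => <-; last 2 first.
- apply/measurable_EFinP; apply: measurable_funS mf; first exact: measurable_Omega.
  exact: Omega_from_sub.
- by move=> y /set_mem/(Omega_from_sub c0)/f0; rewrite lee_fin.
by apply: eq_measure_integral => A mA _; rewrite /pushforward; exact: mu3_shiftx.
Qed.

Lemma ae_shiftx c (Q : space -> Prop) : 0 <= c ->
  {ae mu3, forall y, Omega y -> Q y} ->
  {ae mu3, forall y, Omega y -> Q (shiftx c y)}.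
Proof.
move=> c0 [N [mN N0 QN]]; exists (shiftx c @^-1` N); split.
- by rewrite -[X in measurable X]setTI; exact: measurable_shiftx.
- by rewrite mu3_shiftx.
- move=> y /= h; apply: QN => /= h'; apply: h => Oy; apply: h'; exact: Omega_shiftx.
Qed.

Lemma in_L2_shiftx c (V : space -> R[i]) : 0 <= c -> in_L2 mu3 Omega V ->
  in_L2 mu3 Omega (fun y => V (shiftx c y)).
Proof.
move=> c0 [m1 m2 h]; split.
- by have := measurable_fun_shiftx c0 m1.
- by have := measurable_fun_shiftx c0 m2.
apply: le_lt_trans h; rewrite !sqL2_rdotE.
rewrite (ge0_integral_shiftx (f := fun y => rdot (V y) (V y)))//; last 2 first.
- exact: measurable_rdot.
- by move=> y _; exact: rdot_ge0.
apply: ge0_subset_integral => //.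
- exact: measurable_Omega_from.
- exact: measurable_Omega.
- by apply/measurable_EFinP; exact: measurable_rdot.
- by move=> y _; rewrite lee_fin rdot_ge0.
- exact: Omega_from_sub.
Qed.

Lemma cvg_L2_shiftx c (V_ : nat -> space -> R[i]) V : 0 <= c ->
  (forall j, in_L2 mu3 Omega (V_ j)) -> in_L2 mu3 Omega V ->
  cvg_L2 mu3 Omega V_ V ->
  cvg_L2 mu3 Omega (fun j y => V_ j (shiftx c y)) (fun y => V (shiftx c y)).
Proof.
move=> c0 V_2 V2 cV; rewrite /cvg_L2.
apply: (squeeze_cvge _ (cvg_cst 0%E) cV); near=> j; apply/andP; split.
  by rewrite sqL2_rdotE; apply: integral_ge0 => y _; rewrite lee_fin rdot_ge0.
have [m1 m2 h] := L2_B measurable_Omega (V_2 j) V2.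
rewrite !sqL2_rdotE.
rewrite (ge0_integral_shiftx (f := fun y => rdot (V_ j y - V y) (V_ j y - V y)))//; last 2 first.
- exact: measurable_rdot.
- by move=> y _; exact: rdot_ge0.
apply: ge0_subset_integral => //.
- exact: measurable_Omega_from.
- exact: measurable_Omega.
- by apply/measurable_EFinP; exact: measurable_rdot.
- by move=> y _; rewrite lee_fin rdot_ge0.
- exact: Omega_from_sub.
Unshelve. all: by end_near. Qed.

Lemma mu2_Sigma : mu2 (@Sigma R : set mplane) = 1%E.
Proof.
rewrite /mu2 /Sigma product_measure1E//; try exact: measurable_itv.
have E : lebesgue_measure (`]0, 1[ : set R) = 1%E.
  by rewrite lebesgue_measure_itv/= lte_fin ltr01 -EFinD subr0.
by apply: (etrans (congr2 (fun a b => (a * b)%E) E E)); exact: mule1.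
Qed.

End Geometry.

Section FubiniRect.
Context {d1 d2} {T1 : measurableType d1} {T2 : measurableType d2} {R : realType}.
Variables (m1 : {sigma_finite_measure set T1 -> \bar R})
  (m2 : {sigma_finite_measure set T2 -> \bar R}).
Variables (A : set T1) (B : set T2).
Hypotheses (mA : measurable A) (mB : measurable B).
Variable f : T1 * T2 -> \bar R.
Hypothesis If : (m1 \x m2)%E.-integrable (A `*` B) f.

Lemma fubini_rect12 :
  (\int[m1 \x m2]_(y in A `*` B) f y = \int[m1]_(x in A) \int[m2]_(z in B) f (x, z))%E.
Proof.
rewrite integral_mkcond -integral12_prod_meas1; last first.
  exact: ((integrable_mkcond _ (measurableX mA mB)).1 If).
rewrite [RHS]integral_mkcond; apply: eq_integral => x _.
rewrite [in RHS]/patch; case: ifPn => xA.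
  rewrite [RHS]integral_mkcond; apply: eq_integral => z _.
  by rewrite /patch in_setX xA.
rewrite -[RHS](integral0 m2 setT); apply: eq_integral => z _.
by rewrite /patch in_setX (negbTE xA).
Qed.

Lemma fubini_rect21 :
  (\int[m1 \x m2]_(y in A `*` B) f y = \int[m2]_(z in B) \int[m1]_(x in A) f (x, z))%E.
Proof.
rewrite integral_mkcond -integral21_prod_meas1; last first.
  exact: ((integrable_mkcond _ (measurableX mA mB)).1 If).
rewrite [RHS]integral_mkcond; apply: eq_integral => z _.
rewrite [in RHS]/patch; case: ifPn => zB.
  rewrite [RHS]integral_mkcond; apply: eq_integral => x _.
  by rewrite /patch in_setX zB andbT.
rewrite -[RHS](integral0 m1 setT); apply: eq_integral => x _.
by rewrite /patch in_setX (negbTE zB) andbF.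
Qed.

End FubiniRect.

(** * Differentiable functions on the augmented space *)

Section Smooth.
Context {R : realType}.
Notation plane := (R * R)%type.
Notation space := (R * (R * R))%type.
Notation mplane := (measurableTypeR R * measurableTypeR R)%type.
Notation mspace := (measurableTypeR R * (measurableTypeR R * measurableTypeR R))%type.
Implicit Types f g h : space -> R.

(** Directional derivatives are ordinary derivatives along lines; one-variable calculus
applies to them through this lemma and its converse below. *)
Lemma is_derive_line f (y v : space) (t : R) : derivable f (t *: v + y) v ->
  is_derive t (1 : R) (fun s : R => f (s *: v + y)) ('D_v f (t *: v + y)).
Proof.
have E : (fun h : R => h^-1 *: ((f \o shift (t *: v + y)) (h *: v) - f (t *: v + y))) =
  (fun h : R => h^-1 *: (((fun s => f (s *: v + y)) \o shift t) (h *: 1) - f (t *: v + y))).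
  by apply/funext => h /=; rewrite addrA -scalerDl [h *: 1]mulr1.
move=> df; split; first by rewrite /derivable -E.
by rewrite /derive -E.
Qed.

Lemma is_derive_of_line f (y v : space) (l : R) :
  is_derive (0 : R) (1 : R) (fun s : R => f (s *: v + y)) l -> is_derive y v f l.
Proof.
have E : (fun h : R => h^-1 *: ((f \o shift y) (h *: v) - f y)) =
  (fun h : R => h^-1 *: (((fun s => f (s *: v + y)) \o shift (0:R)) (h *: 1) - f ((0:R) *: v + y))).
  by apply/funext => h /=; rewrite scale0r add0r addr0 [h *: 1]mulr1.
move=> [d1 d2]; split; first by rewrite /derivable E.
by rewrite /derive E.
Qed.

Lemma Cn_continuous n f : Cn n f -> continuous f.
Proof. by case: n => [|n] []. Qed.

Lemma Cn_derivable n f v y : Cn n.+1 f -> derivable f y v.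
Proof. by move=> [_ /(_ v)[h _]]; exact: h. Qed.

Lemma Cn_derive n f v : Cn n.+1 f -> Cn n (fun y => 'D_v f y).
Proof. by move=> [_ /(_ v)[]]. Qed.

Lemma Cn_lin n (a b : R) f g : Cn n f -> Cn n g -> Cn n (fun y => a * f y + b * g y).
Proof.
elim: n f g => [|n IH] f g Cf Cg.
  split=> // y; apply: cvgD; apply: cvgM; try exact: cvg_cst.
    exact: (Cn_continuous Cf).
  exact: (Cn_continuous Cg).
have D (v y : space) : is_derive y v (fun y => a * f y + b * g y) (a * 'D_v f y + b * 'D_v g y).
  have ? := derivableP (@Cn_derivable _ _ v y Cf); have ? := derivableP (@Cn_derivable _ _ v y Cg).
  rewrite (_ : (fun y => _) = (a *: (f : space -> R^o) + b *: (g : space -> R^o))); last exact/funext.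
  exact: is_deriveD.
split.
  move=> y; apply: cvgD; apply: cvgM; try exact: cvg_cst.
    exact: (Cn_continuous Cf).
  exact: (Cn_continuous Cg).
move=> v; split=> [y|]; first by have [] := D v y.
rewrite (_ : (fun y => _) = (fun y => a * 'D_v f y + b * 'D_v g y)).
  by apply: IH; exact: Cn_derive.
by apply/funext => y; have [] := D v y.
Qed.

Lemma continuous_shiftx c : continuous (shiftx c : space -> space).
Proof.
move=> y; rewrite /shiftx; have : y' + c *: (e_x : space) @[y' --> y] --> y + c *: (e_x : space).
  by apply: cvgD; [exact: cvg_id|exact: cvg_cst].
by [].
Qed.

Lemma Cn_shiftx n c f : Cn n f -> Cn n (fun y => f (shiftx c y)).
Proof.
elim: n f => [|n IH] f Cf.
  split=> // y.
  apply: (@continuous_comp _ _ _ (shiftx c) f); last exact: (Cn_continuous Cf).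
  exact: continuous_shiftx.
have D (v y : space) : is_derive y v (fun y => f (shiftx c y)) ('D_v f (shiftx c y)).
  apply: is_derive_of_line.
  have := @is_derive_line f (shiftx c y) v 0 (Cn_derivable Cf).
  rewrite scale0r add0r.
  by under eq_fun do rewrite addrA.
split.
  move=> y; apply: (@continuous_comp _ _ _ (shiftx c) f); last exact: (Cn_continuous Cf).
  exact: continuous_shiftx.
move=> v; split=> [y|]; first by have [] := D v y.
rewrite (_ : (fun y => _) = (fun y => (fun y => 'D_v f y) (shiftx c y))).
  exact: (IH _ (@Cn_derive _ _ v Cf)).
by apply/funext => y; have [] := D v y.
Qed.

Lemma derive_shiftx c f v y : Cn 1 f -> 'D_v (fun y => f (shiftx c y)) y = 'D_v f (shiftx c y).
Proof.
move=> Cf; apply: derive_val; apply: is_derive_of_line.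
have := @is_derive_line f (shiftx c y) v 0 (Cn_derivable Cf).
rewrite scale0r add0r.
by under eq_fun do rewrite addrA.
Qed.

Lemma derive_lin (a b : R) f g v y : Cn 1 f -> Cn 1 g ->
  'D_v (fun y => a * f y + b * g y) y = a * 'D_v f y + b * 'D_v g y.
Proof.
move=> Cf Cg; apply: derive_val.
have ? := derivableP (@Cn_derivable _ _ v y Cf); have ? := derivableP (@Cn_derivable _ _ v y Cg).
rewrite (_ : (fun y => _) = (a *: (f : space -> R^o) + b *: (g : space -> R^o))); last exact/funext.
exact: is_deriveD.
Qed.

Lemma derive_mul f g v y : Cn 1 f -> Cn 1 g ->
  'D_v (fun y => f y * g y) y = f y * 'D_v g y + 'D_v f y * g y.
Proof.
move=> Cf Cg; apply: derive_val.
have ? := derivableP (@Cn_derivable _ _ v y Cf); have ? := derivableP (@Cn_derivable _ _ v y Cg).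
apply: is_derive_eq; by rewrite [X in _ + X = _]mulrC.
Qed.

Lemma Cn1_mul f g : Cn 1 f -> Cn 1 g -> Cn 1 (fun y => f y * g y).
Proof.
move=> Cf Cg; split.
  by move=> y; apply: cvgM; [exact: (Cn_continuous Cf)|exact: (Cn_continuous Cg)].
move=> v; split.
  by move=> y; apply: derivableM; [exact: Cn_derivable Cf|exact: Cn_derivable Cg].
split=> //; rewrite (_ : (fun y => _) = (fun y => f y * 'D_v g y + 'D_v f y * g y)).
  move=> y; apply: cvgD; apply: cvgM.
  - exact: (Cn_continuous Cf).
  - exact: (Cn_continuous (Cn_derive v Cg)).
  - exact: (Cn_continuous (Cn_derive v Cf)).
  - exact: (Cn_continuous Cg).
by apply/funext => y; exact: derive_mul.
Qed.

Definition bounded_x_support f := exists M : R, forall x z, M < `|x| -> f (x, z) = 0.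

(** The regularity that the boundary-term formulas need; it is stable under products and
under multiplication by a weight. *)
Definition C1per h := [/\ Cn 1 h,
  forall x z1 z2, h (x, (z1 + 1, z2)) = h (x, (z1, z2)) /\
                  h (x, (z1, z2 + 1)) = h (x, (z1, z2)) & bounded_x_support h].

Lemma bounded_x_support_derive h v : Cn 1 h -> bounded_x_support h -> bounded_x_support (fun y => 'D_v h y).
Proof.
move=> Ch [M hM]; exists M => x z Mx.
have oU : open [set y : space | M < `|y.1|].
  have := @open_comp _ _ (fun y : space => `|y.1|) [set r | M < r]; apply.
    move=> y _; apply: continuous_comp; last exact: norm_continuous.
    exact: cvg_fst.
  exact: open_gt.
have : \forall y \near (x, z), h y = (cst 0 : space -> R) y.
  have : nbhs (x, z) [set y : space | M < `|y.1|] by exact: open_nbhs_nbhs.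
  by apply: filterS => -[x' z'] /= /hM.
move=> E; rewrite (near_eq_derive _ E); exact: derive_cst.
Qed.

Lemma continuous_bounded_Omega f : continuous f -> bounded_x_support f ->
  exists B : R, forall y, Omega y -> `|f y| <= B.
Proof.
move=> cf [M fM].
pose K : set space := `[0, M] `*` (`[0, 1] `*` `[0, 1]).
have cK : compact K.
  by apply: compact_setX; [|apply: compact_setX]; exact: segment_compact.
have [B hB] : exists B, forall y, K y -> `|f y| <= B.
  have /compact_bounded[B [_ hB]] : compact (f @` K).
    by apply: continuous_compact => //; exact: continuous_subspaceT.
  exists (B + 1) => y Ky; apply: (hB (B + 1)); first by rewrite ltrDl.
  by exists y.
exists (Num.max B 0) => -[x [z1 z2]] [/= x0 [/= h1 h2]].
move: x0 h1 h2; rewrite !in_itv/= andbT => x0 /andP[? ?] /andP[? ?].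
have [xM|xM] := leP x M.
  rewrite le_max hB//; split; rewrite /= ?in_itv/= ?xM ?ltW//.
by rewrite fM; [rewrite normr0 le_max lexx orbT|rewrite gtr0_norm].
Qed.

Lemma bounded_x_support_integrable f : continuous f -> bounded_x_support f ->
  mu3.-integrable (Omega : set mspace) (EFin \o f).
Proof.
move=> cf sf; have [B fB] := continuous_bounded_Omega cf sf.
case: sf => M fM.
pose K : set mspace := `]0, Num.max M 1] `*` Sigma.
have mK : measurable K by apply: measurableX; [exact: measurable_itv|exact: measurable_Sigma].
have KO : K `<=` Omega.
  move=> -[x z] [/= h ?]; split => //=.
  by move: h; rewrite !in_itv/= andbT => /andP[].
have IK : mu3.-integrable K (EFin \o f).
  apply: measurable_bounded_integrable => //.
  - have E : mu3 K = (lebesgue_measure (`]0%R, (Num.max M 1)%R] : set (measurableTypeR R)) *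
        mu2 (Sigma : set mplane))%E.
      by rewrite /mu3 /K product_measure1E//; exact: measurable_Sigma.
    rewrite [ltLHS]E mu2_Sigma mule1 lebesgue_measure_itv/=.
    by case: ifP => _; rewrite -?EFinD ltry.
  - by apply: measurable_funTS; exact: continuous_space_measurable.
  - exists B; split; first by rewrite num_real.
    by move=> r Br y Ky; exact: le_trans (fB _ (KO _ Ky)) (ltW Br).
have := @integrable_restrict _ mspace R mu3 K mK Omega measurable_Omega (EFin \o f).
rewrite setIidr// => -[+ _] => /(_ IK).
apply: eq_integrable; first exact: measurable_Omega.
move=> -[x z] /set_mem [/= h Sz].
rewrite /patch; case: ifPn => // /negP nK; rewrite fM//.
move: h; rewrite in_itv/= andbT => x0.
rewrite gtr0_norm// ltNge; apply/negP => xM; apply: nK; apply/mem_set; split => //=.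
by rewrite in_itv/= x0 le_max xM.
Qed.

Lemma FTC_line (phi psi : R -> R) (a b : R) : a < b ->
  (forall t, is_derive t (1 : R) phi (psi t)) -> continuous psi ->
  (\int[lebesgue_measure]_(t in `]a, b[) (psi t)%:E = (phi b - phi a)%:E)%E.
Proof.
move=> ab D cpsi.
have dphi t : derivable phi t 1 by have [] := D t.
have cphi : continuous phi.
  by move=> t; apply: differentiable_continuous; apply/derivable1_diffP.
have mpsi A : measurable_fun A (EFin \o psi).
  by apply/measurable_EFinP; apply: measurable_funTS; exact: continuous_measurable_fun.
rewrite integral_itv_bndo_bndc; last exact: mpsi.
rewrite integral_itv_obnd_cbnd; last exact: mpsi.
rewrite EFinB; apply: continuous_FTC2 => //.
- exact: continuous_subspaceT.
- split; first by move=> t _; exact: dphi.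
  + by apply: cvg_at_right_filter; exact: cphi.
  + by apply: cvg_at_left_filter; exact: cphi.
- by move=> t _; rewrite derive1E; have [] := D t.
Qed.

Lemma line_x (x : R) (z : plane) : x *: (e_x : space) + (0, z) = (x, z).
Proof.
rewrite /e_x; congr (_, _) => /=; first by rewrite [_ *: _]mulr1 addr0.
by case: z => z1 z2; congr (_, _); rewrite /= [_ *: _]mulr0 add0r.
Qed.
End Smooth.

(** * Green's formula for real functions with bounded support *)

Section Green.
Context {R : realType}.
Notation plane := (R * R)%type.
Notation space := (R * (R * R))%type.
Notation mplane := (measurableTypeR R * measurableTypeR R)%type.
Notation mspace := (measurableTypeR R * (measurableTypeR R * measurableTypeR R))%type.
Implicit Types f g h : space -> R.

Lemma line_z1 (x z1 z2 : R) : z1 *: (e_z1 : space) + (x, (0, z2)) = (x, (z1, z2)).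
Proof.
rewrite /e_z1; congr (_, _) => /=; first by rewrite [_ *: _]mulr0 add0r.
by congr (_, _); rewrite /= ?[_ *: _]mulr0 ?[_ *: _]mulr1 ?add0r ?addr0.
Qed.

Lemma line_z2 (x z1 z2 : R) : z2 *: (e_z2 : space) + (x, (z1, 0)) = (x, (z1, z2)).
Proof.
rewrite /e_z2; congr (_, _) => /=; first by rewrite [_ *: _]mulr0 add0r.
by congr (_, _); rewrite /= ?[_ *: _]mulr0 ?[_ *: _]mulr1 ?add0r ?addr0.
Qed.

Lemma is_derive_x h x z : Cn 1 h ->
  is_derive x (1 : R) (fun t => h (t, z)) ('D_(e_x : space) h (x, z)).
Proof.
move=> Ch; have := @is_derive_line _ h (0, z) e_x x (Cn_derivable Ch).
by under eq_fun do rewrite line_x; rewrite line_x.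
Qed.

Lemma is_derive_z1 h x z1 z2 : Cn 1 h ->
  is_derive z1 (1 : R) (fun t => h (x, (t, z2))) ('D_(e_z1 : space) h (x, (z1, z2))).
Proof.
move=> Ch; have := @is_derive_line _ h (x, (0, z2)) e_z1 z1 (Cn_derivable Ch).
by under eq_fun do rewrite line_z1; rewrite line_z1.
Qed.

Lemma is_derive_z2 h x z1 z2 : Cn 1 h ->
  is_derive z2 (1 : R) (fun t => h (x, (z1, t))) ('D_(e_z2 : space) h (x, (z1, z2))).
Proof.
move=> Ch; have := @is_derive_line _ h (x, (z1, 0)) e_z2 z2 (Cn_derivable Ch).
by under eq_fun do rewrite line_z2; rewrite line_z2.
Qed.

Lemma continuous_x f z : continuous f -> continuous (fun x : R => f (x, z)).
Proof.
move=> cf x; apply: (@continuous_comp _ _ _ (fun x => (x, z)) f); last exact: cf.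
exact: continuous_pairl.
Qed.

Lemma continuous_z f x : continuous f -> continuous (fun z : plane => f (x, z)).
Proof.
move=> cf z; apply: (@continuous_comp _ _ _ (fun z => (x, z)) f); last exact: cf.
exact: continuous_pairr.
Qed.

Lemma continuous_integrable_Sigma f x : continuous f -> bounded_x_support f ->
  mu2.-integrable (Sigma : set mplane) (EFin \o (fun z => f (x, z))).
Proof.
move=> cf sf.
have [B fB] : exists B, forall z, Sigma z -> `|f (x, z)| <= B.
  pose g y := f (shiftx (x - 1) y).
  have cg : continuous g.
    move=> y; apply: (@continuous_comp _ _ _ (shiftx (x - 1)) f); last exact: cf.
    exact: continuous_shiftx.
  have sg : bounded_x_support g.
    case: sf => M fM; exists (M + `|x - 1|) => a z Ma; rewrite /g shiftxE /=; apply: fM.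
    have := ler_normB (a + (x - 1)) (x - 1); rewrite addrK; lra.
  have [B gB] := continuous_bounded_Omega cg sg.
  exists B => z Sz; have := gB (1, z); rewrite /g shiftxE /= subrKC; apply.
  by rewrite OmegaE.
apply: measurable_bounded_integrable.
- exact: measurable_Sigma.
- by rewrite [ltLHS]mu2_Sigma ltry.
- apply: measurable_funTS; apply: continuous_plane_measurable; exact: continuous_z.
- exists B; split; first by rewrite num_real.
  by move=> r Br y Ky; exact: le_trans (fB _ Ky) (ltW Br).
Qed.

(** The support is bounded in x, so only the face x = 0 contributes. *)
Lemma integral_dx h : C1per h ->
  \int[mu3]_(y in Omega) 'D_(e_x : space) h y = - \int[mu2]_(z in Sigma) h (0, z).
Proof.
move=> [Ch _ sh].
have cD : continuous (fun y => 'D_(e_x : space) h y) := Cn_continuous (Cn_derive e_x Ch).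
have sD := bounded_x_support_derive (e_x : space) Ch sh.
have ID := bounded_x_support_integrable cD sD.
case: sh => M hM; case: sD => M' DM.
pose L := Num.max (Num.max M M') 0 + 1.
have L0 : 0 < L by rewrite /L ltr_pwDr// le_max lexx orbT.
have LM : M < L by rewrite /L ltr_pwDr// !le_max lexx.
have LM' : M' < L by rewrite /L ltr_pwDr// !le_max lexx !orbT.
rewrite /Rintegral.
rewrite (@fubini_rect21 _ _ _ _ _ lebesgue_measure mu2 `]0, +oo[ Sigma _ measurable_Sigma _ ID);
  last exact: measurable_itv.
have inner z : (\int[lebesgue_measure]_(x in `]0%R, +oo[) (EFin \o (fun y => 'D_(e_x : space) h y)) (x, z)
    = (- h (0%R, z))%:E)%E.
  rewrite (@itv_bndbnd_setU _ _ (BRight (0:R)) (BLeft L)) ?bnd_simp//.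
  rewrite integral_setU//=.
  - have F := @FTC_line R (fun t => h (t, z)) (fun t => 'D_(e_x : space) h (t, z)) 0 L L0
      (fun t => is_derive_x t z Ch) (@continuous_x _ z cD).
    rewrite [X in (X + _)%E]F.
    rewrite hM ?sub0r; last by rewrite gtr0_norm.
    rewrite (eq_integral (cst 0%E)); first by rewrite integral0 adde0.
    move=> t; rewrite inE/= in_itv/= andbT => Lt; rewrite DM//.
    by rewrite gtr0_norm ?(lt_le_trans L0)// (lt_le_trans LM').
  - apply/measurable_EFinP; apply: measurable_funTS; apply: continuous_measurable_fun.
    exact: (@continuous_x _ z cD).
  - apply/disj_setPS => t /= []; rewrite !in_itv/= andbT => /andP[_ tL].
    by rewrite leNgt tL.
transitivity (fine (\int[mu2]_(z in Sigma) (- h (0%R, z))%:E)%E).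
  by congr fine; apply: eq_integral => z _; exact: inner.
rewrite -mulN1r -RintegralZl//; last 2 first.
- exact: measurable_Sigma.
- by apply: continuous_integrable_Sigma; [exact: (Cn_continuous Ch)|exists M].
by congr fine; apply: eq_integral => z _; rewrite mulN1r.
Qed.


(** Periodicity makes the contributions of the faces z1 = 0 and z1 = 1 cancel. *)
Lemma integral_dz1 h : C1per h -> \int[mu3]_(y in Omega) 'D_(e_z1 : space) h y = 0.
Proof.
move=> [Ch per sh].
have cD : continuous (fun y => 'D_(e_z1 : space) h y) := Cn_continuous (Cn_derive e_z1 Ch).
have sD := bounded_x_support_derive (e_z1 : space) Ch sh.
have ID := bounded_x_support_integrable cD sD.
rewrite /Rintegral (@fubini_rect12 _ _ _ _ _ lebesgue_measure mu2 `]0, +oo[ Sigma _ measurable_Sigma _ ID);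
  last exact: measurable_itv.
rewrite (eq_integral (cst 0%E)) ?integral0// => x _.
rewrite (@fubini_rect21 _ _ _ _ _ lebesgue_measure lebesgue_measure `]0, 1[ `]0, 1[ _ _
    (EFin \o (fun z => 'D_(e_z1 : space) h (x, z)))); last 3 first.
- exact: measurable_itv.
- exact: measurable_itv.
- exact: (@continuous_integrable_Sigma _ x cD sD).
rewrite (eq_integral (cst 0%E)) ?integral0// => z2 _.
have F := @FTC_line R (fun t => h (x, (t, z2))) (fun t => 'D_(e_z1 : space) h (x, (t, z2))) 0 1 ltr01
      (fun t => is_derive_z1 x t z2 Ch).
rewrite [LHS]F.
  have [E _] := per x 0 z2; rewrite add0r in E.
  by rewrite E subrr.
move=> t; apply: (@continuous_comp _ _ _ (fun t => (t, z2)) (fun z => 'D_(e_z1 : space) h (x, z))).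
  exact: continuous_pairl.
exact: (@continuous_z _ x cD).
Qed.

Lemma integral_dz2 h : C1per h -> \int[mu3]_(y in Omega) 'D_(e_z2 : space) h y = 0.
Proof.
move=> [Ch per sh].
have cD : continuous (fun y => 'D_(e_z2 : space) h y) := Cn_continuous (Cn_derive e_z2 Ch).
have sD := bounded_x_support_derive (e_z2 : space) Ch sh.
have ID := bounded_x_support_integrable cD sD.
rewrite /Rintegral (@fubini_rect12 _ _ _ _ _ lebesgue_measure mu2 `]0, +oo[ Sigma _ measurable_Sigma _ ID);
  last exact: measurable_itv.
rewrite (eq_integral (cst 0%E)) ?integral0// => x _.
rewrite (@fubini_rect12 _ _ _ _ _ lebesgue_measure lebesgue_measure `]0, 1[ `]0, 1[ _ _
    (EFin \o (fun z => 'D_(e_z2 : space) h (x, z)))); last 3 first.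
- exact: measurable_itv.
- exact: measurable_itv.
- exact: (@continuous_integrable_Sigma _ x cD sD).
rewrite (eq_integral (cst 0%E)) ?integral0// => z1 _.
have F := @FTC_line R (fun t => h (x, (z1, t))) (fun t => 'D_(e_z2 : space) h (x, (z1, t))) 0 1 ltr01
      (fun t => is_derive_z2 x z1 t Ch).
rewrite [LHS]F.
  have [_ E] := per x z1 0; rewrite add0r in E.
  by rewrite E subrr.
move=> t; apply: (@continuous_comp _ _ _ (fun t => (z1, t)) (fun z => 'D_(e_z2 : space) h (x, z))).
  exact: continuous_pairr.
exact: (@continuous_z _ x cD).
Qed.

(** For b = 0 this is the constant 1; for b = 1 it vanishes at x = 0, which removes the
boundary term of Green's formula. *)
Definition weight (a b x : R) : R := 1 - b * expR (- (a * x)).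
(** The derivative of [weight a b]. *)
Definition weight' (a b x : R) : R := b * (a * expR (- (a * x))).

Lemma is_derive_weight a b (v y : space) :
  is_derive y v (fun y : space => weight a b y.1) (weight' a b y.1 * v.1).
Proof.
apply: is_derive_of_line.
have H : is_derive (0:R) (1:R) (fun s : R => - (a * (s * v.1 + y.1))) (- (a * v.1)).
  rewrite (_ : (fun s : R => _) =
     - ((a *: ((v.1 *: (id : R -> R)) + cst y.1)) : R -> R)); last first.
    by apply/funext => s; rewrite /= !fctE /= /GRing.scale/= (mulrC s).
  apply: is_derive_eq.
  by rewrite addr0 /GRing.scale/= mulr1.
have He := @is_derive1_comp R expR (fun s : R => - (a * (s * v.1 + y.1))) 0 _ _ (is_derive_expR _) H.
rewrite (_ : (fun s : R => _) = (cst 1 - b *: (expR \o (fun s : R => - (a * (s * v.1 + y.1)))) : R -> R)).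
  apply: is_derive_eq.
  rewrite /weight' /GRing.scale/= mul0r !add0r; ring.
by apply/funext => s; rewrite /weight.
Qed.

Lemma continuous_weight' a b : continuous (fun y : space => weight' a b y.1).
Proof.
move=> y; apply: (@continuous_comp _ _ _ (fun y : space => y.1) (weight' a b)).
  exact: cvg_fst.
apply: cvgM; first exact: cvg_cst.
apply: cvgM; first exact: cvg_cst.
apply: (@continuous_comp _ _ _ (fun x : R => - (a * x)) expR); last exact: continuous_expR.
by apply: cvgN; apply: cvgM; [exact: cvg_cst|exact: cvg_id].
Qed.

Lemma Cn1_weight a b : Cn 1 (fun y : space => weight a b y.1).
Proof.
split.
  move=> y; apply: (@continuous_comp _ _ _ (fun y : space => y.1) (weight a b)).
    exact: cvg_fst.
  apply: cvgB; first exact: cvg_cst.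
  apply: cvgM; first exact: cvg_cst.
  apply: (@continuous_comp _ _ _ (fun x : R => - (a * x)) expR); last exact: continuous_expR.
  by apply: cvgN; apply: cvgM; [exact: cvg_cst|exact: cvg_id].
move=> v; split; first by move=> y; have [] := is_derive_weight a b v y.
split=> //; rewrite (_ : (fun y => _) = (fun y : space => weight' a b y.1 * v.1)).
  by move=> y; apply: cvgM; [exact: continuous_weight'|exact: cvg_cst].
by apply/funext => y; have [] := is_derive_weight a b v y.
Qed.

Lemma C1per_mul f g : C1per f -> C1per g -> C1per (fun y => f y * g y).
Proof.
move=> [f1 f2 [M fM]] [g1 g2 _]; split; first exact: Cn1_mul.
  by move=> x z1 z2; have [-> ->] := f2 x z1 z2; have [-> ->] := g2 x z1 z2.
by exists M => x z Mx; rewrite fM// mul0r.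
Qed.

Lemma C1per_weight a b f : C1per f -> C1per (fun y => weight a b y.1 * f y).
Proof.
move=> [f1 f2 [M fM]]; split; first by apply: Cn1_mul => //; exact: Cn1_weight.
  by move=> x z1 z2; have [/= -> ->] := f2 x z1 z2.
by exists M => x z Mx; rewrite fM// mulr0.
Qed.

(** The integrand is the divergence of (f1, f2) multiplied by the weight and by w. *)
Lemma green_real (t1 t2 a b : R) f1 f2 w : C1per f1 -> C1per f2 -> C1per w ->
  \int[mu3]_(y in Omega) (weight a b y.1 *
      (('D_(e_x : space) f1 y + (t1 * 'D_(e_z1 : space) f2 y + t2 * 'D_(e_z2 : space) f2 y)) * w y +
       f1 y * 'D_(e_x : space) w y +
       f2 y * (t1 * 'D_(e_z1 : space) w y + t2 * 'D_(e_z2 : space) w y)) +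
     weight' a b y.1 * (f1 y * w y)) =
  - ((1 - b) * \int[mu2]_(z in Sigma) (f1 (0, z) * w (0, z))).
Proof.
move=> C1 C2 Cw.
have P1 := C1per_mul C1 Cw; have P2 := C1per_mul C2 Cw.
have Q1 := C1per_weight a b P1; have Q2 := C1per_weight a b P2.
have I (h : space -> R) (v : space) : C1per h ->
    mu3.-integrable (Omega : set mspace) (EFin \o (fun y => 'D_v h y)).
  move=> [Ch _ sh]; apply: bounded_x_support_integrable; first exact: (Cn_continuous (Cn_derive v Ch)).
  exact: bounded_x_support_derive.
have [D1 _ _] := C1; have [D2 _ _] := C2; have [Dw _ _] := Cw.
transitivity (\int[mu3]_(y in Omega)
   ('D_(e_x : space) (fun y => weight a b y.1 * (f1 y * w y)) y +
   (t1 * 'D_(e_z1 : space) (fun y => weight a b y.1 * (f2 y * w y)) y +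
    t2 * 'D_(e_z2 : space) (fun y => weight a b y.1 * (f2 y * w y)) y))).
  apply: eq_Rintegral => y _.
  have DW v : 'D_v (fun y : space => weight a b y.1) y = weight' a b y.1 * v.1.
    by have [] := is_derive_weight a b v y.
  have E (v : space) f : Cn 1 f -> 'D_v (fun y => weight a b y.1 * (f y * w y)) y =
      weight a b y.1 * (f y * 'D_v w y + 'D_v f y * w y) + weight' a b y.1 * v.1 * (f y * w y).
    move=> Cf; rewrite (@derive_mul _ _ _ v y (Cn1_weight a b) (Cn1_mul Cf Dw)).
    by rewrite (@derive_mul _ _ _ v y Cf Dw) DW.
  rewrite (E e_x _ D1) (E e_z1 _ D2) (E e_z2 _ D2).
  rewrite [e_x.1]/= [e_z1.1]/= [e_z2.1]/=.
  move: ('D_(e_x : space) f1 y) ('D_(e_z1 : space) f2 y) ('D_(e_z2 : space) f2 y)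
    ('D_(e_x : space) w y) ('D_(e_z1 : space) w y) ('D_(e_z2 : space) w y)
    (weight a b y.1) (weight' a b y.1) (f1 y) (f2 y) (w y) => d1 d2 d3 d4 d5 d6 w1 w2 u1 u2 u3.
  ring.
have IZ (t : R) (h : space -> R) (v : space) : C1per h ->
    mu3.-integrable (Omega : set mspace) (EFin \o (fun y => t * 'D_v h y)).
  by move=> Ch; apply: integrable_scaler; [exact: measurable_Omega|exact: I].
rewrite RintegralD//; last 3 first.
- exact: measurable_Omega.
- exact: I.
- by apply: integrable_addr; [exact: measurable_Omega|exact: IZ|exact: IZ].
rewrite RintegralD//; last 3 first.
- exact: measurable_Omega.
- exact: IZ.
- exact: IZ.
have Z (t : R) (h : space -> R) (v : space) : C1per h ->
    \int[mu3]_(y in Omega) (t * 'D_v h y) = t * \int[mu3]_(y in Omega) 'D_v h y.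
  by move=> Ch; apply: RintegralZl; [exact: measurable_Omega|exact: I].
have A2 := etrans (Z t1 _ (e_z1 : space) Q2) (etrans (congr1 ( *%R t1) (integral_dz1 Q2)) (mulr0 _)).
have A3 := etrans (Z t2 _ (e_z2 : space) Q2) (etrans (congr1 ( *%R t2) (integral_dz2 Q2)) (mulr0 _)).
apply: (etrans (congr2 +%R (integral_dx Q1) (congr2 +%R A2 A3))).
rewrite !addr0; congr (- _).
have [E _ [M hM]] := P1.
rewrite -RintegralZl//; last 2 first.
- exact: measurable_Sigma.
- by apply: (continuous_integrable_Sigma _ (Cn_continuous E)); exists M.
by apply: eq_Rintegral => z _; rewrite /weight /= mulr0 oppr0 expR0 mulr1.
Qed.

End Green.

(** * Test functions *)

Section Test.
Context {R : realType}.
Notation C := R[i].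
Notation plane := (R * R)%type.
Notation space := (R * (R * R))%type.
Notation mplane := (measurableTypeR R * measurableTypeR R)%type.
Notation mspace := (measurableTypeR R * (measurableTypeR R * measurableTypeR R))%type.
Implicit Types phi psi : space -> C.

Lemma test_C1per_Re phi : test_function phi -> C1per (fun y => complex.Re (phi y)).
Proof.
move=> [h1 _ h3 [M hM]]; split; first exact: h1.
  by move=> x z1 z2; have [-> ->] := h3 x z1 z2.
by exists M => x z Mx; rewrite hM.
Qed.

Lemma test_C1per_Im phi : test_function phi -> C1per (fun y => complex.Im (phi y)).
Proof.
move=> [_ h1 h3 [M hM]]; split; first exact: h1.
  by move=> x z1 z2; have [-> ->] := h3 x z1 z2.
by exists M => x z Mx; rewrite hM.
Qed.

Lemma Re_lin (l a b : C) :
  complex.Re (l * a + b) = complex.Re l * complex.Re a + 1 * (- complex.Im l * complex.Im a + 1 * complex.Re b).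
Proof. by case: l => ? ?; case: a => ? ?; case: b => ? ? /=; ring. Qed.

Lemma Im_lin (l a b : C) :
  complex.Im (l * a + b) = complex.Re l * complex.Im a + 1 * (complex.Im l * complex.Re a + 1 * complex.Im b).
Proof. by case: l => ? ?; case: a => ? ?; case: b => ? ? /=; ring. Qed.

Lemma test_lin (l : C) phi psi : test_function phi -> test_function psi ->
  test_function (fun y => l * phi y + psi y).
Proof.
move=> [p1 p2 p3 [M pM]] [q1 q2 q3 [N qN]]; split.
- move=> n; rewrite (_ : (fun y => _) = (fun y => complex.Re l * complex.Re (phi y) +
    1 * (- complex.Im l * complex.Im (phi y) + 1 * complex.Re (psi y)))); last first.
    by apply/funext => y; exact: Re_lin.
  apply: (@Cn_lin _ n (complex.Re l) 1 _ (fun y => - complex.Im l * complex.Im (phi y) + 1 * complex.Re (psi y))) => //.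
  exact: Cn_lin.
- move=> n; rewrite (_ : (fun y => _) = (fun y => complex.Re l * complex.Im (phi y) +
    1 * (complex.Im l * complex.Re (phi y) + 1 * complex.Im (psi y)))); last first.
    by apply/funext => y; exact: Im_lin.
  apply: (@Cn_lin _ n (complex.Re l) 1 _ (fun y => complex.Im l * complex.Re (phi y) + 1 * complex.Im (psi y))) => //.
  exact: Cn_lin.
- by move=> x z1 z2; have [-> ->] := p3 x z1 z2; have [-> ->] := q3 x z1 z2.
- exists (Num.max M N) => x z; rewrite gt_max => /andP[h1 h2].
  by rewrite pM// qN// mulr0 addr0.
Qed.

Lemma test_shiftx c phi : test_function phi -> test_function (fun y => phi (shiftx c y)).
Proof.
move=> [p1 p2 p3 [M pM]]; split.
- by move=> n; have := Cn_shiftx c (p1 n).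
- by move=> n; have := Cn_shiftx c (p2 n).
- by move=> x z1 z2; rewrite !shiftxE /=; exact: p3.
- exists (M + `|c|) => x z h; rewrite shiftxE /=; apply: pM.
  have := ler_normB (x + c) c; rewrite addrK; lra.
Qed.

Lemma test_0 : test_function (fun=> 0 : C).
Proof.
have C0 n : Cn n (fun=> 0 : R).
  elim: n => [|n IH]; first by split=> // y; exact: cvg_cst.
  split; first by move=> y; exact: cvg_cst.
  move=> v; split=> [y|]; first exact: derivable_cst.
  rewrite (_ : (fun y => _) = (fun=> 0)) //.
  by apply/funext => y; exact: derive_cst.
by split => //; exists 0.
Qed.

Lemma partial_lin v (l : C) phi psi y : test_function phi -> test_function psi ->
  partial v (fun y => l * phi y + psi y) y = l * partial v phi y + partial v psi y.
Proof.
move=> /[dup] tp [p1 p2 _ _] /[dup] tq [q1 q2 _ _].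
rewrite /partial.
have -> : (fun y => complex.Re (l * phi y + psi y)) = (fun y => complex.Re l * complex.Re (phi y) +
    1 * (- complex.Im l * complex.Im (phi y) + 1 * complex.Re (psi y))).
  by apply/funext => z; exact: Re_lin.
have -> : (fun y => complex.Im (l * phi y + psi y)) = (fun y => complex.Re l * complex.Im (phi y) +
    1 * (complex.Im l * complex.Re (phi y) + 1 * complex.Im (psi y))).
  by apply/funext => z; exact: Im_lin.
have E1 := @derive_lin _ (- complex.Im l) 1 _ _ v y (p2 1%N) (q1 1%N).
have E2 := @derive_lin _ (complex.Im l) 1 _ _ v y (p1 1%N) (q2 1%N).
have E3 := @derive_lin _ (complex.Re l) 1 _ _ v y (p1 1%N) (Cn_lin (- complex.Im l) 1 (p2 1%N) (q1 1%N)).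
have E4 := @derive_lin _ (complex.Re l) 1 _ _ v y (p2 1%N) (Cn_lin (complex.Im l) 1 (p1 1%N) (q2 1%N)).
rewrite E3 E4 E1 E2.
by apply/eqP; rewrite eq_complex; apply/andP; split; apply/eqP;
  rewrite /= ?Re_lin ?Im_lin; case: l {E1 E2 E3 E4} => ? ? /=; ring.
Qed.

Lemma partial_shiftx c v phi y : test_function phi ->
  partial v (fun y => phi (shiftx c y)) y = partial v phi (shiftx c y).
Proof.
move=> [p1 p2 _ _]; rewrite /partial.
have E1 := @derive_shiftx _ c _ v y (p1 1%N); have E2 := @derive_shiftx _ c _ v y (p2 1%N).
by rewrite E1 E2.
Qed.

Variables t1 t2 : R.

Lemma dTheta_lin (l : C) phi psi y : test_function phi -> test_function psi ->
  dTheta t1 t2 (fun y => l * phi y + psi y) y = l * dTheta t1 t2 phi y + dTheta t1 t2 psi y.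
Proof. 
move=> p q; rewrite /dTheta (@partial_lin e_z1 l phi psi y p q) (@partial_lin e_z2 l phi psi y p q).
by move: (partial e_z1 phi y) (partial e_z2 phi y) (partial e_z1 psi y) (partial e_z2 psi y)
  => d1 d2 d3 d4; ring.
 Qed.

Lemma dTheta_shiftx c phi y : test_function phi ->
  dTheta t1 t2 (fun y => phi (shiftx c y)) y = dTheta t1 t2 phi (shiftx c y).
Proof. 
by move=> p; rewrite /dTheta (@partial_shiftx c e_z1 phi y p) (@partial_shiftx c e_z2 phi y p).
 Qed.

Lemma vec20 (a b : C) : vec2 a b 0 0 = a. Proof. by rewrite mxE. Qed.
Lemma vec21 (a b : C) : vec2 a b 1 0 = b. Proof. by rewrite mxE. Qed.

Lemma continuous_in_L2 phi : continuous (fun y => complex.Re (phi y)) ->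
  continuous (fun y => complex.Im (phi y)) ->
  bounded_x_support (fun y => complex.Re (phi y)) -> bounded_x_support (fun y => complex.Im (phi y)) ->
  in_L2 mu3 Omega phi.
Proof.
move=> c1 c2 [M s1] [N s2]; apply/in_L2P; split; try (by apply: measurable_funTS; exact: continuous_space_measurable).
apply: bounded_x_support_integrable.
  by move=> y; apply: cvgD; apply: cvgM; [exact: c1|exact: c1|exact: c2|exact: c2].
exists (Num.max M N) => x z; rewrite gt_max => /andP[h1 h2].
by rewrite /rdot s1// s2// mul0r addr0.
Qed.

Lemma test_L2 phi : test_function phi -> in_L2 mu3 Omega phi.
Proof.
move=> tp; have [c1 _ s1] := test_C1per_Re tp; have [c2 _ s2] := test_C1per_Im tp.
by apply: continuous_in_L2 => //; [exact: (Cn_continuous c1)|exact: (Cn_continuous c2)].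
Qed.

Lemma partial_L2 v phi : test_function phi -> in_L2 mu3 Omega (partial v phi).
Proof.
move=> tp; have [c1 _ s1] := test_C1per_Re tp; have [c2 _ s2] := test_C1per_Im tp.
apply: continuous_in_L2.
- exact: (Cn_continuous (Cn_derive v c1)).
- exact: (Cn_continuous (Cn_derive v c2)).
- exact: bounded_x_support_derive.
- exact: bounded_x_support_derive.
Qed.

Lemma dTheta_L2 phi : test_function phi -> in_L2 mu3 Omega (dTheta t1 t2 phi).
Proof.
move=> tp; apply: L2_D; first exact: measurable_Omega.
  by apply: L2_Z; [exact: measurable_Omega|exact: partial_L2].
by apply: L2_Z; [exact: measurable_Omega|exact: partial_L2].
Qed.

Lemma grad_L2 phi i : test_function phi -> in_L2 mu3 Omega (fun y => ThetaT_grad t1 t2 phi y i 0).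
Proof.
move=> tp; have -> : (fun y => ThetaT_grad t1 t2 phi y i 0) =
    if i == 0 then partial e_x phi else dTheta t1 t2 phi.
  by apply/funext => y; rewrite mxE; case: ifP.
by case: ifP => _; [exact: partial_L2|exact: dTheta_L2].
Qed.

Lemma div_L2 (W : space -> 'cV[C]_2) : (forall i, test_function (fun y => W y i 0)) ->
  in_L2 mu3 Omega (div_Theta t1 t2 W).
Proof.
move=> tW; apply: L2_D; first exact: measurable_Omega.
  exact: partial_L2.
exact: dTheta_L2.
Qed.

Lemma trace_L2 phi x : test_function phi -> in_L2 mu2 Sigma (fun z => phi (x, z)).
Proof.
move=> tp; have [c1 _ s1] := test_C1per_Re tp; have [c2 _ s2] := test_C1per_Im tp.
apply/in_L2P; split; try (apply: measurable_funTS; apply: continuous_plane_measurable).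
- exact: (@continuous_z _ _ x (Cn_continuous c1)).
- exact: (@continuous_z _ _ x (Cn_continuous c2)).
apply: (@continuous_integrable_Sigma _ (fun y => rdot (phi y) (phi y)) x).
  move=> y; apply: cvgD; apply: cvgM.
  - exact: (Cn_continuous c1).
  - exact: (Cn_continuous c1).
  - exact: (Cn_continuous c2).
  - exact: (Cn_continuous c2).
case: s1 => M s1; case: s2 => N s2.
exists (Num.max M N) => x' z; rewrite gt_max => /andP[h1 h2].
by rewrite /rdot s1// s2// mul0r addr0.
Qed.

Lemma green_integrable (a b : R) (f1 f2 w : space -> R) : C1per f1 -> C1per f2 -> C1per w ->
  mu3.-integrable (Omega : set mspace) (EFin \o (fun y => weight a b y.1 *
      (('D_(e_x : space) f1 y + (t1 * 'D_(e_z1 : space) f2 y + t2 * 'D_(e_z2 : space) f2 y)) * w y +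
       f1 y * 'D_(e_x : space) w y +
       f2 y * (t1 * 'D_(e_z1 : space) w y + t2 * 'D_(e_z2 : space) w y)) +
     weight' a b y.1 * (f1 y * w y))).
Proof.
move=> [c1 _ s1] [c2 _ [M2 s2]] [cw _ sw].
apply: bounded_x_support_integrable.
  have k1 := Cn_continuous c1; have k2 := Cn_continuous c2; have kw := Cn_continuous cw.
  have d1 v := Cn_continuous (@Cn_derive _ _ _ v c1).
  have d2 v := Cn_continuous (@Cn_derive _ _ _ v c2).
  have dw v := Cn_continuous (@Cn_derive _ _ _ v cw).
  have W := Cn_continuous (@Cn1_weight R a b); have W' := @continuous_weight' R a b.
  move=> y; apply: cvgD; apply: cvgM; [exact: W| |exact: W'|apply: cvgM].
  - apply: cvgD; [apply: cvgD|]; apply: cvgM.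
    + apply: cvgD; first exact: d1.
      by apply: cvgD; apply: cvgM; [exact: cvg_cst|exact: d2|exact: cvg_cst|exact: d2].
    + exact: kw.
    + exact: k1.
    + exact: dw.
    + exact: k2.
    + by apply: cvgD; apply: cvgM; [exact: cvg_cst|exact: dw|exact: cvg_cst|exact: dw].
  - exact: k1.
  - exact: kw.
have [N dN] := bounded_x_support_derive (e_x : space) cw sw.
case: s1 => M1 s1; case: sw => M sw.
exists (Num.max (Num.max M1 M2) M) => x z; rewrite !gt_max => /andP[/andP[h1 h2] h3].
by rewrite sw// s1// s2// !mul0r !mulr0 !addr0 mulr0.
Qed.

Lemma green_pointwise (k k' : R) (a b1 b2 f1 f2 w c0 c1 c2 : C) :
  k * (rdot (a + (t1%:C * b1 + t2%:C * b2)) w + (rdot f1 c0 + rdot f2 (t1%:C * c1 + t2%:C * c2))) +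
    k' * rdot f1 w =
  (k * ((complex.Re a + (t1 * complex.Re b1 + t2 * complex.Re b2)) * complex.Re w +
       complex.Re f1 * complex.Re c0 +
       complex.Re f2 * (t1 * complex.Re c1 + t2 * complex.Re c2)) +
     k' * (complex.Re f1 * complex.Re w)) +
  (k * ((complex.Im a + (t1 * complex.Im b1 + t2 * complex.Im b2)) * complex.Im w +
       complex.Im f1 * complex.Im c0 +
       complex.Im f2 * (t1 * complex.Im c1 + t2 * complex.Im c2)) +
     k' * (complex.Im f1 * complex.Im w)).
Proof.
by case: a; case: b1; case: b2; case: f1; case: f2; case: w; case: c0; case: c1; case: c2 =>
  *; rewrite /rdot /=; ring.
Qed.

Lemma green_test (a b : R) (F1 F2 w : space -> C) :
  test_function F1 -> test_function F2 -> test_function w ->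
  \int[mu3]_(y in Omega) (weight a b y.1 *
      (rdot (partial e_x F1 y + dTheta t1 t2 F2 y) (w y) +
       (rdot (F1 y) (partial e_x w y) + rdot (F2 y) (dTheta t1 t2 w y))) +
     weight' a b y.1 * rdot (F1 y) (w y)) =
  - ((1 - b) * \int[mu2]_(z in Sigma) rdot (F1 (0, z)) (w (0, z))).
Proof.
move=> T1 T2 Tw.
have A := green_real t1 t2 a b (test_C1per_Re T1) (test_C1per_Re T2) (test_C1per_Re Tw).
have B := green_real t1 t2 a b (test_C1per_Im T1) (test_C1per_Im T2) (test_C1per_Im Tw).
have IA := green_integrable a b (test_C1per_Re T1) (test_C1per_Re T2) (test_C1per_Re Tw).
have IB := green_integrable a b (test_C1per_Im T1) (test_C1per_Im T2) (test_C1per_Im Tw).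
have S1 : \int[mu2]_(z in Sigma) rdot (F1 (0, z)) (w (0, z)) =
    \int[mu2]_(z in Sigma) (complex.Re (F1 (0, z)) * complex.Re (w (0, z))) +
    \int[mu2]_(z in Sigma) (complex.Im (F1 (0, z)) * complex.Im (w (0, z))).
  rewrite /rdot RintegralD//; first exact: measurable_Sigma.
  - have [c _ s] := C1per_mul (test_C1per_Re T1) (test_C1per_Re Tw).
    exact: (@continuous_integrable_Sigma _ _ 0 (Cn_continuous c) s).
  - have [c _ s] := C1per_mul (test_C1per_Im T1) (test_C1per_Im Tw).
    exact: (@continuous_integrable_Sigma _ _ 0 (Cn_continuous c) s).
rewrite S1 mulrDr opprD -A -B -RintegralD//; last exact: measurable_Omega.
apply: eq_Rintegral => y _.
exact: (green_pointwise (weight a b y.1) (weight' a b y.1) (partial e_x F1 y) (partial e_z1 F2 y)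
  (partial e_z2 F2 y) (F1 y) (F2 y) (w y) (partial e_x w y) (partial e_z1 w y) (partial e_z2 w y)).
Qed.

End Test.

(** * The space H1 and Green's formula in the limit *)

Section H1.
Context {R : realType}.
Notation C := R[i].
Notation plane := (R * R)%type.
Notation space := (R * (R * R))%type.
Notation mplane := (measurableTypeR R * measurableTypeR R)%type.
Notation mspace := (measurableTypeR R * (measurableTypeR R * measurableTypeR R))%type.
Notation mO := measurable_Omega.
Notation mS := measurable_Sigma.
Variables t1 t2 : R.
Notation nO := (sqnorm mu3 Omega).
Notation nS := (sqnorm mu2 Sigma).
Notation L2O := (in_L2 mu3 Omega).

Lemma cvg_L2_eq {d} {T : measurableType d} (mu : set T -> \bar R) D (f_ g_ : nat -> T -> C) f g :
  (forall j y, f_ j y = g_ j y) -> (forall y, f y = g y) ->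
  cvg_L2 mu D g_ g -> cvg_L2 mu D f_ f.
Proof.
move=> h1 h2; suff -> : f_ = g_ by have -> : f = g by exact/funext.
by apply/funext => j; exact/funext.
Qed.

Lemma gradE phi y i : ThetaT_grad t1 t2 phi y i 0 =
  if i == 0 then partial e_x phi y else dTheta t1 t2 phi y.
Proof. by rewrite mxE. Qed.

Lemma grad_lin (l : C) phi psi y i : test_function phi -> test_function psi ->
  ThetaT_grad t1 t2 (fun y => l * phi y + psi y) y i 0 =
  l * ThetaT_grad t1 t2 phi y i 0 + ThetaT_grad t1 t2 psi y i 0.
Proof.
move=> p q; rewrite (gradE (fun y => l * phi y + psi y)) (gradE phi) (gradE psi).
case: (i == 0); first exact: (@partial_lin _ e_x l _ _ y p q).
exact: (@dTheta_lin _ t1 t2 l _ _ y p q).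
Qed.

Lemma grad_shiftx c phi y i : test_function phi ->
  ThetaT_grad t1 t2 (fun y => phi (shiftx c y)) y i 0 = ThetaT_grad t1 t2 phi (shiftx c y) i 0.
Proof.
move=> p.
apply: (etrans (gradE (fun y => phi (shiftx c y)) y i)).
apply: (etrans _ (esym (gradE phi (shiftx c y) i))).
case: (i == 0).
  exact: (@partial_shiftx _ c e_x phi y p).
exact: (@dTheta_shiftx _ t1 t2 c phi y p).
Qed.

Lemma H1_approx_lin (l : C) phi_ V G psi_ V' G' :
  H1_approx t1 t2 phi_ V G -> H1_approx t1 t2 psi_ V' G' ->
  H1_approx t1 t2 (fun j y => l * phi_ j y + psi_ j y) (fun y => l * V y + V' y)
    (fun y => l *: G y + G' y).
Proof.
move=> [p1 p2 p3 p4 p5] [q1 q2 q3 q4 q5].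
have GE y i : (l *: G y + G' y) i 0 = l * G y i 0 + G' y i 0 by rewrite !mxE.
split.
- by move=> j; exact: test_lin.
- exact: (L2_lin mO).
- by move=> i; under eq_fun do rewrite GE; exact: (L2_lin mO).
- exact: (cvg_L2_lin mO l (fun j => test_L2 (p1 j)) (fun j => test_L2 (q1 j)) p2 q2 p4 q4).
- move=> i; have := cvg_L2_lin mO l (fun j => grad_L2 t1 t2 i (p1 j))
    (fun j => grad_L2 t1 t2 i (q1 j)) (p3 i) (q3 i) (p5 i) (q5 i).
  apply: cvg_L2_eq; first by move=> j y; exact: (grad_lin l y i (p1 j) (q1 j)).
  move=> y; exact: GE.
Qed.

Lemma H1_approx_shiftx c phi_ V G : 0 <= c -> H1_approx t1 t2 phi_ V G ->
  H1_approx t1 t2 (fun j y => phi_ j (shiftx c y)) (fun y => V (shiftx c y)) (fun y => G (shiftx c y)).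
Proof.
move=> c0 [p1 p2 p3 p4 p5]; split.
- by move=> j; exact: test_shiftx.
- exact: in_L2_shiftx.
- by move=> i; exact: (in_L2_shiftx c0 (p3 i)).
- by apply: cvg_L2_shiftx => // j; exact: test_L2.
- move=> i; have := cvg_L2_shiftx c0 (fun j => grad_L2 t1 t2 i (p1 j)) (p3 i) (p5 i).
  apply: cvg_L2_eq; first by move=> j y; exact: (grad_shiftx c y i (p1 j)).
  by move=> y; exact: erefl.
Qed.

Lemma H1_approx_ae phi_ V V' G : H1_approx t1 t2 phi_ V G -> L2O V' ->
  {ae mu3, forall y, Omega y -> V y = V' y} -> H1_approx t1 t2 phi_ V' G.
Proof.
move=> [p1 p2 p3 p4 p5] V'2 VV'; split => //.
move: p4; rewrite !(cvg_L2E mO)//; try by move=> j; exact: test_L2.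
rewrite (_ : (fun j => nO (fun y => phi_ j y - V y)) = (fun j => nO (fun y => phi_ j y - V' y)))//.
apply/funext => j; apply: (ae_eq_sqnorm mO).
- by apply: (L2_B mO) => //; exact: test_L2.
- by apply: (L2_B mO) => //; exact: test_L2.
- by apply: ae_on_impl VV' => y _ ->.
Qed.

Lemma sqnorm_shiftx_le (c : R) (V : space -> C) : 0 <= c -> L2O V -> nO (fun y => V (shiftx c y)) <= nO V.
Proof.
move=> c0 V2; have E1 := sqL2E mO (in_L2_shiftx c0 V2); have E2 := sqL2E mO V2.
rewrite -lee_fin -E1 -E2.
have [m1 m2 h] := V2.
rewrite !sqL2_rdotE (ge0_integral_shiftx (f := fun y => rdot (V y) (V y)))//; last 2 first.
- exact: measurable_rdot.
- by move=> y _; exact: rdot_ge0.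
apply: ge0_subset_integral => //.
- exact: measurable_Omega_from.
- exact: measurable_Omega.
- by apply/measurable_EFinP; exact: measurable_rdot.
- by move=> y _; rewrite lee_fin rdot_ge0.
- exact: Omega_from_sub.
Qed.

Lemma weight_bound (a b : R) (y : space) : 0 <= a -> 0 <= b <= 1 -> Omega y -> `|weight a b y.1| <= 1.
Proof.
move=> a0 /andP[b0 b1]; rewrite OmegaE => -[y0 _].
have e0 := expR_gt0 (- (a * y.1)).
have e1 : expR (- (a * y.1)) <= 1.
  by rewrite -expR0 ler_expR oppr_le0 mulr_ge0// ltW.
rewrite /weight ger0_norm; first by rewrite gerBl mulr_ge0// ltW.
by rewrite subr_ge0 mulr_ile1// ltW.
Qed.

Lemma weight'_bound (a b : R) (y : space) : 0 <= a -> 0 <= b <= 1 -> Omega y -> `|weight' a b y.1| <= a.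
Proof.
move=> a0 /andP[b0 b1]; rewrite OmegaE => -[y0 _].
have e0 := expR_gt0 (- (a * y.1)).
have e1 : expR (- (a * y.1)) <= 1.
  by rewrite -expR0 ler_expR oppr_le0 mulr_ge0// ltW.
rewrite /weight' ger0_norm; last by rewrite !mulr_ge0// ltW.
rewrite -[leRHS]mul1r; apply: ler_pM => //; first by rewrite mulr_ge0// ltW.
by rewrite -[leRHS]mulr1; apply: ler_pM => //; exact: ltW.
Qed.

Lemma measurable_weight (a b : R) : @measurable_fun _ _ mspace _ Omega (fun y : space => weight a b y.1).
Proof.
apply: measurable_funTS; apply: continuous_space_measurable.
exact: (Cn_continuous (Cn1_weight a b)).
Qed.

Lemma measurable_weight' (a b : R) : @measurable_fun _ _ mspace _ Omega (fun y : space => weight' a b y.1).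
Proof.
by apply: measurable_funTS; apply: continuous_space_measurable; exact: continuous_weight'.
Qed.

Section Pairing.
Variables a b : R.
Hypotheses (a0 : 0 <= a) (b01 : 0 <= b <= 1).

Let I (f g : space -> C) : R := \int[mu3]_(y in Omega) (weight a b y.1 * rdot (f y) (g y)).
Let I' (f g : space -> C) : R := \int[mu3]_(y in Omega) (weight' a b y.1 * rdot (f y) (g y)).

(** The left-hand side of Green's formula, for a flux (F1, F2) with divergence D and a
function W with gradient (G1, G2). The last term comes from differentiating the weight. *)
Definition green_form (D F1 F2 W G1 G2 : space -> C) : R :=
  \int[mu3]_(y in Omega) (weight a b y.1 *
      (rdot (D y) (W y) + (rdot (F1 y) (G1 y) + rdot (F2 y) (G2 y))) +
     weight' a b y.1 * rdot (F1 y) (W y)).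

Lemma integrable_weight f g : L2O f -> L2O g ->
  mu3.-integrable (Omega : set mspace) (EFin \o (fun y => weight a b y.1 * rdot (f y) (g y))).
Proof.
move=> F G; apply: (integrable_weighted_rdot mO F G (measurable_weight a b) (M := 1)).
by move=> y Oy; exact: weight_bound.
Qed.

Lemma integrable_weight' f g : L2O f -> L2O g ->
  mu3.-integrable (Omega : set mspace) (EFin \o (fun y => weight' a b y.1 * rdot (f y) (g y))).
Proof.
move=> F G; apply: (integrable_weighted_rdot mO F G (measurable_weight' a b) (M := a)).
by move=> y Oy; exact: weight'_bound.
Qed.

Lemma green_formE D F1 F2 W G1 G2 : L2O D -> L2O F1 -> L2O F2 -> L2O W -> L2O G1 -> L2O G2 ->
  green_form D F1 F2 W G1 G2 = (I D W + (I F1 G1 + I F2 G2)) + I' F1 W.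
Proof.
move=> dD dF1 dF2 dW dG1 dG2; rewrite /green_form /I /I'.
transitivity (\int[mu3]_(y in Omega) ((weight a b y.1 * rdot (D y) (W y) +
   (weight a b y.1 * rdot (F1 y) (G1 y) + weight a b y.1 * rdot (F2 y) (G2 y))) +
   weight' a b y.1 * rdot (F1 y) (W y))).
  by apply: eq_Rintegral => y _; rewrite !mulrDr.
have h1 := integrable_weight dD dW; have h2 := integrable_weight dF1 dG1.
have h3 := integrable_weight dF2 dG2; have h4 := integrable_weight' dF1 dW.
have h5 := integrable_addr mO h2 h3; have h6 := integrable_addr mO h1 h5.
apply: (etrans (RintegralD mO h6 h4)); congr (_ + _).
apply: (etrans (RintegralD mO h1 h5)); congr (_ + _).
exact: (RintegralD mO h2 h3).
Qed.

Lemma cvg_weighted_pairing f g (g_ : nat -> space -> C) : L2O f -> L2O g -> (forall j, L2O (g_ j)) ->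
  cvg_L2 mu3 Omega g_ g -> I f (g_ j) @[j --> \oo] --> I f g.
Proof.
move=> F G G_; apply: (cvg_L2_pairing mO F G G_ (measurable_weight a b) (M := 1)).
by move=> y Oy; exact: weight_bound.
Qed.

Lemma cvg_weighted_pairing' f g (g_ : nat -> space -> C) : L2O f -> L2O g -> (forall j, L2O (g_ j)) ->
  cvg_L2 mu3 Omega g_ g -> I' f (g_ j) @[j --> \oo] --> I' f g.
Proof.
move=> F G G_; apply: (cvg_L2_pairing mO F G G_ (measurable_weight' a b) (M := a)).
by move=> y Oy; exact: weight'_bound.
Qed.

Lemma weighted_pairingC f g : I f g = I g f.
Proof. by apply: eq_Rintegral => y _; rewrite rdotC. Qed.

Lemma weighted_pairing'C f g : I' f g = I' g f.
Proof. by apply: eq_Rintegral => y _; rewrite rdotC. Qed.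

(** The limit in w is taken first, with a smooth flux: the boundary term then only
involves traces converging in L^2, whereas the normal trace of a limit flux need not be a
function. The boundary term vanishes because the weight does (b = 1) or because W has zero
trace. *)
Lemma green_limit F D w W GW : Hdiv_div t1 t2 F D -> H1_approx t1 t2 w W GW ->
  b = 1 \/ cvg_L2 mu2 Sigma (fun j z => w j (0, z)) (fun=> 0) ->
  green_form D (fun y => F y 0 0) (fun y => F y 1 0) W (fun y => GW y 0 0) (fun y => GW y 1 0) = 0.
Proof.
move=> [F2 D2 [F_ [tF cF cD]]] [tw W2 GW2 cW cGW] bw.
have step j : green_form (div_Theta t1 t2 (F_ j)) (fun y => F_ j y 0 0) (fun y => F_ j y 1 0)
    W (fun y => GW y 0 0) (fun y => GW y 1 0) = 0.
  have dj := div_L2 t1 t2 (tF j).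
  have fj i := test_L2 (tF j i).
  have E l : green_form (div_Theta t1 t2 (F_ j)) (fun y => F_ j y 0 0) (fun y => F_ j y 1 0)
      (w l) (fun y => ThetaT_grad t1 t2 (w l) y 0 0) (fun y => ThetaT_grad t1 t2 (w l) y 1 0) =
      - ((1 - b) * \int[mu2]_(z in Sigma) (1 * rdot (F_ j (0, z) 0 0) (w l (0, z)))).
    transitivity (- ((1 - b) * \int[mu2]_(z in Sigma) rdot (F_ j (0, z) 0 0) (w l (0, z)))).
      rewrite -(green_test t1 t2 a b (tF j 0) (tF j 1) (tw l)).
      by apply: eq_Rintegral => y _; rewrite vec20 vec21.
    by congr (- (_ * _)); apply: eq_Rintegral => z _; rewrite mul1r.
  have L : green_form (div_Theta t1 t2 (F_ j)) (fun y => F_ j y 0 0) (fun y => F_ j y 1 0)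
      (w l) (fun y => ThetaT_grad t1 t2 (w l) y 0 0) (fun y => ThetaT_grad t1 t2 (w l) y 1 0)
      @[l --> \oo] --> green_form (div_Theta t1 t2 (F_ j)) (fun y => F_ j y 0 0) (fun y => F_ j y 1 0)
    W (fun y => GW y 0 0) (fun y => GW y 1 0).
    rewrite green_formE//.
    under eq_fun => l do rewrite (green_formE dj (fj 0) (fj 1) (test_L2 (tw l)) (grad_L2 t1 t2 0 (tw l)) (grad_L2 t1 t2 1 (tw l))).
    apply: cvgD; [apply: cvgD; [|apply: cvgD]|].
    - by apply: cvg_weighted_pairing => // l; exact: test_L2.
    - by apply: cvg_weighted_pairing => // l; exact: grad_L2.
    - by apply: cvg_weighted_pairing => // l; exact: grad_L2.
    - by apply: cvg_weighted_pairing' => // l; exact: test_L2.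
  rewrite -(cvg_lim _ L)//; apply: cvg_lim => //.
  under eq_fun => l do rewrite E.
  case: bw => [->|cw].
    by under eq_fun do rewrite subrr mul0r oppr0; exact: cvg_cst.
  have n1 (z : mplane) : Sigma z -> `|cst (1 : R) z| <= 1 by rewrite /cst normr1.
  have := @cvg_L2_pairing _ _ _ mu2 Sigma mS (cst 1) 1 (fun z => F_ j (0, z) 0 0) (fun=> 0)
    (fun l z => w l (0, z)) (trace_L2 0 (tF j 0)) (L2_0 mu2 Sigma) (fun l => trace_L2 0 (tw l))
    (measurable_cst _) n1 cw.
  have Z : \int[mu2]_(y in Sigma) (cst 1 y * rdot (F_ j (0, y) 0 0) 0) = 0.
    under eq_Rintegral do rewrite rdot0r mulr0.
    by rewrite Rintegral_cst ?mul0r//; exact: mS.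
  rewrite Z => hc; have := cvgN (cvgM (cvg_cst (1 - b)) hc).
  by rewrite mulr0 oppr0; apply.
have L : green_form (div_Theta t1 t2 (F_ j)) (fun y => F_ j y 0 0) (fun y => F_ j y 1 0)
    W (fun y => GW y 0 0) (fun y => GW y 1 0) @[j --> \oo] -->
    green_form D (fun y => F y 0 0) (fun y => F y 1 0) W (fun y => GW y 0 0) (fun y => GW y 1 0).
  rewrite green_formE//.
  under eq_fun => j do rewrite (green_formE (div_L2 t1 t2 (tF j)) (test_L2 (tF j 0)) (test_L2 (tF j 1)) W2 (GW2 0) (GW2 1)).
  apply: cvgD; [apply: cvgD; [|apply: cvgD]|].
  - rewrite weighted_pairingC; under eq_fun do rewrite weighted_pairingC.
    by apply: cvg_weighted_pairing => // l; exact: div_L2.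
  - rewrite weighted_pairingC; under eq_fun do rewrite weighted_pairingC.
    by apply: cvg_weighted_pairing => // l; exact: test_L2.
  - rewrite weighted_pairingC; under eq_fun do rewrite weighted_pairingC.
    by apply: cvg_weighted_pairing => // l; exact: test_L2.
  - rewrite weighted_pairing'C; under eq_fun do rewrite weighted_pairing'C.
    by apply: cvg_weighted_pairing' => // l; exact: test_L2.
rewrite -(cvg_lim _ L)//; apply: cvg_lim => //.
by under eq_fun do rewrite step; exact: cvg_cst.
Qed.

End Pairing.

End H1.

(** * Traces of test functions *)

Lemma cvg0_squeeze2 {R : realType} (w u v : nat -> R) : (forall j, 0 <= w j) ->
  (forall j, w j <= 2 * u j + 2 * v j) -> u j @[j --> \oo] --> 0 ->
  v j @[j --> \oo] --> 0 -> w j @[j --> \oo] --> 0.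
Proof.
move=> w0 wuv u0 v0.
have h : (2 * u j + 2 * v j) @[j --> \oo] --> (2 * 0 + 2 * 0 : R).
  by apply: cvgD; apply: cvgM => //; exact: cvg_cst.
rewrite mulr0 addr0 in h; apply: (squeeze_cvgr _ (cvg_cst 0) h).
by near=> j; rewrite w0 wuv.
Unshelve. all: by end_near. Qed.

#[local] Opaque derive partial dTheta.

Section Trace.
Context {R : realType}.
Notation C := R[i].
Notation plane := (R * R)%type.
Notation space := (R * (R * R))%type.
Notation mplane := (measurableTypeR R * measurableTypeR R)%type.
Notation mspace := (measurableTypeR R * (measurableTypeR R * measurableTypeR R))%type.
Notation mO := measurable_Omega.
Notation mS := measurable_Sigma.
Variables t1 t2 : R.
Notation nO := (sqnorm mu3 Omega).
Notation nS := (sqnorm mu2 Sigma).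
Notation L2O := (in_L2 mu3 Omega).

Lemma trace_pointwise (r : R) (p q1 q2 s1 s2 v : C) :
  weight 0 0 r * (rdot (p + (0%:C * q1 + 0%:C * q2)) v + (rdot v p + rdot 0 (0%:C * s1 + 0%:C * s2))) +
    weight' 0 0 r * rdot v v = 2 * rdot v p.
Proof.
rewrite /weight /weight' !mul0r subr0; case: p => ? ?; case: q1 => ? ?; case: q2 => ? ?.
by case: s1 => ? ?; case: s2 => ? ?; case: v => ? ?; rewrite /rdot /=; ring.
Qed.

(** Green's formula for the flux (w, 0) and the function w expresses the left-hand side as
minus the integral of 2 Re (w conj (d_x w)). A large e makes the contribution of the derivative
small. *)
Lemma trace_ineq0 (w : space -> C) (e : R) : test_function w -> 0 < e ->
  nS (fun z => w (0, z)) <= 2 * (e * nO w + e^-1 * nO (partial e_x w)).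
Proof.
move=> tw e0.
have G := green_test 0 0 0 0 tw test_0 tw.
have E : nS (fun z => w (0, z)) = - \int[mu3]_(y in Omega) (cst 2 y * rdot (w y) (partial e_x w y)).
  rewrite -[LHS]opprK; congr (- _).
  transitivity (- ((1 - 0) * nS (fun z => w (0, z)))); first by rewrite subr0 mul1r.
  apply: (etrans (esym G)); apply: eq_Rintegral => y _.
  exact: (trace_pointwise y.1 (partial e_x w y) (partial e_z1 (fun=> 0) y) (partial e_z2 (fun=> 0) y)
    (partial e_z1 w y) (partial e_z2 w y) (w y)).
rewrite E; apply: (le_trans (ler_norm _)); rewrite normrN.
apply: (le_trans (pairing_young mO (M := 2) (test_L2 tw) (partial_L2 e_x tw) _ _ e0)) => //.
- by move=> y _; rewrite /cst normr_nat.
- by rewrite normr_nat.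
Qed.

Lemma trace_ineq (x : R) (w : space -> C) (e : R) : 0 <= x -> test_function w -> 0 < e ->
  nS (fun z => w (x, z)) <= 2 * (e * nO w + e^-1 * nO (partial e_x w)).
Proof.
move=> x0 tw e0; have T := trace_ineq0 (test_shiftx x tw) e0.
have <- : nS (fun z => w (shiftx x (0, z))) = nS (fun z => w (x, z)).
  by apply: eq_Rintegral => z _; rewrite shiftxE /= add0r.
apply: (le_trans T); apply: (ler_wpM2l (ler0n _ 2)).
have E : nO (partial e_x (fun y => w (shiftx x y))) = nO (fun y => partial e_x w (shiftx x y)).
  by apply: eq_Rintegral => y _; rewrite (@partial_shiftx _ x e_x w y tw).
rewrite E; have ei : 0 <= e^-1 by rewrite invr_ge0 ltW.
apply: lerD; [apply: (ler_wpM2l (ltW e0))|apply: (ler_wpM2l ei)].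
  exact: (sqnorm_shiftx_le x0 (test_L2 tw)).
exact: (sqnorm_shiftx_le x0 (partial_L2 e_x tw)).
Qed.

(** Bounded x-derivatives are absorbed by a large parameter in [trace_ineq], so that
convergence in L^2 is enough. *)
Lemma trace_cvg0 (x : R) (w : nat -> space -> C) (B : R) : 0 <= x ->
  (forall j, test_function (w j)) -> nO (w j) @[j --> \oo] --> 0 ->
  (\forall j \near \oo, nO (partial e_x (w j)) <= B) ->
  nS (fun z => w j (x, z)) @[j --> \oo] --> 0.
Proof.
move=> x0 tw cw bw; apply/cvgrPdist_le => /= e e0.
have B0 : 0 < `|B| + 1 by rewrite ltr_wpDl.
(* The two terms of [trace_ineq] are each at most e / 4 before the factor 2. *)
pose k := 4 * (`|B| + 1) / e.
have k0 : 0 < k by rewrite /k divr_gt0// mulr_gt0.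
pose d := e / (4 * k).
have d0 : 0 < d by rewrite /d divr_gt0// mulr_gt0.
have : \forall j \near \oo, nO (w j) <= d.
  move/cvgrPdist_le : cw => /(_ _ d0); apply: filterS => j.
  by rewrite sub0r normrN ger0_norm ?sqnorm_ge0.
apply: filterS2 bw => j h1 h2.
rewrite sub0r normrN ger0_norm ?sqnorm_ge0//.
apply: (le_trans (trace_ineq x0 (tw j) k0)).
have h3 : k * nO (w j) <= e / 4.
  have <- : k * d = e / 4 by rewrite /d; field; rewrite gt_eqF.
  exact: ler_wpM2l (ltW k0) _ _ h2.
have h4 : k^-1 * nO (partial e_x (w j)) <= e / 4.
  have h5 : nO (partial e_x (w j)) <= `|B| + 1.
    by apply: (le_trans h1); rewrite (le_trans (ler_norm _))// lerDl.
  have <- : k^-1 * (`|B| + 1) = e / 4 by rewrite /k; field; rewrite !gt_eqF.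
  by apply: ler_wpM2l => //; rewrite invr_ge0 ltW.
lra.
Qed.

Lemma test_B phi psi : test_function phi -> test_function psi ->
  test_function (fun y => phi y - psi y : C).
Proof.
move=> p q; rewrite (_ : (fun y => _) = (fun y => -1 * psi y + phi y)); first exact: test_lin.
by apply/funext => y; rewrite mulN1r addrC.
Qed.

Lemma partial_B v phi psi y : test_function phi -> test_function psi ->
  partial v (fun y => phi y - psi y : C) y = partial v phi y - partial v psi y.
Proof.
move=> p q.
have -> : (fun y => phi y - psi y) = (fun y => -1 * psi y + phi y).
  by apply/funext => z; rewrite mulN1r addrC.
by rewrite (@partial_lin _ v (-1) psi phi y q p) mulN1r addrC.
Qed.

Lemma cvg_L2_bound (f_ : nat -> space -> C) f : (forall j, L2O (f_ j)) -> L2O f ->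
  cvg_L2 mu3 Omega f_ f -> \forall j \near \oo, nO (f_ j) <= 2 + 2 * nO f.
Proof.
move=> F_ F; rewrite (cvg_L2E mO)// => /cvgrPdist_le/(_ _ ltr01); apply: filterS => j.
rewrite sub0r normrN ger0_norm ?sqnorm_ge0// => h.
have E : nO (fun y => (f_ j y - f y) + f y) = nO (f_ j).
  by apply: eq_Rintegral => y _; rewrite subrK.
have h2 := sqnormD_le mO (L2_B mO (F_ j) F) F; rewrite E in h2; apply: (le_trans h2).
by rewrite lerD2r -[leRHS]mulr1 ler_pM2l.
Qed.

Lemma H1_approx_cvg phi_ V G : H1_approx t1 t2 phi_ V G ->
  nO (fun y => phi_ j y - V y) @[j --> \oo] --> 0.
Proof.
by move=> [p1 p2 _ p4 _]; apply/(cvg_L2E mO) => // j; exact: test_L2.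
Qed.

Lemma H1_approx_dx phi_ V G : H1_approx t1 t2 phi_ V G ->
  cvg_L2 mu3 Omega (fun j => partial e_x (phi_ j)) (fun y => G y 0 0).
Proof.
move=> [_ _ _ _ /(_ 0)]; apply: cvg_L2_eq => // j y; exact: (esym (gradE t1 t2 (phi_ j) y 0)).
Qed.

(** The difference of the two sequences tends to zero in L^2, and its x-derivatives are
bounded because those of each sequence converge, possibly to different limits. *)
Lemma trace_cvg_transfer (x : R) phi_ V G psi_ V' G' Phi : 0 <= x ->
  H1_approx t1 t2 phi_ V G -> H1_approx t1 t2 psi_ V' G' ->
  {ae mu3, forall y, Omega y -> V y = V' y} ->
  in_L2 mu2 Sigma Phi -> cvg_L2 mu2 Sigma (fun j z => psi_ j (x, z)) Phi ->
  cvg_L2 mu2 Sigma (fun j z => phi_ j (x, z)) Phi.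
Proof.
move=> x0 Hp Hq VV' Phi2 cq.
have [tp V2 G2 _ _] := Hp; have [tq V'2 G'2 _ _] := Hq.
have tpS j := trace_L2 x (tp j); have tqS j := trace_L2 x (tq j).
move: cq; rewrite !(cvg_L2E mS)// => cq.
have Hq' : H1_approx t1 t2 psi_ V G'.
  by apply: (H1_approx_ae Hq V2); apply: ae_on_impl VV' => y _ ->.
have cw : nO (fun y => phi_ j y - psi_ j y) @[j --> \oo] --> 0.
  apply: (cvg0_squeeze2 _ _ (H1_approx_cvg Hp) (H1_approx_cvg Hq')) => j; first exact: sqnorm_ge0.
  rewrite [X in X <= _](_ : _ = nO (fun y => (phi_ j y - V y) - (psi_ j y - V y))).
    by apply: (sqnormB_le mO); apply: (L2_B mO) => //; exact: test_L2.
  by apply: eq_Rintegral => y _; congr (rdot _ _); ring.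
have bw : \forall j \near \oo, nO (partial e_x (fun y => phi_ j y - psi_ j y)) <=
    2 * (2 + 2 * nO (fun y => G y 0 0)) + 2 * (2 + 2 * nO (fun y => G' y 0 0)).
  have b1 := cvg_L2_bound (fun j => partial_L2 e_x (tp j)) (G2 0) (H1_approx_dx Hp).
  have b2 := cvg_L2_bound (fun j => partial_L2 e_x (tq j)) (G'2 0) (H1_approx_dx Hq).
  apply: filterS2 b1 b2 => j b1 b2.
  rewrite [X in X <= _](_ : _ = nO (fun y => partial e_x (phi_ j) y - partial e_x (psi_ j) y)).
    apply: (le_trans (sqnormB_le mO (partial_L2 e_x (tp j)) (partial_L2 e_x (tq j)))).
    by apply: lerD; apply: ler_wpM2l.
  by apply: eq_Rintegral => y _; rewrite (partial_B e_x y (tp j) (tq j)).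
have c0 := trace_cvg0 x0 (fun j => test_B (tp j) (tq j)) cw bw.
apply: (cvg0_squeeze2 _ _ c0 cq) => j; first exact: sqnorm_ge0.
rewrite [X in X <= _](_ : _ = nS (fun z => (phi_ j (x, z) - psi_ j (x, z)) + (psi_ j (x, z) - Phi z))).
  by apply: (sqnormD_le mS); apply: (L2_B mS).
by apply: eq_Rintegral => z _; congr (rdot _ _); ring.
Qed.

End Trace.

(** * Traces of H1 functions *)

Section HasTrace.
Context {R : realType}.
Notation C := R[i].
Notation plane := (R * R)%type.
Notation space := (R * (R * R))%type.
Notation mplane := (measurableTypeR R * measurableTypeR R)%type.
Notation mspace := (measurableTypeR R * (measurableTypeR R * measurableTypeR R))%type.
Notation mO := measurable_Omega.
Notation mS := measurable_Sigma.
Variables t1 t2 : R.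
Notation nO := (sqnorm mu3 Omega).
Notation nS := (sqnorm mu2 Sigma).
Notation L2O := (in_L2 mu3 Omega).
Notation L2S := (in_L2 mu2 Sigma).

(** The square of the H1 norm of V with gradient G. *)
Definition energy (V : space -> C) (G : space -> 'cV[C]_2) : R :=
  nO V + (nO (fun y => G y 0 0) + nO (fun y => G y 1 0)).

Lemma energy_ge0 V G : 0 <= energy V G.
Proof. by rewrite /energy !addr_ge0 ?sqnorm_ge0. Qed.

Lemma sqnorm_le_energy V G : nO V <= energy V G.
Proof. by rewrite /energy lerDl addr_ge0 ?sqnorm_ge0. Qed.

Lemma H1_grad_L2 V G : H1_grad t1 t2 V G -> L2O V /\ forall i, L2O (fun y => G y i 0).
Proof. by move=> [phi [_ h1 h2 _ _]]; split. Qed.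

Lemma H1_normE V G : H1_grad t1 t2 V G -> H1_norm V G = Num.sqrt (energy V G).
Proof.
move=> /H1_grad_L2[V2 G2]; rewrite /H1_norm; congr Num.sqrt.
have E0 := sqL2E mO (G2 0); have E1 := sqL2E mO (G2 1); have EV := sqL2E mO V2.
rewrite !big_ord_recl big_ord0 EV.
rewrite (_ : lift ord0 ord0 = 1); last exact/val_inj.
by rewrite [X in (_ + (X + _))%E]E0 [X in (_ + (_ + (X + _)))%E]E1 adde0 -!EFinD.
Qed.

Lemma H1_grad_lin (l : C) V G V' G' : H1_grad t1 t2 V G -> H1_grad t1 t2 V' G' ->
  H1_grad t1 t2 (fun y => l * V y + V' y) (fun y => l *: G y + G' y).
Proof. by move=> [p hp] [q hq]; eexists; exact: (H1_approx_lin l hp hq). Qed.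

Lemma H1_grad_shiftx (x : R) V G : 0 <= x -> H1_grad t1 t2 V G ->
  H1_grad t1 t2 (fun y => V (shiftx x y)) (fun y => G (shiftx x y)).
Proof. by move=> x0 [p hp]; eexists; exact: (H1_approx_shiftx x0 hp). Qed.

Lemma H1_approx_0 : H1_approx t1 t2 (fun _ _ => 0) (fun=> 0) (fun=> 0).
Proof.
have Z : nO (fun=> 0 - 0 : C) = 0 by rewrite subrr; exact: (sqnorm0 mu3 mO).
split.
- by move=> j; exact: test_0.
- exact: L2_0.
- by move=> i; under eq_fun do rewrite mxE; exact: L2_0.
- apply/(cvg_L2E mO); [by move=> j; exact: L2_0|exact: L2_0|].
  by under eq_fun do rewrite Z; exact: cvg_cst.
- move=> i; have : cvg_L2 mu3 Omega (fun (j : nat) => (fun=> 0 : C)) (fun=> 0).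
    apply/(cvg_L2E mO); [by move=> j; exact: L2_0|exact: L2_0|].
    by under eq_fun do rewrite Z; exact: cvg_cst.
  apply: cvg_L2_eq; last by move=> y; rewrite mxE.
  move=> j y.
  have E := @grad_lin R t1 t2 (-1) (fun=> 0) (fun=> 0) y i test_0 test_0.
  rewrite (_ : (fun y : space => -1 * 0 + 0 : C) = (fun=> 0)) in E; last first.
    by apply/funext => z; rewrite mulr0 addr0.
  by rewrite mulN1r addNr in E.
Qed.

Lemma H1_grad_0 : H1_grad t1 t2 (fun=> 0) (fun=> 0).
Proof. by exists (fun _ _ => 0); exact: H1_approx_0. Qed.

Lemma has_trace_L2 n V Phi : has_trace t1 t2 n V Phi -> L2S Phi.
Proof. by case. Qed.

Lemma has_trace_grad n V Phi : has_trace t1 t2 n V Phi -> exists G, H1_grad t1 t2 V G.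
Proof. by move=> [_ [G [phi [h _]]]]; exists G, phi. Qed.

Lemma has_trace_lin (l : C) n V Phi V' Phi' : has_trace t1 t2 n V Phi ->
  has_trace t1 t2 n V' Phi' ->
  has_trace t1 t2 n (fun y => l * V y + V' y) (fun z => l * Phi z + Phi' z).
Proof.
move=> [P2 [G [phi [hp cp]]]] [Q2 [G' [psi [hq cq]]]]; split; first exact: (L2_lin mS).
exists (fun y => l *: G y + G' y), (fun j y => l * phi j y + psi j y); split.
  exact: H1_approx_lin.
have [tp _ _ _ _] := hp; have [tq _ _ _ _] := hq.
exact: (cvg_L2_lin mS l (fun j => trace_L2 _ (tp j)) (fun j => trace_L2 _ (tq j)) P2 Q2 cp cq).
Qed.

Lemma cvg_L2_ae (f_ : nat -> plane -> C) f g : (forall j, L2S (f_ j)) -> L2S f -> L2S g ->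
  eqae f g -> cvg_L2 mu2 Sigma f_ f -> cvg_L2 mu2 Sigma f_ g.
Proof.
move=> F_ F G fg; rewrite !(cvg_L2E mS)//.
rewrite (_ : (fun j => nS (fun y => f_ j y - f y)) = (fun j => nS (fun y => f_ j y - g y)))//.
apply/funext => j; apply: (ae_eq_sqnorm mS).
- exact: (L2_B mS).
- exact: (L2_B mS).
- by apply: ae_on_impl fg => y _ ->.
Qed.

Lemma has_trace_ae n V V' Phi Phi' : has_trace t1 t2 n V Phi -> L2O V' -> L2S Phi' ->
  {ae mu3, forall y, Omega y -> V y = V' y} -> eqae Phi Phi' ->
  has_trace t1 t2 n V' Phi'.
Proof.
move=> [P2 [G [phi [hp cp]]]] V'2 P'2 VV' PP'; split=> //.
exists G, phi; split; first exact: H1_approx_ae VV'.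
have [tp _ _ _ _] := hp.
exact: (cvg_L2_ae (fun j => trace_L2 _ (tp j)) P2 P'2 PP' cp).
Qed.

Lemma has_trace_cvg n V G Phi phi : has_trace t1 t2 n V Phi -> H1_approx t1 t2 phi V G ->
  cvg_L2 mu2 Sigma (fun j z => phi j (n%:R, z)) Phi.
Proof.
move=> [P2 [G' [psi [hq cq]]]] hp.
by apply: (trace_cvg_transfer (ler0n _ n) hp hq _ P2 cq); apply: ae_on_all.
Qed.

Lemma has_trace_shiftx n V Phi : has_trace t1 t2 n V Phi ->
  has_trace t1 t2 0 (fun y => V (shiftx n%:R y)) Phi.
Proof.
move=> [P2 [G [phi [hp cp]]]]; split=> //.
exists (fun y => G (shiftx n%:R y)), (fun j y => phi j (shiftx n%:R y)); split.
  exact: H1_approx_shiftx (ler0n _ _) hp.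
by apply: cvg_L2_eq cp => // j z; rewrite shiftxE add0r.
Qed.

(** A sequence approximating V approximates the translate of V once translated, and
traces do not depend on the approximating sequence. *)
Lemma has_trace_unshiftx n V G Phi : H1_grad t1 t2 V G ->
  has_trace t1 t2 0 (fun y => V (shiftx n%:R y)) Phi -> has_trace t1 t2 n V Phi.
Proof.
move=> [phi hp] tV; split; first exact: has_trace_L2 tV.
exists G, phi; split => //.
have hs := H1_approx_shiftx (ler0n _ n) hp.
by apply: cvg_L2_eq (has_trace_cvg tV hs) => // j z; rewrite shiftxE add0r.
Qed.

Lemma has_trace_unique n V Phi Psi : has_trace t1 t2 n V Phi -> has_trace t1 t2 n V Psi ->
  eqae Phi Psi.
Proof.
move=> [P2 [G [phi [hp cp]]]] tQ.
have [tp _ _ _ _] := hp.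
exact: (cvg_L2_unique mS (fun j => trace_L2 _ (tp j)) P2 (has_trace_L2 tQ) cp (has_trace_cvg tQ hp)).
Qed.

Let energy_bound_aux (p q r s t u v w x z : R) : p <= 2 * q + 2 * r -> r <= 2 * (s + t) ->
  s <= 2 * u + 2 * v -> t <= 2 * w + 2 * x -> 0 <= z ->
  p <= 2 * q + (8 * (u + w) + 8 * (v + (x + z))).
Proof. lra. Qed.

Lemma trace_energy V G Phi : H1_grad t1 t2 V G -> has_trace t1 t2 0 V Phi ->
  nS Phi <= 8 * energy V G.
Proof.
move=> [phi hp] tV; have [tp V2 G2 _ _] := hp.
have P2 := has_trace_L2 tV.
have := has_trace_cvg tV hp; rewrite (cvg_L2E mS)//; last by move=> j; exact: trace_L2.
move=> c1; have c2 := H1_approx_cvg hp.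
have c3 : nO (fun y => partial e_x (phi j) y - G y 0 0) @[j --> \oo] --> 0.
  apply/(cvg_L2E mO (f_ := fun j => partial e_x (phi j))); last exact: H1_approx_dx hp.
    by move=> j; exact: partial_L2.
  exact: G2.
have B j : nS Phi <= 2 * nS (fun z => phi j (0, z) - Phi z) +
   (8 * (nO (fun y => phi j y - V y) + nO (fun y => partial e_x (phi j) y - G y 0 0)) + 8 * energy V G).
  have h1 : nS Phi <= 2 * nS (fun z => phi j (0, z) - Phi z) + 2 * nS (fun z => phi j (0, z)).
    rewrite [X in X <= _](_ : _ = nS (fun z => phi j (0, z) - (phi j (0, z) - Phi z))).
      rewrite addrC; apply: (sqnormB_le mS); first exact: trace_L2.
      by apply: (L2_B mS) => //; exact: trace_L2.
    by apply: eq_Rintegral => z _; rewrite subKr.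
  have h2 := trace_ineq0 (tp j) ltr01; rewrite invr1 !mul1r in h2.
  have h3 : nO (phi j) <= 2 * nO (fun y => phi j y - V y) + 2 * nO V.
    rewrite [X in X <= _](_ : _ = nO (fun y => (phi j y - V y) + V y)).
      by apply: (sqnormD_le mO) => //; apply: (L2_B mO) => //; exact: test_L2.
    by apply: eq_Rintegral => z _; rewrite subrK.
  have h4 : nO (partial e_x (phi j)) <= 2 * nO (fun y => partial e_x (phi j) y - G y 0 0) + 2 * nO (fun y => G y 0 0).
    rewrite [X in X <= _](_ : _ = nO (fun y => (partial e_x (phi j) y - G y 0 0) + G y 0 0)).
      by apply: (sqnormD_le mO) => //; apply: (L2_B mO) => //; exact: partial_L2.
    by apply: eq_Rintegral => z _; rewrite subrK.
  have h5 := sqnorm_ge0 mu3 Omega (fun y => G y 1 0).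
  rewrite /energy; exact: (energy_bound_aux h1 h2 h3 h4 h5).
have L : (2 * nS (fun z => phi j (0, z) - Phi z) +
   (8 * (nO (fun y => phi j y - V y) + nO (fun y => partial e_x (phi j) y - G y 0 0)) +
    8 * energy V G)) @[j --> \oo] --> (2 * 0 + (8 * (0 + 0) + 8 * energy V G) : R).
  apply: cvgD; first by apply: cvgM => //; exact: cvg_cst.
  apply: cvgD; last exact: cvg_cst.
  by apply: cvgM; [exact: cvg_cst|apply: cvgD].
rewrite addr0 !mulr0 !add0r in L.
rewrite -(cvg_lim _ L)//; apply: limr_ge; first by apply/cvg_ex; eexists; exact: L.
by near=> j; exact: B.
Unshelve. all: by end_near. Qed.

End HasTrace.

(** * Square-integrable fluxes and periodic coefficients *)

Section Hdiv.
Context {R : realType}.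
Notation C := R[i].
Notation plane := (R * R)%type.
Notation space := (R * (R * R))%type.
Notation mplane := (measurableTypeR R * measurableTypeR R)%type.
Notation mspace := (measurableTypeR R * (measurableTypeR R * measurableTypeR R))%type.
Notation mO := measurable_Omega.
Notation mS := measurable_Sigma.
Variables t1 t2 : R.
Notation nO := (sqnorm mu3 Omega).
Notation nS := (sqnorm mu2 Sigma).
Notation L2O := (in_L2 mu3 Omega).

Lemma div_lin (l : C) (W W' : space -> 'cV[C]_2) y :
  (forall i, test_function (fun y => W y i 0)) -> (forall i, test_function (fun y => W' y i 0)) ->
  div_Theta t1 t2 (fun y => l *: W y + W' y) y = l * div_Theta t1 t2 W y + div_Theta t1 t2 W' y.
Proof.
move=> tW tW'; rewrite /div_Theta.
have E i : (fun y => (l *: W y + W' y) i 0) = (fun y => l * W y i 0 + W' y i 0).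
  by apply/funext => z; rewrite !mxE.
rewrite !E (@partial_lin _ e_x l _ _ y (tW 0) (tW' 0)) (@dTheta_lin _ t1 t2 l _ _ y (tW 1) (tW' 1)).
have A (p q r s : C) : (l * p + q) + (l * r + s) = l * (p + r) + (q + s) by ring.
exact: A.
Qed.

Lemma div_shiftx (x : R) (W : space -> 'cV[C]_2) y : (forall i, test_function (fun y => W y i 0)) ->
  div_Theta t1 t2 (fun y => W (shiftx x y)) y = div_Theta t1 t2 W (shiftx x y).
Proof.
move=> tW; rewrite /div_Theta.
by rewrite (@partial_shiftx _ x e_x _ y (tW 0)) (@dTheta_shiftx _ t1 t2 x _ y (tW 1)).
Qed.

Lemma Hdiv_lin (l : C) W D W' D' : Hdiv_div t1 t2 W D -> Hdiv_div t1 t2 W' D' ->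
  Hdiv_div t1 t2 (fun y => l *: W y + W' y) (fun y => l * D y + D' y).
Proof.
move=> [p1 p2 [W_ [p3 p4 p5]]] [q1 q2 [W_' [q3 q4 q5]]].
have E (G G' : space -> 'cV[C]_2) i : (fun y => (l *: G y + G' y) i 0) = (fun y => l * G y i 0 + G' y i 0).
  by apply/funext => z; rewrite !mxE.
split.
- by move=> i; rewrite E; exact: (L2_lin mO).
- exact: (L2_lin mO).
exists (fun j y => l *: W_ j y + W_' j y); split.
- by move=> j i; rewrite E; exact: test_lin.
- move=> i; have := cvg_L2_lin mO l (fun j => test_L2 (p3 j i)) (fun j => test_L2 (q3 j i))
    (p1 i) (q1 i) (p4 i) (q4 i).
  by apply: cvg_L2_eq => [j y|y]; rewrite !mxE.
- have := cvg_L2_lin mO l (fun j => div_L2 t1 t2 (p3 j)) (fun j => div_L2 t1 t2 (q3 j)) p2 q2 p5 q5.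
  apply: cvg_L2_eq; first by move=> j y; exact: (div_lin l y (p3 j) (q3 j)).
  by move=> y; exact: erefl.
Qed.

Lemma Hdiv_shiftx (x : R) W D : 0 <= x -> Hdiv_div t1 t2 W D ->
  Hdiv_div t1 t2 (fun y => W (shiftx x y)) (fun y => D (shiftx x y)).
Proof.
move=> x0 [p1 p2 [W_ [p3 p4 p5]]]; split.
- by move=> i; exact: (in_L2_shiftx x0 (p1 i)).
- exact: in_L2_shiftx.
exists (fun j y => W_ j (shiftx x y)); split.
- by move=> j i; exact: (test_shiftx x (p3 j i)).
- by move=> i; exact: (cvg_L2_shiftx x0 (fun j => test_L2 (p3 j i)) (p1 i) (p4 i)).
- have := cvg_L2_shiftx x0 (fun j => div_L2 t1 t2 (p3 j)) p2 p5.
  apply: cvg_L2_eq; first by move=> j y; exact: (div_shiftx x y (p3 j)).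
  by move=> y; exact: erefl.
Qed.

Lemma Hdiv_scale (l : C) W D : Hdiv_div t1 t2 W D ->
  Hdiv_div t1 t2 (fun y => l *: W y) (fun y => l * D y).
Proof.
move=> h; have := Hdiv_lin (l - 1) h h.
have -> : (fun y => (l - 1) *: W y + W y) = (fun y => l *: W y).
  by apply/funext => y; rewrite scalerBl scale1r subrK.
have -> // : (fun y => (l - 1) * D y + D y) = (fun y => l * D y).
by apply/funext => y; rewrite mulrBl mul1r subrK.
Qed.

End Hdiv.

Section Medium.
Context {R : realType}.
Notation C := R[i].
Notation plane := (R * R)%type.
Notation space := (R * (R * R))%type.

Lemma invariant_nat {T : Type} (f : plane -> T) : invariant_by f (1, 0) ->
  forall n x z, f (x + n%:R, z) = f (x, z).
Proof.
move=> fI; elim=> [|n IH] x z; first by rewrite addr0.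
have -> : (x + n.+1%:R, z) = (x + n%:R, z) + (1, 0).
  by congr (_, _) => /=; rewrite ?addr0// -natr1 addrA.
by rewrite fI.
Qed.

(** Every point can be moved into x > 0 by an integer translation. The coefficients of the
right half-plane thus inherit on the whole plane the bounds of the global ones; this is needed
because the lifted coefficients evaluate them at points with any sign of x. *)
Lemma invariant_glob {T : Type} (f g : plane -> T) : invariant_by f (1, 0) ->
  (forall y, 0 < y.1 -> g y = f y) -> forall y, exists y', f y = g y'.
Proof.
move=> fI gf [x z].
have [n hn] : exists n : nat, `|x| < n%:R.
  by exists (Num.bound `|x|); exact: archi_boundP.
have P : 0 < x + n%:R.
  rewrite -ltrBlDl sub0r; apply: le_lt_trans hn.
  by rewrite -normrN ler_norm.
by exists (x + n%:R, z); rewrite (gf (x + n%:R, z) P) (invariant_nat fI n x z).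
Qed.

Lemma lift_plus_glob {T : Type} (c : configuration R) (f g : plane -> T) :
  invariant_by f (1, 0) -> (forall y, 0 < y.1 -> g y = f y) ->
  forall y, exists y', lift_plus c f y = g y'.
Proof. by move=> fI gf y; case: c => * /=; exact: invariant_glob. Qed.

Lemma lift_plus_shiftx1 {T : Type} (c : configuration R) (f : plane -> T) :
  invariant_by f (1, 0) -> forall y, lift_plus c f (shiftx 1 y) = lift_plus c f y.
Proof.
move=> fI y; have fI1 x z : f (x + 1, z) = f (x, z) := invariant_nat fI 1 x z.
rewrite shiftxE; case: c => [pz pm|px pz] /=; first exact: fI1.
by rewrite -[RHS]fI1; congr (f (_, _)); ring.
Qed.

Lemma compatible_inv (m : medium R) c : compatible c m ->
  invariant_by (A_plus m) (1, 0) /\ invariant_by (rho_plus m) (1, 0).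
Proof. by case: c => ? ? /= []; [move=> _ _ [? ? ? ?] _|move=> _ [? ? ? ?] _]. Qed.

Variables (m : medium R) (c : configuration R) (omega : C) (k : R).
Hypothesis hc : compatible c m.
Hypothesis homega : 0 < complex.Im omega.

Notation flux := (flux_k m c k).
Notation ik := (ik_theta1 c k).
Notation rho y := (lift_plus c (rho_plus m) y).

(** This is i conj(omega). Both Re zeta and Re (- zeta omega^2) are positive multiples of
Im omega. *)
Definition zeta : C := complex.Im omega +i* complex.Re omega.

(** The terms coming from the shift of the z1-derivative by i k theta1 cancel between the
divergence and the gradient. The symmetry of the coefficient matrix makes its quadratic form
real at complex vectors, so that it is multiplied by Re zeta = Im omega. *)
Lemma coercive_pointwise (a00 a01 a10 a11 rh kt alpha beta : R) (d u g0 g1 f0 f1 : C) :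
  a01 = a10 ->
  f0 = a00%:C * g0 + a01%:C * (g1 + (0 +i* kt) * u) ->
  f1 = a10%:C * g0 + a11%:C * (g1 + (0 +i* kt) * u) ->
  - (d + (0 +i* kt) * f1) - rh%:C * omega ^+ 2 * u = 0 ->
  (forall x y : R, alpha * (x ^+ 2 + y ^+ 2) <= a00 * x ^+ 2 + 2 * a01 * x * y + a11 * y ^+ 2) ->
  beta <= rh ->
  complex.Im omega * (alpha * (rdot g0 g0 + rdot (g1 + (0 +i* kt) * u) (g1 + (0 +i* kt) * u)) +
    beta * rdot omega omega * rdot u u) <=
  rdot (zeta * d) u + (rdot (zeta * f0) g0 + rdot (zeta * f1) g1).
Proof.
move=> <- -> -> E co br.
have {E} -> : d = - ((0 +i* kt) * (a01%:C * g0 + a11%:C * (g1 + (0 +i* kt) * u))) - rh%:C * omega ^+ 2 * u.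
  by apply/eqP; rewrite -subr_eq0; apply/eqP; rewrite -oppr0 -E; ring.
set h1 := g1 + _.
have -> : g1 = h1 - (0 +i* kt) * u by rewrite /h1 addrK.
move: h1 homega => h1 w0.
have -> : rdot (zeta * (- ((0 +i* kt) * (a01%:C * g0 + a11%:C * h1)) - rh%:C * omega ^+ 2 * u)) u +
  (rdot (zeta * (a00%:C * g0 + a01%:C * h1)) g0 + rdot (zeta * (a01%:C * g0 + a11%:C * h1)) (h1 - (0 +i* kt) * u)) =
  complex.Im omega * (
    (a00 * complex.Re g0 ^+ 2 + 2 * a01 * complex.Re g0 * complex.Re h1 + a11 * complex.Re h1 ^+ 2) +
    (a00 * complex.Im g0 ^+ 2 + 2 * a01 * complex.Im g0 * complex.Im h1 + a11 * complex.Im h1 ^+ 2) +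
    rh * rdot omega omega * rdot u u).
  rewrite /zeta /rdot; case: omega => wr wi; case: u => ? ?; case: g0 => ? ?; case: h1 => ? ? /=.
  rewrite expr2 /=; ring.
apply: ler_wpM2l; first exact: ltW.
have c1 := co (complex.Re g0) (complex.Re h1); have c2 := co (complex.Im g0) (complex.Im h1).
have p0 : 0 <= rdot omega omega * rdot u u by rewrite mulr_ge0 ?rdot_ge0.
have c3 := ler_wpM2r p0 br.
apply: lerD; last by rewrite -!mulrA.
by apply: le_trans (lerD c1 c2); rewrite /rdot; lra.
Qed.

End Medium.

(** * Pointwise coercivity *)

Section Sol.
Context {R : realType}.
Notation C := R[i].
Notation plane := (R * R)%type.
Notation space := (R * (R * R))%type.
Notation mplane := (measurableTypeR R * measurableTypeR R)%type.
Notation mspace := (measurableTypeR R * (measurableTypeR R * measurableTypeR R))%type.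
Notation mO := measurable_Omega.
Notation mS := measurable_Sigma.
Variables (m : medium R) (c : configuration R) (omega : C) (k : R).
Hypothesis hc : compatible c m.
Hypothesis homega : 0 < complex.Im omega.
Notation t1 := (theta1 c).
Notation t2 := (theta2 c).
Notation nO := (sqnorm mu3 Omega).
Notation nS := (sqnorm mu2 Sigma).
Notation L2O := (in_L2 mu3 Omega).
Notation flux := (flux_k m c k).
Notation ik := (ik_theta1 c k).
Notation rho y := (lift_plus c (rho_plus m) y).
Notation zeta := (zeta omega).

Lemma ikE : ik = 0 +i* (k * t1).
Proof.
rewrite /ik_theta1; apply/eqP; rewrite eq_complex /=; apply/andP; split; apply/eqP; ring.
Qed.

Lemma fluxE (U : space -> C) (G : space -> 'cV[C]_2) y (i : 'I_2) :
  flux U G y i 0 = (lift_plus c (A_plus m) y i 0)%:C * G y 0 0 +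
    (lift_plus c (A_plus m) y i 1)%:C * (G y 1 0 + ik * U y).
Proof.
rewrite /flux_k mxE !big_ord_recl big_ord0 addr0 !mxE /=.
rewrite (_ : lift ord0 ord0 = 1); last exact/val_inj.
by rewrite addr0.
Qed.

Lemma rdot_comb_le (M a b : R) (x y : C) : `|a| <= M -> `|b| <= M ->
  rdot (a%:C * x + b%:C * y) (a%:C * x + b%:C * y) <= 2 * M ^+ 2 * (rdot x x + rdot y y).
Proof.
move=> aM bM; apply: (le_trans (rdotDD_le _ _)); rewrite !rdotMM.
have prr (r : R) : rdot r%:C r%:C = r ^+ 2 by rewrite /rdot /=; ring.
have sq (r : R) : `|r| <= M -> r ^+ 2 <= M ^+ 2.
  by move=> rM; rewrite -real_normK ?num_real// lerXn2r// nnegrE ?(le_trans _ rM).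
rewrite !prr; have h1 := ler_wpM2r (rdot_ge0 x) (sq a aM).
have h2 := ler_wpM2r (rdot_ge0 y) (sq b bM); lra.
Qed.

Definition density (U : space -> C) (G : space -> 'cV[C]_2) (y : space) : R :=
  rdot (U y) (U y) + (rdot (G y 0 0) (G y 0 0) + rdot (G y 1 0) (G y 1 0)).

Lemma density_ge0 U G y : 0 <= density U G y.
Proof. by apply: addr_ge0; [exact: rdot_ge0|apply: addr_ge0; exact: rdot_ge0]. Qed.

Let pointwise_lower (wi a rW K c0 s p q h : R) : 0 <= c0 -> c0 <= wi * a / 2 ->
  c0 * (1 + 2 * K) <= wi * rW -> 0 <= s -> 0 <= p -> 0 <= h -> q <= 2 * h + 2 * (K * s) ->
  c0 * (s + (p + q)) <= wi * (a * (p + h) + rW * s).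
Proof.
move=> c00 ca cb s0 p0 h0 hq.
have h1 := ler_wpM2r p0 ca; have h2 := ler_wpM2r h0 ca; have h3 := ler_wpM2r s0 cb.
have h4 := ler_wpM2l c00 hq.
have h5 := mulr_ge0 c00 p0.
lra.
Qed.

Let pointwise_upper (Z M K NW s p q h F0 F1 d : R) : 0 <= Z -> 0 <= K -> 0 <= NW ->
  0 <= s -> 0 <= p -> 0 <= q -> h <= 2 * q + 2 * (K * s) ->
  F0 <= 2 * M ^+ 2 * (p + h) -> F1 <= 2 * M ^+ 2 * (p + h) -> 0 <= F0 ->
  d <= 2 * (K * F1) + 2 * (NW * s) ->
  Z * d + (Z * F0 + Z * F1) <=
  (Z * (4 * M ^+ 2 * (1 + 2 * K) * (2 + 2 * K) + 2 * NW) + 1) * (s + (p + q)).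
Proof.
move=> Z0 K0 NW0 s0 p0 q0 hh hF0 hF1 F00 hd.
have S0 : 0 <= s + (p + q) by rewrite !addr_ge0.
apply: (@le_trans _ _ (Z * (d + (F0 + F1)))); first by rewrite !mulrDr.
rewrite mulrDl mul1r ler_wpDr// -mulrA; apply: ler_wpM2l => //.
have K1 : 0 <= 1 + 2 * K by lra.
have M0 : 0 <= M ^+ 2 by exact: sqr_ge0.
have h1 : p + h <= (2 + 2 * K) * (s + (p + q)).
  have := mulr_ge0 K0 p0; have := mulr_ge0 K0 q0; lra.
have h2 : F0 + F1 <= 4 * M ^+ 2 * ((2 + 2 * K) * (s + (p + q))).
  have := ler_wpM2l M0 h1; lra.
have h3 : d + (F0 + F1) <= (1 + 2 * K) * (F0 + F1) + 2 * (NW * s).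
  have := mulr_ge0 K0 F00; lra.
apply: (le_trans h3); have h4 := ler_wpM2l K1 h2.
have h5 := mulr_ge0 NW0 (addr_ge0 p0 q0).
rewrite [leRHS]mulrDl; apply: lerD.
  apply: (le_trans h4); rewrite le_eqVlt; apply/orP; left; apply/eqP; ring.
lra.
Qed.

(** The equation eliminates the divergence, which turns coercivity and continuity of the
form into statements about the values at one point. The gradient and the shifted gradient
differ by a multiple of the function, which costs the factors 1 + 2 K. *)
Lemma pointwise_bounds : exists c0 C1 : R, [/\ 0 < c0, 0 < C1 &
  forall (U D : space -> C) (G : space -> 'cV[C]_2) y,
    - (D y + ik * flux U G y 1 0) - (rho y)%:C * omega ^+ 2 * U y = 0 ->
  c0 * density U G y <= rdot (zeta * D y) (U y) +
     (rdot (zeta * flux U G y 0 0) (G y 0 0) + rdot (zeta * flux U G y 1 0) (G y 1 0)) /\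
  rdot (zeta * D y) (zeta * D y) + (rdot (zeta * flux U G y 0 0) (zeta * flux U G y 0 0) +
     rdot (zeta * flux U G y 1 0) (zeta * flux U G y 1 0)) <= C1 * density U G y].
Proof.
have [invA invr] := compatible_inv hc.
have [M AM] := A_bounded m; have [N rN] := rho_bounded m.
have [a a0 Aco] := A_coercive m; have [r r0 rr] := rho_coercive m.
pose wi := complex.Im omega; pose W := rdot omega omega; pose K := (k * t1) ^+ 2.
have wi0 : 0 < wi by [].
have K0 : 0 <= K by rewrite sqr_ge0.
have W0 : 0 < W.
  by rewrite /W /rdot ltr_wpDl// -expr2 ?sqr_ge0// exprn_gt0.
pose c0 := Num.min (wi * a / 2) (wi * (r * W) / (1 + 2 * K)).
have K1 : 0 < 1 + 2 * K by lra.
have c00 : 0 < c0 by rewrite /c0 lt_min !divr_gt0// ?mulr_gt0.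
pose Z := rdot zeta zeta.
pose C1 := Z * (4 * M ^+ 2 * (1 + 2 * K) * (2 + 2 * K) + 2 * N ^+ 2 * W ^+ 2) + 1.
have Z0 : 0 <= Z := rdot_ge0 _.
exists c0, C1; split=> //.
  have h2K : 0 <= 2 + 2 * K by lra.
  have T : 0 <= 4 * M ^+ 2 * (1 + 2 * K) * (2 + 2 * K) + 2 * N ^+ 2 * W ^+ 2.
    apply: addr_ge0; last by rewrite -mulrA; apply: mulr_ge0 => //; apply: mulr_ge0; exact: sqr_ge0.
    apply: mulr_ge0 => //; apply: mulr_ge0; last exact: ltW.
    by apply: mulr_ge0 => //; exact: sqr_ge0.
  by rewrite /C1; apply: ltr_wpDl => //; exact: mulr_ge0.
move=> U D G y.
have [y' Ay] := lift_plus_glob c invA (A_globP m) y.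
have [y'' ry] := lift_plus_glob c invr (rho_globP m) y.
rewrite !fluxE Ay ry ikE.
set B := A_glob m y'; set u := U y; set d := D y; set g0 := G y 0 0; set g1 := G y 1 0.
set f1 := (B 1 0)%:C * g0 + _; set f0 := (B 0 0)%:C * g0 + _ => E.
have Bsym : B 0 1 = B 1 0.
  by have := A_sym m y' => /matrixP /(_ 1 0); rewrite mxE.
have Bco x z : a * (x ^+ 2 + z ^+ 2) <= B 0 0 * x ^+ 2 + 2 * B 0 1 * x * z + B 1 1 * z ^+ 2.
  have := Aco y' (\col_i if i == 0 then x else z).
  rewrite !mxE !big_ord_recl !big_ord0 !mxE !big_ord_recl !big_ord0 !mxE /=.
  rewrite (_ : lift ord0 ord0 = 1); last exact/val_inj.
  rewrite /B -[_ 0 0]/(B 0 0) -/B Bsym; lra.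
have Q1 := coercive_pointwise homega (a00 := B 0 0) (a01 := B 0 1) (a10 := B 1 0) (a11 := B 1 1)
  (alpha := a) (beta := r) Bsym erefl erefl E Bco (rr y'').
have prk (x : C) : rdot ((0 +i* (k * t1)) * x) ((0 +i* (k * t1)) * x) = K * rdot x x.
  by rewrite rdotMM /rdot /= /K; ring.
have prr (x : R) : rdot x%:C x%:C = x ^+ 2 by rewrite /rdot /=; ring.
pose h := rdot (g1 + (0 +i* (k * t1)) * u) (g1 + (0 +i* (k * t1)) * u).
have hq : rdot g1 g1 <= 2 * h + 2 * (K * rdot u u).
  have := rdotDD_le (g1 + (0 +i* (k * t1)) * u) (- ((0 +i* (k * t1)) * u)).
  by rewrite addrK rdotNl rdotNr opprK prk.
have hh : h <= 2 * rdot g1 g1 + 2 * (K * rdot u u).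
  by apply: (le_trans (rdotDD_le _ _)); rewrite prk.
have s0 := rdot_ge0 u; have p0 := rdot_ge0 g0; have q0 := rdot_ge0 g1; have h0 : 0 <= h := rdot_ge0 _.
have c0a : c0 <= wi * a / 2 by rewrite /c0 ge_min lexx.
have c0b : c0 * (1 + 2 * K) <= wi * (r * W).
  by rewrite -ler_pdivlMr// /c0 ge_min lexx orbT.
split.
  apply: le_trans Q1; rewrite -/h -/wi -/W /density -/u -/g0 -/g1.
  have c0ge := ltW c00.
  apply: (pointwise_lower c0ge c0a c0b s0 p0 h0 hq).
have F0 := rdot_comb_le g0 (g1 + (0 +i* (k * t1)) * u) (AM y' 0 0) (AM y' 0 1).
have F1 := rdot_comb_le g0 (g1 + (0 +i* (k * t1)) * u) (AM y' 1 0) (AM y' 1 1).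
have dE : d = - ((0 +i* (k * t1)) * f1) + (- ((rho_glob m y'')%:C * omega ^+ 2 * u)).
  by apply/eqP; rewrite -subr_eq0; apply/eqP; rewrite -oppr0 -E; ring.
have dd : rdot d d <= 2 * (K * rdot f1 f1) + 2 * (N ^+ 2 * W ^+ 2 * rdot u u).
  rewrite dE; apply: (le_trans (rdotDD_le _ _)); rewrite !rdotNl !rdotNr !opprK prk.
  rewrite [omega ^+ 2]expr2 !rdotMM prr -/W lerD2l; apply: (ler_wpM2l (ler0n _ 2)).
  have WW : 0 <= W * W * rdot u u by apply: mulr_ge0 => //; apply: mulr_ge0; exact: ltW.
  have rN2 : (rho_glob m y'') ^+ 2 <= N ^+ 2.
    by rewrite -real_normK ?num_real// lerXn2r// nnegrE ?(le_trans _ (rN y'')).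
  have := ler_wpM2r WW rN2.
  by congr (_ <= _); ring.
rewrite (rdotMM _ d) (rdotMM _ f0) (rdotMM _ f1) -/Z /density -/u -/g0 -/g1.
have NW0 : 0 <= N ^+ 2 * W ^+ 2 by apply: mulr_ge0; exact: sqr_ge0.
have := pointwise_upper Z0 K0 NW0 s0 p0 q0 hh F0 F1 (rdot_ge0 _) dd.
by rewrite [2 * (N ^+ 2 * W ^+ 2)]mulrA.
Qed.

End Sol.

(** * A priori estimate and decay of solutions *)

Section Estimates.
Context {R : realType}.
Notation C := R[i].
Notation plane := (R * R)%type.
Notation space := (R * (R * R))%type.
Notation mplane := (measurableTypeR R * measurableTypeR R)%type.
Notation mspace := (measurableTypeR R * (measurableTypeR R * measurableTypeR R))%type.
Notation mO := measurable_Omega.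
Notation mS := measurable_Sigma.
Variables (m : medium R) (c : configuration R) (omega : C) (k : R).
Hypothesis hc : compatible c m.
Hypothesis homega : 0 < complex.Im omega.
Notation t1 := (theta1 c).
Notation t2 := (theta2 c).
Notation nO := (sqnorm mu3 Omega).
Notation nS := (sqnorm mu2 Sigma).
Notation L2O := (in_L2 mu3 Omega).
Notation flux := (flux_k m c k).
Notation ik := (ik_theta1 c k).
Notation rho y := (lift_plus c (rho_plus m) y).
Notation zeta := (zeta omega).
Notation density := (@density R).
Notation energy := (@energy R).

(** The half-guide problem without its Dirichlet condition. Solutions form a linear space,
stable under translation by e_x. *)
Definition sol (U : space -> C) (G : space -> 'cV[C]_2) : Prop :=
  exists D, [/\ H1_grad t1 t2 U G, Hdiv_div t1 t2 (flux U G) D &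
    {ae mu3, forall y, Omega y ->
      - (D y + ik * flux U G y 1 0) - (rho y)%:C * omega ^+ 2 * U y = 0}].

Lemma sol_H1 U G : sol U G -> H1_grad t1 t2 U G.
Proof. by move=> [D []]. Qed.

Lemma flux_lin (l : C) (U U' : space -> C) (G G' : space -> 'cV[C]_2) :
  flux (fun y => l * U y + U' y) (fun y => l *: G y + G' y) =
  (fun y => l *: flux U G y + flux U' G' y).
Proof.
apply/funext => y; rewrite /flux_k scalemxAr -mulmxDr; congr (_ *m _).
by apply/matrixP => i j; rewrite !mxE; case: (i == 0); ring.
Qed.

Lemma comb_entryE (l : C) (M N : 'cV[C]_2) i : (l *: M + N) i 0 = l * M i 0 + N i 0.
Proof. by rewrite !mxE. Qed.

Lemma scale_entryE (l : C) (M : 'cV[C]_2) i : (l *: M) i 0 = l * M i 0.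
Proof. by rewrite !mxE. Qed.

Lemma sol_lin (l : C) U G U' G' : sol U G -> sol U' G' ->
  sol (fun y => l * U y + U' y) (fun y => l *: G y + G' y).
Proof.
move=> [D [h1 h2 h3]] [D' [h1' h2' h3']]; exists (fun y => l * D y + D' y); split.
- exact: H1_grad_lin.
- by rewrite flux_lin; exact: Hdiv_lin.
- apply: ae_on_impl2 h3 h3' => y _ e e'; rewrite flux_lin comb_entryE.
  by have := congr2 (fun a b => l * a + b) e e'; rewrite mulr0 addr0 => <-; ring.
Qed.

Lemma flux_shiftx1 U G y : flux (fun y => U (shiftx 1 y)) (fun y => G (shiftx 1 y)) y = flux U G (shiftx 1 y).
Proof.
have [invA _] := compatible_inv hc.
by rewrite /flux_k (lift_plus_shiftx1 c invA).
Qed.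

Lemma sol_shiftx1 U G : sol U G -> sol (fun y => U (shiftx 1 y)) (fun y => G (shiftx 1 y)).
Proof.
move=> [D [h1 h2 h3]]; exists (fun y => D (shiftx 1 y)); split.
- exact: H1_grad_shiftx (ler01) h1.
- rewrite (_ : flux _ _ = (fun y => flux U G (shiftx 1 y))); first exact: Hdiv_shiftx ler01 h2.
  by apply/funext => y; exact: flux_shiftx1.
- have := ae_shiftx ler01 h3; apply: ae_on_impl => y _.
  have [_ invr] := compatible_inv hc.
  by rewrite flux_shiftx1 (lift_plus_shiftx1 c invr).
Qed.

Lemma half_guide_sol Phi U : half_guide_solution m c omega k Phi U ->
  (exists G, sol U G) /\ has_trace t1 t2 0 U Phi.
Proof. by move=> [G [D [h1 h2 h3 h4]]]; split=> //; exists G, D. Qed.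

Lemma le_Rintegral_ae (f g : space -> R) :
  mu3.-integrable (Omega : set mspace) (EFin \o f) ->
  mu3.-integrable (Omega : set mspace) (EFin \o g) ->
  {ae mu3, forall y, Omega y -> f y <= g y} ->
  \int[mu3]_(y in Omega) f y <= \int[mu3]_(y in Omega) g y.
Proof.
move=> If Ig fg.
have mf := measurable_int _ If; have mg := measurable_int _ Ig.
have /measurable_EFinP mf' := mf; have /measurable_EFinP mg' := mg.
have mm : @measurable_fun _ _ mspace _ Omega (EFin \o (fun y => Num.max (f y) (g y))).
  by apply/measurable_EFinP; exact: measurable_maxr.
have eqm : {ae mu3, forall y, Omega y -> (EFin \o (fun y => Num.max (f y) (g y))) y = (EFin \o g) y}.
  by apply: ae_on_impl fg => y _ h /=; rewrite max_r.
have Im : mu3.-integrable (Omega : set mspace) (EFin \o (fun y => Num.max (f y) (g y))).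
  apply: (le_integrable mO (g := EFin \o (fun y => `|f y| + `|g y|))) => //.
    move=> y _ /=; rewrite lee_fin [leRHS]ger0_norm ?addr_ge0//.
    by rewrite /Num.max; case: ifP => _; rewrite ?lerDl ?lerDr.
  by apply: (integrable_addr mO); exact: integrable_norm.
have E : \int[mu3]_(y in Omega) Num.max (f y) (g y) = \int[mu3]_(y in Omega) g y.
  by congr fine; apply: ae_eq_integral; [exact: mO|exact: mm|exact: mg|exact: eqm].
rewrite -E; apply: (le_Rintegral mO If Im) => y _.
by rewrite le_max lexx.
Qed.

Lemma density_integrable U G : H1_grad t1 t2 U G ->
  mu3.-integrable (Omega : set mspace) (EFin \o density U G).
Proof.
move=> /H1_grad_L2[U2 G2].
apply: (integrable_addr mO); first exact: (integrable_rdot mO).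
by apply: (integrable_addr mO); exact: (integrable_rdot mO (G2 _) (G2 _)).
Qed.

Lemma energyE U G : H1_grad t1 t2 U G ->
  energy U G = \int[mu3]_(y in Omega) density U G y.
Proof.
move=> /H1_grad_L2[U2 G2].
have I0 := integrable_rdot mO U2 U2.
have I1 := integrable_rdot mO (G2 0) (G2 0).
have I2 := integrable_rdot mO (G2 1) (G2 1).
apply/esym; apply: (etrans (RintegralD mO I0 (integrable_addr mO I1 I2))).
by congr (_ + _); exact: (RintegralD mO I1 I2).
Qed.

Definition qform (D F0 F1 W G0 G1 : space -> C) (y : space) : R :=
  rdot (D y) (W y) + (rdot (F0 y) (G0 y) + rdot (F1 y) (G1 y)).

Lemma green_form_integrable (a b : R) D F0 F1 W G0 G1 : 0 <= a -> 0 <= b <= 1 ->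
  L2O D -> L2O F0 -> L2O F1 -> L2O W -> L2O G0 -> L2O G1 ->
  mu3.-integrable (Omega : set mspace) (EFin \o (fun y => weight a b y.1 * qform D F0 F1 W G0 G1 y +
    weight' a b y.1 * rdot (F0 y) (W y))).
Proof.
move=> a0 b01 dD dF0 dF1 dW dG0 dG1.
apply: (integrable_addr mO); last exact: integrable_weight'.
have -> : (fun y => weight a b y.1 * qform D F0 F1 W G0 G1 y) = (fun y => weight a b y.1 * rdot (D y) (W y) +
    (weight a b y.1 * rdot (F0 y) (G0 y) + weight a b y.1 * rdot (F1 y) (G1 y))).
  by apply/funext => y; rewrite /qform !mulrDr.
apply: (integrable_addr mO); first exact: integrable_weight.
by apply: (integrable_addr mO); exact: integrable_weight.
Qed.

(** The value of e is such that half of the coercive term absorbs the flux and the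
divergence in the terms containing (v, h0, h1). *)
Lemma apriori_pointwise (e c0 C1 : R) (d f0 f1 u g0 g1 v h0 h1 : C) : 0 < e -> e * C1 = c0 / 2 ->
  let s := rdot u u + (rdot g0 g0 + rdot g1 g1) in
  c0 * s <= rdot d u + (rdot f0 g0 + rdot f1 g1) ->
  rdot d d + (rdot f0 f0 + rdot f1 f1) <= C1 * s ->
  c0 / 2 * s <= rdot d (-1 * v + u) + (rdot f0 (-1 * h0 + g0) + rdot f1 (-1 * h1 + g1)) +
    e^-1 * (rdot v v + (rdot h0 h0 + rdot h1 h1)).
Proof.
move=> e0 eC s lo up; rewrite !mulN1r !rdotDr !rdotNr.
have y1 := le_trans (ler_norm _) (rdot_young d v e0).
have y2 := le_trans (ler_norm _) (rdot_young f0 h0 e0).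
have y3 := le_trans (ler_norm _) (rdot_young f1 h1 e0).
have := ler_wpM2l (ltW e0) up; rewrite mulrA eC.
move: (rdot d d) (rdot f0 f0) (rdot f1 f1) (rdot v v) (rdot h0 h0) (rdot h1 h1) (rdot d v) (rdot f0 h0) (rdot f1 h1)
  (rdot d u) (rdot f0 g0) (rdot f1 g1) s lo up y1 y2 y3 => *; lra.
Qed.

(** The test function U - V vanishes on the interface. *)
Lemma apriori : exists2 K : R, 0 < K & forall U G V GV Phi,
  sol U G -> has_trace t1 t2 0 U Phi -> H1_grad t1 t2 V GV -> has_trace t1 t2 0 V Phi ->
  energy U G <= K * energy V GV.
Proof.
have [c0 [C1 [c00 C10 B]]] := pointwise_bounds k hc homega.
(* e * C1 is half the coercivity constant. *)
pose e := c0 / (2 * C1).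
have e0 : 0 < e by rewrite divr_gt0// mulr_gt0.
exists (e^-1 / (c0 / 2)); first by rewrite !divr_gt0// invr_gt0.
move=> U G V GV Phi [D [hU hD pde]] tU hV tV.
have [phi hphi] := hU; have [psi hpsi] := hV.
have hW := H1_approx_lin (-1) hpsi hphi.
have tW : has_trace t1 t2 0 (fun y => -1 * V y + U y) (fun=> 0).
  apply: (has_trace_ae (has_trace_lin (-1) tV tU)).
  - by case: hW.
  - exact: L2_0.
  - by apply: ae_on_all.
  - by apply: ae_on_all => z _; rewrite mulN1r addNr.
have cW := has_trace_cvg tW hW.
have hF := Hdiv_scale zeta hD.
have b01 : 0 <= (0 : R) <= 1 by rewrite lexx ler01.
have Gr := green_limit (lexx 0) b01 hF hW (or_intror cW).
have [F2 D2 _] := hF.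
have [V2 GV2] := H1_grad_L2 hV; have [U2 G2] := H1_grad_L2 hU.
have [W2 GW2] : L2O (fun y => -1 * V y + U y) /\ forall i, L2O (fun y => (-1 *: GV y + G y) i 0).
  by case: hW.
pose wf (y : space) : R := weight 0 0 y.1 * qform (fun y => zeta * D y) (fun y => (zeta *: flux U G y) 0 0)
   (fun y => (zeta *: flux U G y) 1 0) (fun y => -1 * V y + U y)
   (fun y => (-1 *: GV y + G y) 0 0) (fun y => (-1 *: GV y + G y) 1 0) y +
   weight' 0 0 y.1 * rdot ((zeta *: flux U G y) 0 0) (-1 * V y + U y).
have Iw : mu3.-integrable (Omega : set mspace) (EFin \o wf).
  by apply: green_form_integrable.
have key : \int[mu3]_(y in Omega) (c0 / 2 * density U G y) <=
   \int[mu3]_(y in Omega) (wf y + e^-1 * density V GV y).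
  apply: le_Rintegral_ae.
  - by apply: (integrable_scaler mO); exact: density_integrable.
  - by apply: (integrable_addr mO) => //; apply: (integrable_scaler mO); exact: density_integrable.
  apply: ae_on_impl pde => y Oy /B[lo up].
  rewrite /wf /weight /weight' !mul0r subr0 mul1r addr0 /qform !comb_entryE !scale_entryE.
  apply: apriori_pointwise lo up => //.
  by rewrite /e; field; rewrite gt_eqF.
have Z : \int[mu3]_(y in Omega) wf y = 0 by rewrite -[RHS]Gr.
rewrite (RintegralD mO Iw (integrable_scaler mO _ (density_integrable hV))) Z add0r in key.
rewrite !(RintegralZl _ mO (density_integrable _))// -!energyE// in key.
by rewrite mulrAC ler_pdivlMr ?divr_gt0// mulrC.
Qed.

(** The exponential is bounded by 1 for x <= 1 and by exp (- a) for x > 1. *)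
Lemma decay_pointwise (c0 K a x s Q P : R) : 0 < c0 -> 0 < K -> 0 < a -> 0 <= s -> 0 < x ->
  c0 * s <= Q -> `|P| <= K * c0 * s ->
  c0 * (- (K * a) * s + (if 1 < x then (1 + K * a) * (1 - expR (- a)) * s else 0)) <=
  weight a 1 x * Q + weight' a 1 x * P.
Proof.
move=> c00 K0 a0 s0 x0 hQ hP; rewrite /weight /weight' !mul1r.
have E0 := expR_gt0 (- (a * x)).
have E1 : expR (- (a * x)) <= 1 by rewrite -expR0 ler_expR oppr_le0 mulr_ge0// ltW.
have Ee : 1 < x -> expR (- (a * x)) <= expR (- a).
  by move=> x1; rewrite ler_expR lerN2 -[leLHS]mulr1 ler_pM2l// ltW.
move: (expR (- (a * x))) (expR (- a)) E0 E1 Ee => E e E0 E1 Ee.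
have w0 : 0 <= 1 - E by lra.
have h1 := ler_wpM2l w0 hQ.
have aE : 0 <= a * E by rewrite mulr_ge0 ?ltW.
have hP' : - (K * c0 * s) <= P by move: hP; rewrite ler_norml => /andP[].
have h2 := ler_wpM2l aE hP'.
have cs : 0 <= c0 * s by rewrite mulr_ge0// ltW.
have Ka : 0 <= 1 + K * a by have := mulr_gt0 K0 a0; lra.
have Kcs := mulr_ge0 Ka cs.
case: ifP => [x1|_].
  have h3 := ler_wpM2r Kcs (Ee x1); lra.
have h3 := ler_wpM2r Kcs E1; lra.
Qed.

(** Integrating [decay_pointwise] gives
(1 + K a) (1 - exp (- a)) E1 <= K a E0, where E0 is the energy in x > 0 and E1 that in x > 1;
the ratio is less than 1 as soon as exp a > 1 + K a. *)
Lemma decay : exists q : R, [/\ 0 < q, q < 1 & forall U G, sol U G ->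
  energy (fun y => U (shiftx 1 y)) (fun y => G (shiftx 1 y)) <= q * energy U G].
Proof.
have [c0 [C1 [c00 C10 B]]] := pointwise_bounds k hc homega.
pose K := (C1 + 1) / c0.
have K0 : 0 < K by rewrite divr_gt0// ltr_wpDl// ltW.
(* Then (1 + a / 2)^2 = 1 + K a + a. *)
pose a := 4 * K.
have a0 : 0 < a by rewrite mulr_gt0.
pose e := expR (- a).
have Ka0 : 0 < K * a by rewrite mulr_gt0.
have Ka1 : 0 < 1 + K * a by rewrite ltr_wpDr// ltW.
have e1 : (1 + K * a) * e < 1.
  have ea : expR a * e = 1 by rewrite /e expRN divff// gt_eqF// expR_gt0.
  rewrite -[ltRHS]ea ltr_pM2r ?expR_gt0//.
  have h : 1 + a / 2 <= expR (a / 2) by exact: expR_ge1Dx.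
  have h0 : 0 <= 1 + a / 2 by rewrite addr_ge0// divr_ge0// ltW.
  have -> : expR a = expR (a / 2) * expR (a / 2) by rewrite -expRD; congr expR; lra.
  have := ler_pM h0 h0 h h; apply: lt_le_trans.
  have -> : (1 + a / 2) * (1 + a / 2) = 1 + K * a + a by rewrite /a; field.
  by rewrite ltrDl.
have e0 : 0 < 1 - e.
  rewrite subr_gt0; apply: le_lt_trans e1; rewrite -[leLHS]mul1r ler_wpM2r ?expR_ge0//.
  by rewrite lerDl ltW.
have de0 : 0 < (1 + K * a) * (1 - e) by rewrite mulr_gt0.
exists (K * a / ((1 + K * a) * (1 - e))); split.
- by rewrite divr_gt0.
- by rewrite ltr_pdivrMr// mul1r mulrBr mulr1; lra.
move=> U G [D [hU hD pde]].
have [phi hphi] := hU.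
have hF := Hdiv_scale zeta hD.
have b01 : 0 <= (1 : R) <= 1 by rewrite lexx ler01.
have Gr := green_limit (ltW a0) b01 hF hphi (or_introl erefl).
have [F2 D2 _] := hF; have [U2 G2] := H1_grad_L2 hU.
pose wf (y : space) : R := weight a 1 y.1 * qform (fun y => zeta * D y) (fun y => (zeta *: flux U G y) 0 0)
   (fun y => (zeta *: flux U G y) 1 0) U
   (fun y => G y 0 0) (fun y => G y 1 0) y +
   weight' a 1 y.1 * rdot ((zeta *: flux U G y) 0 0) (U y).
have Iw : mu3.-integrable (Omega : set mspace) (EFin \o wf).
  by apply: green_form_integrable => //; exact: ltW.
have Id := density_integrable hU.
have sub : Omega_from 1 `<=` (Omega : set mspace) by exact: (Omega_from_sub ler01).
pose d1 := (density U G \_ (Omega_from 1)) : space -> R.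
have E1 : \int[mu3]_(y in Omega) d1 y = energy (fun y => U (shiftx 1 y)) (fun y => G (shiftx 1 y)).
  rewrite energyE; last exact: H1_grad_shiftx ler01 hU.
  transitivity (\int[mu3]_(y in Omega_from 1) density U G y).
    by rewrite -Rintegral_mkcondr setIidr.
  congr fine; apply/esym; apply: (ge0_integral_shiftx (f := density U G) ler01).
    by have /measurable_EFinP := measurable_int _ Id.
  by move=> y _; exact: density_ge0.
have Id1 : mu3.-integrable (Omega : set mspace) (EFin \o d1).
  have I1 := integrableS mO (measurable_Omega_from 1) sub Id.
  have := @integrable_restrict _ mspace R mu3 (Omega_from 1) (measurable_Omega_from 1) Omega mO
    (EFin \o density U G).
  rewrite setIidr// => -[/(_ I1) + _].
  by congr (integrable _ _ _); apply/funext => y; rewrite /d1 /patch /=; case: ifP.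
have key : \int[mu3]_(y in Omega) (c0 * (- (K * a) * density U G y + (1 + K * a) * (1 - e) * d1 y)) <=
   \int[mu3]_(y in Omega) wf y.
  apply: le_Rintegral_ae => //.
    apply: (integrable_scaler mO); apply: (integrable_addr mO); exact: (integrable_scaler mO).
  apply: ae_on_impl pde => y Oy /B[lo up].
  have y0 : 0 < y.1 by move: Oy; rewrite OmegaE => -[].
  have -> : (1 + K * a) * (1 - e) * d1 y =
      if 1 < y.1 then (1 + K * a) * (1 - e) * density U G y else 0.
    rewrite /d1 /patch; have -> : (y \in Omega_from 1) = (1 < y.1).
      apply/idP/idP => [/set_mem|h]; first by rewrite Omega_fromE => -[].
      by apply/mem_set; rewrite Omega_fromE; split=> //; move: Oy; rewrite OmegaE => -[].
    by case: ifP => // _; rewrite mulr0.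
  apply: decay_pointwise => //; first exact: density_ge0.
    by rewrite /qform !scale_entryE.
  rewrite scale_entryE; apply: (le_trans (rdot_young _ _ ltr01)); rewrite invr1 !mul1r.
  rewrite /K divfK ?gt_eqF// mulrDl mul1r; apply: lerD.
    apply: le_trans up; rewrite addrCA lerDl addr_ge0 ?rdot_ge0//.
  by rewrite /density lerDl addr_ge0 ?rdot_ge0.
have Z : \int[mu3]_(y in Omega) wf y = 0 by rewrite -[RHS]Gr.
rewrite Z in key.
have I1 := integrable_scaler mO (- (K * a)) Id.
have I2 := integrable_scaler mO ((1 + K * a) * (1 - e)) Id1.
rewrite (RintegralZl _ mO (integrable_addr mO I1 I2)) (RintegralD mO I1 I2) in key.
rewrite (RintegralZl _ mO Id) (RintegralZl _ mO Id1) E1 -energyE// in key.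
move: key; rewrite pmulr_rle0// mulNr addrC subr_le0 => key.
by rewrite mulrAC ler_pdivlMr// mulrC.
Qed.

End Estimates.

(** * The propagation operator *)

Section Propagation.
Context {R : realType}.
Notation C := R[i].
Notation plane := (R * R)%type.
Notation space := (R * (R * R))%type.
Notation mplane := (measurableTypeR R * measurableTypeR R)%type.
Notation mspace := (measurableTypeR R * (measurableTypeR R * measurableTypeR R))%type.
Notation mO := measurable_Omega.
Notation mS := measurable_Sigma.
Variables (m : medium R) (c : configuration R) (omega : C) (k : R).
Hypothesis hc : compatible c m.
Hypothesis homega : 0 < complex.Im omega.
Notation t1 := (theta1 c).
Notation t2 := (theta2 c).
Notation nO := (sqnorm mu3 Omega).
Notation nS := (sqnorm mu2 Sigma).
Notation L2O := (in_L2 mu3 Omega).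
Notation flux := (flux_k m c k).
Notation ik := (ik_theta1 c k).
Notation rho y := (lift_plus c (rho_plus m) y).
Notation zeta := (zeta omega).
Notation density := (@density R).
Notation energy := (@energy R).
Notation sol := (sol m c omega k).
Notation H := (H12 t1 t2).
Notation tr := (has_trace t1 t2).

Lemma eqae_refl (Phi : plane -> C) : eqae Phi Phi.
Proof. by apply: ae_on_all. Qed.

Lemma eqae_sym (Phi Psi : plane -> C) : eqae Phi Psi -> eqae Psi Phi.
Proof. by apply: ae_on_impl => z _ ->. Qed.

Lemma eqae_trans (Phi Psi Xi : plane -> C) : eqae Phi Psi -> eqae Psi Xi -> eqae Phi Xi.
Proof. by move=> h1 h2; apply: ae_on_impl2 h1 h2 => z _ -> ->. Qed.

Lemma has_trace_scale (l : C) n V Phi : tr n V Phi ->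
  tr n (fun y => l * V y) (fun z => l * Phi z).
Proof.
move=> h; have := has_trace_lin (l - 1) h h.
have -> : (fun y => (l - 1) * V y + V y) = (fun y => l * V y).
  by apply/funext => y; ring.
have -> // : (fun z => (l - 1) * Phi z + Phi z) = (fun z => l * Phi z).
by apply/funext => z; ring.
Qed.

Lemma sol_scale (l : C) U G : sol U G -> sol (fun y => l * U y) (fun y => l *: G y).
Proof.
move=> h; have := sol_lin (l - 1) h h.
have -> : (fun y => (l - 1) * U y + U y) = (fun y => l * U y).
  by apply/funext => y; ring.
have -> // : (fun y => (l - 1) *: G y + G y) = (fun y => l *: G y).
by apply/funext => y; rewrite scalerBl scale1r subrK.
Qed.

Lemma H1_grad_scale (l : C) U G : H1_grad t1 t2 U G ->
  H1_grad t1 t2 (fun y => l * U y) (fun y => l *: G y).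
Proof.
move=> h; have := H1_grad_lin (l - 1) h h.
have -> : (fun y => (l - 1) * U y + U y) = (fun y => l * U y).
  by apply/funext => y; ring.
have -> // : (fun y => (l - 1) *: G y + G y) = (fun y => l *: G y).
by apply/funext => y; rewrite scalerBl scale1r subrK.
Qed.

Lemma energy_scale (l : C) U G : H1_grad t1 t2 U G ->
  energy (fun y => l * U y) (fun y => l *: G y) = rdot l l * energy U G.
Proof.
move=> /H1_grad_L2[U2 G2]; rewrite /energy.
have E i : (fun y => (l *: G y) i 0) = (fun y => l * G y i 0).
  by apply/funext => y; rewrite mxE.
by rewrite !E (sqnormZ mO l U2) (sqnormZ mO l (G2 0)) (sqnormZ mO l (G2 1)) !mulrDr.
Qed.

Lemma H12_lin (l : C) Phi Psi : H Phi -> H Psi -> H (fun z => l * Phi z + Psi z).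
Proof. by move=> [V hV] [W hW]; eexists; exact: (has_trace_lin l hV hW). Qed.

Lemma H12_scale (l : C) Phi : H Phi -> H (fun z => l * Phi z).
Proof. by move=> [V hV]; eexists; exact: (has_trace_scale l hV). Qed.

Lemma H12_L2 Phi : H Phi -> in_L2 mu2 Sigma Phi.
Proof. by move=> [V /has_trace_L2]. Qed.

Lemma has_trace_00 : tr 0 (fun=> 0) (fun=> 0).
Proof.
have Z : nS (fun=> 0 - 0 : C) = 0 by rewrite subrr; exact: (sqnorm0 mu2 mS).
split; first exact: L2_0.
exists (fun=> 0), (fun _ _ => 0); split; last first.
  apply/(cvg_L2E mS); [by move=> j; exact: L2_0|exact: L2_0|].
  by under eq_fun do rewrite Z; exact: cvg_cst.
exact: H1_approx_0.
Qed.

(** The difference has zero trace: compare its energy with that of the zero function. *)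
Lemma sol_unique U G U' G' Phi Phi' : sol U G -> tr 0 U Phi -> sol U' G' -> tr 0 U' Phi' ->
  eqae Phi Phi' -> {ae mu3, forall y, Omega y -> U y = U' y}.
Proof.
move=> sU tU sU' tU' PP'.
have [K K0 HK] := apriori k hc homega.
have sW := sol_lin (-1) sU sU'.
have [W2 _] := H1_grad_L2 (sol_H1 sW).
have tW : tr 0 (fun y => -1 * U y + U' y) (fun=> 0).
  apply: (has_trace_ae (has_trace_lin (-1) tU tU') W2).
  - exact: L2_0.
  - by apply: ae_on_all.
  - by apply: ae_on_impl PP' => z _ ->; rewrite mulN1r addNr.
have := HK _ _ _ _ _ sW tW (H1_grad_0 t1 t2) has_trace_00.
rewrite /energy.
have -> : nO (fun=> 0 : C) = 0 := sqnorm0 mu3 mO.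
have E i : (fun y : space => (0 : 'cV[C]_2) i 0) = (fun=> 0) by apply/funext => y; rewrite mxE.
rewrite !E (sqnorm0 mu3 mO) !addr0 mulr0 => le0.
have W0 : nO (fun y => -1 * U y + U' y) = 0.
  by apply/eqP; rewrite eq_le sqnorm_ge0 andbT; exact: (le_trans (sqnorm_le_energy _ _) le0).
have := sqnorm_eq0 mO W2 W0; apply: ae_on_impl => y _ /eqP.
by rewrite mulN1r addrC subr_eq0 => /eqP ->.
Qed.

Lemma H12_norm_le V G Phi : H1_grad t1 t2 V G -> tr 0 V Phi ->
  H12_norm t1 t2 Phi <= Num.sqrt (energy V G).
Proof.
move=> hV tV; apply: ge_inf.
  exists 0 => _ [W [GW [h1 h2 ->]]]; exact: sqrtr_ge0.
by exists V, G; split=> //; rewrite (H1_normE hV).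
Qed.

Lemma H12_norm_ge (x : R) Phi : H Phi ->
  (forall V G, H1_grad t1 t2 V G -> tr 0 V Phi -> x <= Num.sqrt (energy V G)) ->
  x <= H12_norm t1 t2 Phi.
Proof.
move=> [V tV] h; apply: lb_le_inf.
  by have [G hG] := has_trace_grad tV; exists (H1_norm V G), V, G.
by move=> _ [W [GW [h1 h2 ->]]]; rewrite (H1_normE h1); exact: h.
Qed.

(** The norm of a trace is the infimum of the H1 norms of its lifts, so it suffices to
bound the energy of one lift of S Phi by that of every lift of Phi. *)
Lemma operator_bound (K : R) (S : (plane -> C) -> (plane -> C)) : 0 < K ->
  (forall Phi, H Phi -> forall W GW, H1_grad t1 t2 W GW -> tr 0 W Phi ->
    exists V G, [/\ H1_grad t1 t2 V G, tr 0 V (S Phi) & energy V G <= K * energy W GW]) ->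
  exists M : R, forall Phi, H Phi -> H12_norm t1 t2 (S Phi) <= M * H12_norm t1 t2 Phi.
Proof.
move=> K0 h; exists (Num.sqrt K) => Phi HPhi.
have sK0 : 0 < Num.sqrt K by rewrite sqrtr_gt0.
rewrite -ler_pdivrMl//; apply: H12_norm_ge => // W GW hW tW.
have [V [G [hV tV E]]] := h _ HPhi _ _ hW tW.
rewrite ler_pdivrMl//; apply: (le_trans (H12_norm_le hV tV)).
rewrite -sqrtrM; last exact: ltW.
exact: ler_wsqrtr.
Qed.

Variables (Uhat : (plane -> C) -> (space -> C)) (P : (plane -> C) -> (plane -> C)).
Hypothesis hU : forall Phi, H Phi -> half_guide_solution m c omega k Phi (Uhat Phi).
Hypothesis hP : forall Phi, H Phi -> tr 1 (Uhat Phi) (P Phi).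

Lemma P_H12 Phi : H Phi -> H (P Phi).
Proof. by move=> /hP /has_trace_shiftx h; eexists; exact: h. Qed.

Lemma iter_P_H12 n Phi : H Phi -> H (iter n P Phi).
Proof. by move=> h; elim: n => //= n; exact: P_H12. Qed.

(** P gives the trace at x = 1 of every solution, and not only of the chosen ones. *)
Lemma sol_P U G Phi : sol U G -> tr 0 U Phi -> tr 1 U (P Phi).
Proof.
move=> sU tU; have HPhi : H Phi by exists U.
have [[G' sU'] tU'] := half_guide_sol (hU HPhi).
have [U2 _] := H1_grad_L2 (sol_H1 sU).
apply: (has_trace_ae (hP HPhi) U2 (H12_L2 (P_H12 HPhi)) _ (eqae_refl _)).
exact: sol_unique sU' tU' sU tU (eqae_refl _).
Qed.

Lemma sol_shift U G Phi : sol U G -> tr 0 U Phi ->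
  sol (fun y => U (shiftx 1 y)) (fun y => G (shiftx 1 y)) /\ tr 0 (fun y => U (shiftx 1 y)) (P Phi).
Proof.
move=> sU tU; split; first exact: sol_shiftx1.
exact: (has_trace_shiftx (sol_P sU tU)).
Qed.

Lemma shiftxS n y : shiftx n.+1%:R y = shiftx 1 (shiftx n%:R y) :> space.
Proof. by rewrite shiftxD natr1. Qed.

Lemma sol_iter U G Phi n : sol U G -> tr 0 U Phi ->
  sol (fun y => U (shiftx n%:R y)) (fun y => G (shiftx n%:R y)) /\
  tr 0 (fun y => U (shiftx n%:R y)) (iter n P Phi).
Proof.
move=> sU tU; elim: n => [|n [IH1 IH2]].
  have -> : (fun y => U (shiftx 0%:R y)) = U by apply/funext => y; rewrite /shiftx scale0r addr0.
  by have -> : (fun y => G (shiftx 0%:R y)) = G by apply/funext => y; rewrite /shiftx scale0r addr0.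
have [] := sol_shift IH1 IH2.
have E (T : Type) (f : space -> T) : (fun y => f (shiftx n%:R (shiftx 1 y))) = (fun y => f (shiftx n.+1%:R y)).
  by apply/funext => y; rewrite shiftxD addrC natr1.
by rewrite !E.
Qed.

Lemma P_ext Phi Psi : H Phi -> H Psi -> eqae Phi Psi -> eqae (P Phi) (P Psi).
Proof.
move=> hPhi hPsi PP.
have [[G sU] tU] := half_guide_sol (hU hPhi); have [[G' sU'] tU'] := half_guide_sol (hU hPsi).
have UU := sol_unique sU tU sU' tU' PP.
have [U2 _] := H1_grad_L2 (sol_H1 sU').
exact: has_trace_unique (has_trace_ae (hP hPhi) U2 (H12_L2 (P_H12 hPhi)) UU (eqae_refl _)) (hP hPsi).
Qed.

Lemma P_lin (l : C) Phi Psi : H Phi -> H Psi ->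
  eqae (P (fun z => l * Phi z + Psi z)) (fun z => l * P Phi z + P Psi z).
Proof.
move=> hPhi hPsi.
have [[G sU] tU] := half_guide_sol (hU hPhi); have [[G' sU'] tU'] := half_guide_sol (hU hPsi).
have sW := sol_lin l sU sU'; have tW := has_trace_lin l tU tU'.
exact: has_trace_unique (sol_P sW tW) (has_trace_lin l (hP hPhi) (hP hPsi)).
Qed.

Lemma P_bounded : bounded_operator t1 t2 P.
Proof.
split; [exact: P_H12|exact: P_ext|exact: P_lin|].
have [K K0 HK] := apriori k hc homega.
have [q [q0 q1 Hq]] := decay k hc homega.
apply: (@operator_bound K) => // Phi hPhi W GW hW tW.
have [[G sU] tU] := half_guide_sol (hU hPhi).
have [sV tV] := sol_shift sU tU.
exists (fun y => Uhat Phi (shiftx 1 y)), (fun y => G (shiftx 1 y)); split => //.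
  exact: sol_H1 sV.
apply: le_trans (HK _ _ _ _ _ sU tU hW tW); apply: (le_trans (Hq _ _ sU)).
by rewrite -[leRHS]mul1r ler_wpM2r ?energy_ge0// ltW.
Qed.

Lemma P_iter Phi : H Phi ->
  (forall n : nat, {ae mu3, forall y, Omega y ->
     Uhat Phi (y + n%:R *: e_x) = Uhat (iter n P Phi) y}) /\
  (forall n : nat, tr n (Uhat Phi) (iter n P Phi)).
Proof.
move=> hPhi; have [[G sU] tU] := half_guide_sol (hU hPhi).
split=> n; have [sn tn] := sol_iter n sU tU.
  have [[G' sU'] tU'] := half_guide_sol (hU (iter_P_H12 n hPhi)).
  exact: sol_unique sn tn sU' tU' (eqae_refl _).
exact: has_trace_unshiftx (sol_H1 sU) tn.
Qed.

End Propagation.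

(** * The spectrum of the propagation operator *)

Section Spectrum.
Context {R : realType}.
Notation C := R[i].
Notation plane := (R * R)%type.
Notation space := (R * (R * R))%type.
Notation mplane := (measurableTypeR R * measurableTypeR R)%type.
Notation mspace := (measurableTypeR R * (measurableTypeR R * measurableTypeR R))%type.
Notation mO := measurable_Omega.
Notation mS := measurable_Sigma.
Variables (m : medium R) (c : configuration R) (omega : C) (k : R).
Hypothesis hc : compatible c m.
Hypothesis homega : 0 < complex.Im omega.
Notation t1 := (theta1 c).
Notation t2 := (theta2 c).
Notation nO := (sqnorm mu3 Omega).
Notation nS := (sqnorm mu2 Sigma).
Notation L2O := (in_L2 mu3 Omega).
Notation flux := (flux_k m c k).
Notation ik := (ik_theta1 c k).
Notation rho y := (lift_plus c (rho_plus m) y).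
Notation zeta := (zeta omega).
Notation density := (@density R).
Notation energy := (@energy R).
Notation sol := (sol m c omega k).
Notation H := (H12 t1 t2).
Notation tr := (has_trace t1 t2).
Notation L2S := (in_L2 mu2 Sigma).
Variables (Uhat : (plane -> C) -> (space -> C)) (P : (plane -> C) -> (plane -> C)).
Hypothesis hU : forall Phi, H Phi -> half_guide_solution m c omega k Phi (Uhat Phi).
Hypothesis hP : forall Phi, H Phi -> tr 1 (Uhat Phi) (P Phi).

Lemma energyD_le V G V' G' W GW : H1_grad t1 t2 V G -> H1_grad t1 t2 V' G' ->
  (forall y, W y = V y + V' y) -> (forall y, GW y = G y + G' y) ->
  energy W GW <= 2 * energy V G + 2 * energy V' G'.
Proof.
move=> /H1_grad_L2[V2 G2] /H1_grad_L2[V'2 G'2] EW EG; rewrite /energy.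
have h1 := sqnormD_le mO V2 V'2; have h2 := sqnormD_le mO (G2 0) (G'2 0); have h3 := sqnormD_le mO (G2 1) (G'2 1).
have -> : W = (fun y => V y + V' y) by exact/funext.
have E i : (fun y => GW y i 0) = (fun y => G y i 0 + G' y i 0).
  by apply/funext => y; rewrite EG mxE.
rewrite !E; apply: (le_trans (lerD h1 (lerD h2 h3))).
rewrite le_eqVlt; apply/orP; left; apply/eqP; ring.
Qed.

(** The limits V, G and Ps come from completeness of L^2. They form an element of H1 and its
trace because the n-th function is approximated by a test function with an error r^(2n); these
test functions approximate the limit. *)
Lemma H1_complete (V_ : nat -> space -> C) (G_ : nat -> space -> 'cV[C]_2) (Ps_ : nat -> plane -> C)
    (K r : R) : 0 < r -> r < 1 ->
  (forall n, H1_grad t1 t2 (V_ n) (G_ n)) -> (forall n, tr 0 (V_ n) (Ps_ n)) ->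
  (forall n, energy (fun y => -1 * V_ n y + V_ n.+1 y) (fun y => -1 *: G_ n y + G_ n.+1 y)
     <= K * r ^+ 4 ^+ n) ->
  exists V G Ps, [/\ H1_grad t1 t2 V G, tr 0 V Ps,
    forall n, energy (fun y => -1 * V_ n y + V y) (fun y => -1 *: G_ n y + G y) <=
      3 * (2 / (1 - r) ^+ 2 * (K / (1 - r ^+ 2))) * (r ^+ 2) ^+ n &
    forall n, nS (fun z => Ps_ n z - Ps z) <=
      2 / (1 - r) ^+ 2 * (8 * K / (1 - r ^+ 2)) * (r ^+ 2) ^+ n].
Proof.
move=> r0 r1 hV tV hE.
have V_2 n : L2O (V_ n) by have [] := H1_grad_L2 (hV n).
have G_2 n i : L2O (fun y => G_ n y i 0) by have [_] := H1_grad_L2 (hV n).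
have P_2 n : in_L2 mu2 Sigma (Ps_ n) := has_trace_L2 (tV n).
have hG n i : (fun y => (-1 *: G_ n y + G_ n.+1 y) i 0) = (fun y => G_ n.+1 y i 0 - G_ n y i 0).
  by apply/funext => y; rewrite comb_entryE mulN1r addrC.
have hB (f g : space -> C) : (fun y => -1 * f y + g y) = (fun y => g y - f y).
  by apply/funext => y; rewrite mulN1r addrC.
have eV n : nO (fun y => V_ n.+1 y - V_ n y) <= K * r ^+ 4 ^+ n.
  by apply: le_trans (hE n); rewrite /energy hB lerDl addr_ge0 ?sqnorm_ge0.
have eG0 n : nO (fun y => G_ n.+1 y 0 0 - G_ n y 0 0) <= K * r ^+ 4 ^+ n.
  by apply: le_trans (hE n); rewrite /energy !hG addrCA lerDl addr_ge0 ?sqnorm_ge0.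
have eG1 n : nO (fun y => G_ n.+1 y 1 0 - G_ n y 1 0) <= K * r ^+ 4 ^+ n.
  by apply: le_trans (hE n); rewrite /energy !hG addrA lerDr addr_ge0 ?sqnorm_ge0.
have eP n : nS (fun z => Ps_ n.+1 z - Ps_ n z) <= 8 * K * r ^+ 4 ^+ n.
  have := trace_energy (H1_grad_lin (-1) (hV n) (hV n.+1)) (has_trace_lin (-1) (tV n) (tV n.+1)).
  have -> : (fun z => -1 * Ps_ n z + Ps_ n.+1 z) = (fun z => Ps_ n.+1 z - Ps_ n z).
    by apply/funext => z; rewrite mulN1r addrC.
  by move/le_trans; apply; rewrite -mulrA; apply: (ler_wpM2l (ler0n _ 8)).
have [V V2 cV] := L2_complete mO r0 r1 V_2 eV.
have [G0 G02 cG0] := L2_complete mO r0 r1 (fun n => G_2 n 0) eG0.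
have [G1 G12 cG1] := L2_complete mO r0 r1 (fun n => G_2 n 1) eG1.
have [Ps Ps2 cP] := L2_complete mS r0 r1 P_2 eP.
pose t := r ^+ 2.
have t0 : 0 < t by rewrite exprn_gt0.
have t1lt : t < 1 by rewrite expr_lt1// ltW.
have choose n : exists phi : space -> C, [/\ test_function phi,
    nO (fun y => phi y - V_ n y) <= t ^+ n,
    forall i, nO (fun y => ThetaT_grad t1 t2 phi y i 0 - G_ n y i 0) <= t ^+ n &
    nS (fun z => phi (0, z) - Ps_ n z) <= t ^+ n].
  have [phi hphi] := hV n; have [tp _ _ a1 a2] := hphi.
  have a3 := has_trace_cvg (tV n) hphi.
  have tn0 : 0 < t ^+ n by rewrite exprn_gt0.
  have ev (u : nat -> R) : (forall j, 0 <= u j) -> u j @[j --> \oo] --> 0 ->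
      \forall j \near \oo, u j <= t ^+ n.
    move=> u0 /cvgrPdist_le/(_ _ tn0); apply: filterS => j.
    by rewrite sub0r normrN ger0_norm.
  have b1 := ev _ (fun j => sqnorm_ge0 _ _ _) ((cvg_L2E mO (fun j => test_L2 (tp j)) (V_2 n)).1 a1).
  have b2 i := ev _ (fun j => sqnorm_ge0 _ _ _)
    ((cvg_L2E mO (fun j => grad_L2 t1 t2 i (tp j)) (G_2 n i)).1 (a2 i)).
  have b3 := ev _ (fun j => sqnorm_ge0 _ _ _) ((cvg_L2E mS (fun j => trace_L2 0 (tp j)) (P_2 n)).1 a3).
  have b20 := b2 0; have b21 := b2 1.
  near \oo => j; exists (phi j); split.
  - exact: tp.
  - by near: j.
  - move=> i; have [->|->] : i = 0 \/ i = 1.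
      by case: i => -[|[|]]// ?; [left|right]; exact/val_inj.
    + by near: j; exact: b20.
    + by near: j; exact: b21.
  - by near: j.
have {choose} [phi hphi] := choice choose.
have cgeo (x : R) : x * t ^+ n @[n --> \oo] --> 0.
  rewrite -(mulr0 x); apply: cvgM; first exact: cvg_cst.
  by apply: cvg_expr; rewrite ger0_norm// ltW.
have cg1 : t ^+ n @[n --> \oo] --> 0 by apply: cvg_expr; rewrite ger0_norm// ltW.
have lim (f_ g_ : nat -> space -> C) f (x : R) : (forall j, L2O (f_ j)) -> (forall j, L2O (g_ j)) ->
    L2O f -> (forall j, nO (fun y => f_ j y - g_ j y) <= t ^+ j) ->
    (forall j, nO (fun y => g_ j y - f y) <= x * t ^+ j) -> cvg_L2 mu3 Omega f_ f.
  move=> F_ G2 F h1 h2; apply/(cvg_L2E mO) => //.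
  apply: (cvg0_squeeze2 _ _ cg1 (cgeo x)) => j; first exact: sqnorm_ge0.
  have -> : (fun y => f_ j y - f y) = (fun y => (f_ j y - g_ j y) + (g_ j y - f y)).
    by apply/funext => y; ring.
  apply: (le_trans (sqnormD_le mO (L2_B mO (F_ j) (G2 j)) (L2_B mO (G2 j) F))).
  by apply: lerD; apply: (ler_wpM2l (ler0n _ 2)).
have tp j : test_function (phi j) by have [] := hphi j.
pose G y := vec2 (G0 y) (G1 y).
have GE0 : (fun y => G y 0 0) = G0 by apply/funext => y; rewrite vec20.
have GE1 : (fun y => G y 1 0) = G1 by apply/funext => y; rewrite vec21.
have i01 (i : 'I_2) : i = 0 \/ i = 1.
  by case: i => -[|[|]]// ?; [left|right]; exact/val_inj.
have hA : H1_approx t1 t2 phi V G.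
  split=> //.
  - by move=> i; have [->|->] := i01 i; rewrite ?GE0 ?GE1.
  - by apply: (lim _ _ _ _ (fun j => test_L2 (tp j)) V_2 V2 _ cV) => j; have [] := hphi j.
  - move=> i; have [->|->] := i01 i; rewrite ?GE0 ?GE1.
      by apply: (lim _ _ _ _ (fun j => grad_L2 t1 t2 0 (tp j)) (fun j => G_2 j 0) G02 _ cG0) => j;
        have [_ _ h _] := hphi j; exact: h.
    by apply: (lim _ _ _ _ (fun j => grad_L2 t1 t2 1 (tp j)) (fun j => G_2 j 1) G12 _ cG1) => j;
      have [_ _ h _] := hphi j; exact: h.
exists V, G, Ps; split.
- by exists phi.
- split=> //; exists G, phi; split => //.
  apply/(cvg_L2E mS) => //; first by move=> j; exact: trace_L2.
  apply: (cvg0_squeeze2 _ _ cg1 (cgeo (2 / (1 - r) ^+ 2 * (8 * K / (1 - r ^+ 2))))) => j.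
    exact: sqnorm_ge0.
  have -> : (fun z => phi j (0, z) - Ps z) = (fun z => (phi j (0, z) - Ps_ j z) + (Ps_ j z - Ps z)).
    by apply/funext => z; ring.
  have tS := trace_L2 0 (tp j).
  apply: (le_trans (sqnormD_le mS (L2_B mS tS (P_2 j)) (L2_B mS (P_2 j) Ps2))).
  apply: lerD; apply: (ler_wpM2l (ler0n _ 2)); last exact: cP.
  by have [] := hphi j.
- move=> n; rewrite /energy.
  have hG' i : (fun y => (-1 *: G_ n y + G y) i 0) = (fun y => G y i 0 - G_ n y i 0).
    by apply/funext => y; rewrite comb_entryE mulN1r addrC.
  rewrite hB !hG'.
  have e0 : nO (fun y => G y 0 0 - G_ n y 0 0) = nO (fun y => G_ n y 0 0 - G0 y).
    by rewrite sqnormBC; apply: eq_Rintegral => y _; rewrite vec20.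
  have e1 : nO (fun y => G y 1 0 - G_ n y 1 0) = nO (fun y => G_ n y 1 0 - G1 y).
    by rewrite sqnormBC; apply: eq_Rintegral => y _; rewrite vec21.
  rewrite e0 e1 (sqnormBC _ _ V (V_ n)); apply: (le_trans (lerD (cV n) (lerD (cG0 n) (cG1 n)))).
  by rewrite le_eqVlt; apply/orP; left; apply/eqP; ring.
- exact: cP.
Unshelve. all: by end_near. Qed.

Section Resolvent.
Variables (q : R) (l : C).
Hypotheses (q0 : 0 < q)
  (Hq : forall U G, sol U G ->
    energy (fun y => U (shiftx 1 y)) (fun y => G (shiftx 1 y)) <= q * energy U G)
  (ql : q < rdot l l).

Lemma l_neq0 : l != 0.
Proof. by apply/eqP => l0; have := lt_trans q0 ql; rewrite l0 rdot0l ltxx. Qed.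

Notation mu := (l^-1).

Lemma rdot_inv : rdot mu mu * rdot l l = 1.
Proof. by rewrite -rdotMM mulVf ?l_neq0// /rdot /= mulr1 mulr0 addr0. Qed.

Lemma energy_iter U G n : sol U G ->
  energy (fun y => U (shiftx n%:R y)) (fun y => G (shiftx n%:R y)) <= q ^+ n * energy U G /\
  sol (fun y => U (shiftx n%:R y)) (fun y => G (shiftx n%:R y)).
Proof.
move=> sU; elim: n => [|n [IH1 IH2]].
  have -> : (fun y => U (shiftx 0%:R y)) = U by apply/funext => y; rewrite /shiftx scale0r addr0.
  have -> : (fun y => G (shiftx 0%:R y)) = G by apply/funext => y; rewrite /shiftx scale0r addr0.
  by rewrite expr0 mul1r.
have E (T : Type) (f : space -> T) : (fun y => f (shiftx n%:R (shiftx 1 y))) = (fun y => f (shiftx n.+1%:R y)).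
  by apply/funext => y; rewrite shiftxD addrC natr1.
have := Hq IH2; have := sol_shiftx1 hc IH2; rewrite !E => s1 h1; split => //.
by apply: (le_trans h1); rewrite exprS -mulrA ler_pM2l.
Qed.

(** The solution U attached to Th satisfies U(. + n e_x) = l^n U, whose squared norm is
|l|^(2n) |U|^2, while decay bounds it by q^n times the energy of U. *)
Lemma eigenfunction_eq0 Th : H Th -> eqae (P Th) (fun z => l * Th z) -> eqae Th (fun=> 0).
Proof.
move=> hTh ev.
have [[G sU] tU] := half_guide_sol (hU hTh).
set U := Uhat Th in sU tU.
have [U2 _] := H1_grad_L2 (sol_H1 sU).
have [s1 t1'] := sol_shift hc homega hU hP sU tU.
have U1 := sol_unique hc homega s1 t1' (sol_scale l sU) (has_trace_scale l tU) ev.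
have Un n : {ae mu3, forall y, Omega y -> U (shiftx n%:R y) = l ^+ n * U y}.
  elim: n => [|n IH].
    by apply: ae_on_all => y _; rewrite /shiftx scale0r addr0 expr0 mul1r.
  have := ae_shiftx (ler0n _ n) U1; apply: ae_on_impl2 IH => y _ e1 e2.
  by rewrite shiftxS e2 e1 exprS mulrA.
have prX n : rdot (l ^+ n) (l ^+ n) = rdot l l ^+ n.
  elim: n => [|n IH]; first by rewrite !expr0 /rdot /= mulr1 mulr0 addr0.
  by rewrite !exprS rdotMM IH.
have bound n : nO U <= (q / rdot l l) ^+ n * energy U G.
  have pl0 : 0 < rdot l l := lt_trans q0 ql.
  rewrite exprMn exprVn mulrAC ler_pdivlMr ?exprn_gt0// mulrC -prX.
  rewrite -(sqnormZ mO (l ^+ n) U2).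
  rewrite -(ae_eq_sqnorm mO _ _ (Un n)); last 2 first.
  - by apply: in_L2_shiftx.
  - exact: (L2_Z mO).
  by have [h _] := energy_iter n sU; apply: le_trans h; exact: sqnorm_le_energy.
have U0 : nO U = 0.
  apply/eqP; rewrite eq_le sqnorm_ge0 andbT.
  have pl0 : 0 < rdot l l := lt_trans q0 ql.
  have c0 : ((q / rdot l l) ^+ n * energy U G) @[n --> \oo] --> (0 * energy U G : R).
    apply: cvgM; last exact: cvg_cst.
    by apply: cvg_expr; rewrite ger0_norm ?divr_ge0 ?ltW// ltr_pdivrMr// mul1r.
  rewrite mul0r in c0; rewrite -(cvg_lim _ c0)//.
  apply: limr_ge; first by apply/cvg_ex; eexists; exact: c0.
  by near=> n; exact: bound.
have Z := sqnorm_eq0 mO U2 U0.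
have t0 := has_trace_ae tU (L2_0 mu3 Omega) (H12_L2 hTh) Z (eqae_refl _).
exact: has_trace_unique t0 (has_trace_00 c).
Unshelve. all: by end_near. Qed.

Lemma resolvent_inj Ps1 Ps2 : H Ps1 -> H Ps2 ->
  eqae (fun z => l * Ps1 z - P Ps1 z) (fun z => l * Ps2 z - P Ps2 z) -> eqae Ps1 Ps2.
Proof.
move=> h1 h2 e12.
have hT := H12_lin (-1) h1 h2.
have PL := P_lin hc homega hU hP (-1) h1 h2.
have ev : eqae (P (fun z => -1 * Ps1 z + Ps2 z)) (fun z => l * (-1 * Ps1 z + Ps2 z)).
  apply: ae_on_impl2 PL e12 => z _ -> e.
  have e0 : (l * Ps1 z - P Ps1 z) - (l * Ps2 z - P Ps2 z) = 0 by rewrite e subrr.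
  by apply/eqP; rewrite -subr_eq0; apply/eqP; rewrite -e0; ring.
have := eigenfunction_eq0 hT ev; apply: ae_on_impl => z _ /eqP.
by rewrite mulN1r addrC subr_eq0 => /eqP ->.
Qed.

(** The iterates of Psi |-> l^-1 P Psi + Phi1 are [Pseq]; [Vseq] and [Gseq] are the
solutions attached to them and their gradients. *)
Fixpoint Vseq (U1 : space -> C) (n : nat) : space -> C :=
  if n is n'.+1 then fun y => mu * Vseq U1 n' (shiftx 1 y) + U1 y else U1.
Fixpoint Gseq (G1 : space -> 'cV[C]_2) (n : nat) : space -> 'cV[C]_2 :=
  if n is n'.+1 then fun y => mu *: Gseq G1 n' (shiftx 1 y) + G1 y else G1.
Fixpoint Pseq (Phi1 : plane -> C) (n : nat) : plane -> C :=
  if n is n'.+1 then fun z => mu * P (Pseq Phi1 n') z + Phi1 z else Phi1.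

Lemma seq_sol U1 G1 Phi1 n : sol U1 G1 -> tr 0 U1 Phi1 ->
  sol (Vseq U1 n) (Gseq G1 n) /\ tr 0 (Vseq U1 n) (Pseq Phi1 n).
Proof.
move=> s1 tr1; elim: n => [|n [IH1 IH2]] //=.
have [s2 tr2] := sol_shift hc homega hU hP IH1 IH2.
by split; [exact: sol_lin|exact: has_trace_lin].
Qed.

Notation ratio := (rdot mu mu * q).

Lemma seq_diff U1 G1 n : sol U1 G1 ->
  sol (fun y => -1 * Vseq U1 n y + Vseq U1 n.+1 y) (fun y => -1 *: Gseq G1 n y + Gseq G1 n.+1 y) /\
  energy (fun y => -1 * Vseq U1 n y + Vseq U1 n.+1 y) (fun y => -1 *: Gseq G1 n y + Gseq G1 n.+1 y)
   <= energy U1 G1 * ratio ^+ n.+1.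
Proof.
move=> s1; elim: n => [|n [IH1 IH2]].
  have E1 : (fun y => -1 * Vseq U1 0 y + Vseq U1 1 y) = (fun y => mu * U1 (shiftx 1 y)).
    by apply/funext => y /=; ring.
  have E2 : (fun y => -1 *: Gseq G1 0 y + Gseq G1 1 y) = (fun y => mu *: G1 (shiftx 1 y)).
    by apply/funext => y /=; rewrite scaleN1r addrC addrK.
  have s2 := sol_shiftx1 hc s1.
  rewrite E1 E2; split; first exact: sol_scale.
  rewrite (energy_scale mu (sol_H1 s2)) expr1.
  have := ler_wpM2l (rdot_ge0 mu) (Hq s1); rewrite mulrCA mulrA => h; apply: (le_trans h).
  by rewrite le_eqVlt; apply/orP; left; apply/eqP; ring.
have E1 : (fun y => -1 * Vseq U1 n.+1 y + Vseq U1 n.+2 y) =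
    (fun y => mu * (-1 * Vseq U1 n (shiftx 1 y) + Vseq U1 n.+1 (shiftx 1 y))).
  by apply/funext => y /=; ring.
have E2 : (fun y => -1 *: Gseq G1 n.+1 y + Gseq G1 n.+2 y) =
    (fun y => mu *: (-1 *: Gseq G1 n (shiftx 1 y) + Gseq G1 n.+1 (shiftx 1 y))).
  apply/funext => y.
  have S j : Gseq G1 j.+1 y = mu *: Gseq G1 j (shiftx 1 y) + G1 y by [].
  rewrite (S n.+1) (S n); move: (Gseq G1 n (shiftx 1 y)) (Gseq G1 n.+1 (shiftx 1 y)) (G1 y) => A B D.
  by apply/matrixP => i j; rewrite !mxE; ring.
have s2 := sol_shiftx1 hc IH1.
rewrite E1 E2; split; first exact: (sol_scale mu s2).
rewrite (energy_scale mu (sol_H1 s2)).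
have h := ler_wpM2l (rdot_ge0 mu) (Hq IH1); apply: (le_trans h).
have r0 : 0 <= ratio by rewrite mulr_ge0 ?rdot_ge0// ltW.
rewrite mulrA exprS mulrCA; exact: ler_wpM2l.
Qed.

Lemma ratio_gt0 : 0 < ratio.
Proof.
rewrite mulr_gt0// lt_neqAle rdot_ge0 andbT eq_sym; apply/eqP => p0.
by have := rdot_inv; rewrite p0 mul0r => /eqP; rewrite eq_sym oner_eq0.
Qed.

Lemma ratio_lt1 : ratio < 1.
Proof.
rewrite -rdot_inv; have : 0 < rdot mu mu by have := ratio_gt0; rewrite pmulr_lgt0.
by move=> p0; rewrite ltr_pM2l.
Qed.

(** The iterates converge by [seq_diff] and [H1_complete]. The a priori estimate bounds the
trace at x = 1 of a solution by the energy of any lift of its data, so that P may be applied to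
the limit. *)
Lemma fixed_point : exists2 K : R, 0 < K & forall U1 G1 Phi1, sol U1 G1 -> tr 0 U1 Phi1 ->
  exists V G Ps, [/\ H1_grad t1 t2 V G, tr 0 V Ps, energy V G <= K * energy U1 G1 &
    eqae Ps (fun z => mu * P Ps z + Phi1 z)].
Proof.
have [K K0 HK] := apriori k hc homega.
(* [H1_complete] is stated with increments decreasing like r^(4n). *)
pose r := Num.sqrt (Num.sqrt ratio).
have r0 : 0 < r by rewrite !sqrtr_gt0 ratio_gt0.
have r4 : r ^+ 4 = ratio.
  by rewrite (exprM r 2 2) /r !sqr_sqrtr ?sqrtr_ge0// ltW// ratio_gt0.
have r1 : r < 1.
  by rewrite -(expr_lt1 (n := 4)) ?ltW// r4 ratio_lt1.
have r1' : 0 < 1 - r by rewrite subr_gt0.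
have r21 : r ^+ 2 < 1 by rewrite expr_lt1// ltW.
have r21' : 0 < 1 - r ^+ 2 by rewrite subr_gt0.
pose c0 := 2 / (1 - r) ^+ 2 * (1 / (1 - r ^+ 2)).
have c00 : 0 < c0 by rewrite /c0; apply: mulr_gt0; apply: divr_gt0 => //; exact: exprn_gt0.
exists (6 * c0 + 2); first by apply: addr_gt0 => //; exact: mulr_gt0.
move=> U1 G1 Phi1 s1 tr1.
set E := energy U1 G1.
have E0 : 0 <= E := energy_ge0 _ _.
have sV n := (seq_sol n s1 tr1).1; have tV n := (seq_sol n s1 tr1).2.
have hE n : energy (fun y => -1 * Vseq U1 n y + Vseq U1 n.+1 y)
    (fun y => -1 *: Gseq G1 n y + Gseq G1 n.+1 y) <= E * r ^+ 4 ^+ n.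
  have [_ h] := seq_diff n s1; apply: (le_trans h); rewrite r4 exprS.
  apply: (ler_wpM2l E0); rewrite -[leRHS]mul1r; apply: ler_wpM2r; last exact: ltW ratio_lt1.
  by rewrite exprn_ge0// ltW// ratio_gt0.
have [V [G [Ps [hV tP eV eP]]]] := H1_complete r0 r1 (fun n => sol_H1 (sV n)) tV hE.
exists V, G, Ps; split=> //.
  have h0 := eV 0; rewrite expr0 mulr1 in h0.
  have h := energyD_le (H1_grad_lin (-1) (sol_H1 (sV 0)) hV) (sol_H1 (sV 0))
    (W := V) (GW := G) _ _.
  apply: (le_trans (h _ _)).
  - by move=> y; ring.
  - by move=> y; rewrite scaleN1r addrC addNKr.
  have h1 := lerD (ler_wpM2l (ler0n R 2) h0) (lexx (2 * E)).
  apply: (le_trans h1); rewrite le_eqVlt; apply/orP; left; apply/eqP; rewrite /c0; ring.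
have hPs : H Ps by exists V.
have [[GP sP] tUP] := half_guide_sol (hU hPs).
have P2 : in_L2 mu2 Sigma (P Ps) := H12_L2 (P_H12 hP hPs).
have Ps2 := H12_L2 hPs.
have Pn2 n : in_L2 mu2 Sigma (Pseq Phi1 n) := has_trace_L2 (tV n).
have HPn n : H (Pseq Phi1 n) by exists (Vseq U1 n).
have PPn2 n : in_L2 mu2 Sigma (P (Pseq Phi1 n)) := H12_L2 (P_H12 hP (HPn n)).
pose t := r ^+ 2.
have bnd n : nS (fun z => P (Pseq Phi1 n) z - P Ps z) <= (8 * (q * (K * (3 * c0 * E)))) * t ^+ n.
  have sD := sol_lin (-1) (sV n) sP; have tD := has_trace_lin (-1) (tV n) tUP.
  have [sS tS] := sol_shift hc homega hU hP sD tD.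
  have h1 := trace_energy (sol_H1 sS) tS.
  have h2 := Hq sD.
  have h3 := HK _ _ _ _ _ sD tD (H1_grad_lin (-1) (sol_H1 (sV n)) hV) (has_trace_lin (-1) (tV n) tP).
  have PL := P_lin hc homega hU hP (-1) (HPn n) hPs.
  have HD := H12_lin (-1) (HPn n) hPs.
  have e1 := ae_eq_sqnorm mS (H12_L2 (P_H12 hP HD)) (L2_lin mS (-1) (PPn2 n) P2) PL.
  rewrite sqnormBC.
  have -> : (fun z => P Ps z - P (Pseq Phi1 n) z) = (fun z => -1 * P (Pseq Phi1 n) z + P Ps z).
    by apply/funext => z; rewrite mulN1r addrC.
  rewrite -e1; apply: (le_trans h1); rewrite -[leRHS]mulrA; apply: (ler_wpM2l (ler0n _ 8)).
  apply: (le_trans h2); rewrite -[leRHS]mulrA; apply: (ler_wpM2l (ltW q0)).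
  apply: (le_trans h3); rewrite -[leRHS]mulrA; apply: (ler_wpM2l (ltW K0)).
  apply: (le_trans (eV n)); rewrite le_eqVlt; apply/orP; left; apply/eqP; rewrite /c0 /t; ring.
have X0 : nS (fun z => Ps z - (mu * P Ps z + Phi1 z)) = 0.
  set X := nS _.
  have cg (x : R) : x * t ^+ n @[n --> \oo] --> 0.
    rewrite -(mulr0 x); apply: cvgM; first exact: cvg_cst.
    by apply: cvg_expr; rewrite ger0_norm// exprn_ge0// ltW.
  have hX : (fun _ : nat => X) @ \oo --> (0 : R).
    apply: (cvg0_squeeze2 _ _ (cg (2 / (1 - r) ^+ 2 * (8 * E / (1 - r ^+ 2)) * t))
      (cg (rdot mu mu * (8 * (q * (K * (3 * c0 * E))))))) => n; first exact: sqnorm_ge0.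
    have hs : L2S (fun z => mu * (P (Pseq Phi1 n) z - P Ps z)) by apply: (L2_Z mS); exact: (L2_B mS).
    rewrite /X; have -> : (fun z => Ps z - (mu * P Ps z + Phi1 z)) =
        (fun z => (Ps z - Pseq Phi1 n.+1 z) + mu * (P (Pseq Phi1 n) z - P Ps z)).
      by apply/funext => z /=; ring.
    apply: (le_trans (sqnormD_le mS (L2_B mS Ps2 (Pn2 n.+1)) hs)).
    rewrite (sqnormZ mS mu (L2_B mS (PPn2 n) P2)).
    apply: lerD; apply: (ler_wpM2l (ler0n _ 2)).
      rewrite sqnormBC; apply: (le_trans (eP n.+1)).
      by rewrite (exprS (r ^+ 2) n) mulrA lexx.
    by rewrite -mulrA; apply: ler_wpM2l; [exact: rdot_ge0|exact: bnd].
  exact: (cvg_unique _ (cvg_cst X) hX).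
have L : L2S (fun z => mu * P Ps z + Phi1 z).
  by apply: (L2_lin mS) => //; exact: has_trace_L2 tr1.
have := sqnorm_eq0 mS (L2_B mS Ps2 L) X0; apply: ae_on_impl => z _ /eqP.
by rewrite subr_eq0 => /eqP.
Qed.

(** Apply [fixed_point] to the data l^-1 Phi. *)
Lemma resolvent_exists : exists2 K : R, 0 < K & forall Phi, H Phi -> exists Ps,
  [/\ H Ps, eqae (fun z => l * Ps z - P Ps z) Phi &
    forall W GW, H1_grad t1 t2 W GW -> tr 0 W Phi ->
      exists V G, [/\ H1_grad t1 t2 V G, tr 0 V Ps & energy V G <= K * energy W GW]].
Proof.
have [K K0 HK] := apriori k hc homega; have [K' K'0 HK'] := fixed_point.
have pm0 : 0 < rdot mu mu by have := ratio_gt0; rewrite pmulr_lgt0.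
exists (K' * (K * rdot mu mu)); first by rewrite !mulr_gt0.
move=> Phi hPhi; have [[G1 s1] tr1] := half_guide_sol (hU (H12_scale mu hPhi)).
have [V [G [Ps [hV tV eV fp]]]] := HK' _ _ _ s1 tr1.
exists Ps; split; first by exists V.
- apply: ae_on_impl fp => z _ e; rewrite {1}e mulrDr !mulrA divff ?l_neq0// !mul1r.
  by rewrite addrAC subrr add0r.
move=> W GW hW tW; exists V, G; split=> //; apply: (le_trans eV); rewrite -mulrA ler_pM2l//.
have := HK _ _ _ _ _ s1 tr1 (H1_grad_scale mu hW) (has_trace_scale mu tW).
by rewrite (energy_scale mu hW) mulrA.
Qed.

(** A right inverse exists by [resolvent_exists]; injectivity makes it linear, compatible
with almost everywhere equality, and a left inverse. *)
Lemma resolvent : resolvent_set t1 t2 P l.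
Proof.
have [K K0 HK] := resolvent_exists.
have /choice[S hS] : forall Phi, exists Ps, H Phi -> [/\ H Ps, eqae (fun z => l * Ps z - P Ps z) Phi &
    forall W GW, H1_grad t1 t2 W GW -> tr 0 W Phi ->
      exists V G, [/\ H1_grad t1 t2 V G, tr 0 V Ps & energy V G <= K * energy W GW]].
  move=> Phi; have [h|h] := pselect (H Phi); last by exists Phi.
  by have [Ps] := HK Phi h; exists Ps.
have HS Phi : H Phi -> H (S Phi) by move=> /hS[].
have ES Phi : H Phi -> eqae (fun z => l * S Phi z - P (S Phi) z) Phi by move=> /hS[].
exists S; split=> //.
  split=> //.
  - move=> Phi Psi h1 h2 e; apply: resolvent_inj; [exact: HS|exact: HS|].
    exact: eqae_trans (ES _ h1) (eqae_trans e (eqae_sym (ES _ h2))).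
  - move=> a Phi Psi h1 h2.
    have hl := H12_lin a h1 h2; have hr := H12_lin a (HS _ h1) (HS _ h2).
    apply: resolvent_inj; [exact: HS|exact: hr|].
    apply: eqae_trans (ES _ hl) _.
    have PL := P_lin hc homega hU hP a (HS _ h1) (HS _ h2).
    have e12 : eqae (fun z => a * Phi z + Psi z)
      (fun z => a * (l * S Phi z - P (S Phi) z) + (l * S Psi z - P (S Psi) z)).
      by apply: ae_on_impl2 (ES _ h1) (ES _ h2) => z _ -> ->.
    by apply: ae_on_impl2 PL e12 => z _ -> ->; ring.
  - by apply: (@operator_bound _ c K) => // Phi h; have [_ _] := hS _ h; exact.
- move=> Phi h.
  have hl : H (fun z => l * Phi z - P Phi z).
    have := H12_lin (-1) (P_H12 hP h) (H12_scale l h).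
    by have -> // : (fun z => -1 * P Phi z + l * Phi z) = (fun z => l * Phi z - P Phi z);
      apply/funext => z; rewrite mulN1r addrC.
  by apply: resolvent_inj; [exact: HS|exact: h|exact: ES].
Qed.

End Resolvent.

Lemma spectral_radius_lt1 : (spectral_radius t1 t2 P < 1%:E)%E.
Proof.
have [q [q0 q1 Hq]] := decay k hc homega.
apply: (@le_lt_trans _ _ (Num.sqrt q)%:E); last first.
  by rewrite lte_fin -sqrtr1 ltr_sqrt.
apply: ge_ereal_sup => _ [l hl <-]; rewrite lee_fin.
rewrite -[leLHS]ger0_norm; last by case: l {hl} => ? ?; exact: sqrtr_ge0.
rewrite -sqrtr_sqr sqr_normcE ler_wsqrtr// leNgt; apply/negP => ql.
by apply: hl; exact: resolvent q0 Hq ql.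
Qed.

End Spectrum.

Theorem proposition4p10 (R : realType) (m : medium R) (c : configuration R)
  (hc : compatible c m)
  (omega : R[i]) (homega : 0 < complex.Im omega)
  (k : R) (hk : - pi < k < pi)
  (Uhat : (R * R -> R[i]) -> (R * (R * R) -> R[i]))
  (hU : forall Phi, H12 (theta1 c) (theta2 c) Phi ->
     half_guide_solution m c omega k Phi (Uhat Phi))
  (P : (R * R -> R[i]) -> (R * R -> R[i]))
  (hP : forall Phi, H12 (theta1 c) (theta2 c) Phi ->
     has_trace (theta1 c) (theta2 c) 1 (Uhat Phi) (P Phi)) :
  [/\ bounded_operator (theta1 c) (theta2 c) P,
      forall Phi, H12 (theta1 c) (theta2 c) Phi ->
        (forall n : nat, {ae mu3, forall y, Omega y ->
           Uhat Phi (y + n%:R *: e_x) = Uhat (iter n P Phi) y}) /\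
        (forall n : nat,
           has_trace (theta1 c) (theta2 c) n (Uhat Phi) (iter n P Phi)) &
      (spectral_radius (theta1 c) (theta2 c) P < 1%:E)%E].
Proof.
split.
- exact: (P_bounded hc homega hU hP).
- by move=> Phi hPhi; exact: (P_iter hc homega hU hP hPhi).
- exact: (spectral_radius_lt1 hc homega hU hP).
Qed.
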